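(* Let $p>0$ be odd, $q$ an integer relatively prime to $p$, and let $K=K(p,q)\subset S^3$ be the 2-bridge knot whose 2-fold branched cover is the lens space $L(p,q)$, equipped with the 2-tangle decomposition $(S^3,K)=(Y,T)\cup(D,U)$ described in the context. Then $L_1:R(Y,T)\to P$ is a linearly embedded arc of slope $\frac{q-p}{q}$, and hence a restricted immersed arc. Taking $L_0=L_0^{\epsilon,0}$ with $\epsilon>0$ small, $C(L_0,L_1)$ has rank $p$, generated by the points $r_+^\epsilon$ and $x_\ell^+,x_\ell^-$, $\ell=1,\dots,\frac{p-1}{2}$. The $\mathbb Z/4$ grading is determined by $$gr(r_+^\epsilon)=\sigma(K),\qquad gr(x_\ell^+,x_\ell^-)=1,$$ and, letting $x_\ell^\circ$ denote $x_\ell^+$ if $\left|\frac{q-p}{q}\right|>1$ and $x_\ell^-$ if $\left|\frac{q-p}{q}\right|<1$, $$gr(r_+^\epsilon,x_\ell^\circ)=z(\alpha),$$ where $\alpha$ is the loop in $P^*$ which starts at $r_+^\epsilon$, follows $L_0$ to $x_\ell^\circ$, then returns to $r_+^\epsilon$ along $L_1$. All differentials are zero and hence $C(L_0,L_1)\cong H^\natural(Y,T)$.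
   Context: Pillowcase: $P=\mathbb R^2/G$ where $G$ is generated by $(\gamma,\theta)\mapsto(\gamma+2\pi,\theta)$, $(\gamma,\theta)\mapsto(\gamma,\theta+2\pi)$, $(\gamma,\theta)\mapsto(-\gamma,-\theta)$; the corners are the images of $(\pi\mathbb Z)^2$, and $P^*$ is $P$ minus the corners. $\ell_1$ is the line field on $P^*$ of slope 1; $z\in H^1(P^*;\mathbb Z/4)$ is the unique class with value $1$ on each small loop circling a corner counterclockwise. Traceless character varieties: $SU(2)$ is the group of unit quaternions. For a manifold $A$ and properly embedded codimension 2 submanifold $B$, $R(A,B)$ is the space of conjugacy classes of representations $\pi_1(A\setminus B)\to SU(2)$ sending meridians of $B$ to purely imaginary unit quaternions. For the 4-punctured sphere, with meridians $a,b,c,d$ satisfying $ba=cd$, $R(S^2,\{a,b,c,d\})\cong P$ via $(\gamma,\theta)\mapsto(a\mapsto \mathbf i,\ b\mapsto e^{\gamma\mathbf k}\mathbf i,\ c\mapsto e^{\theta\mathbf k}\mathbf i,\ d\mapsto e^{(\theta-\gamma)\mathbf k}\mathbf i)$. $(S^3,K)$ is decomposed along a 2-sphere meeting $K$ in four points into a trivial 2-tangle $(D,U)$ in a 3-ball and the complementary (also trivial) 2-tangle $(Y,T)$, the decomposition being determined by a continued fraction expansion of $p/q$; the fact recalled from earlier work is that for this decomposition $R(Y,T)$ is a smooth arc, $R(Y,T)\cong[0,\pi]$, and the restriction map $L_1:R(Y,T)\to R(S^2,\{a,b,c,d\})=P$ is $t\mapsto(qt,(q-p)t)$. $L_0^{\epsilon,0}:S^1\to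 P^*$ is the image in $P$ of $t\mapsto(t+\epsilon\sin t+\frac\pi2,\ t-\epsilon\sin t+\frac\pi2)$, $t\in[0,2\pi]$ (period $2\pi$ in $P$). It is close to the diagonal arc $\Delta=\{(\gamma,\gamma):\gamma\in[0,\pi]\}$. $L_1$ meets $\Delta$ in the points $x_\ell=(q\frac{2\pi\ell}{p},(q-p)\frac{2\pi\ell}{p})$, $\ell=0,\dots,\frac{p-1}2$. For $\ell>0$, $x_\ell^+$ (resp. $x_\ell^-$) is the intersection point of $L_1$ with $L_0$ close to $x_\ell$ lying on the part of $L_0$ of slope slightly less than 1 (resp. slightly greater than 1). $r_+^\epsilon$ is the unique continuously varying intersection point of $L_0^{\epsilon,0}$ and $L_1$ with $\lim_{\epsilon\to0}r_+^\epsilon=x_0=(0,0)$. Maslov index: for a path $\alpha$ in the domain of an immersed curve $L$, $\mu(L,\ell_1)_\alpha$ is the degree of the path of tangent lines measured relative to $\ell_1$ in the circle of lines (counterclockwise positive, rotation by $\pi$ being one full turn; degree is the signed count of preimages of the line rotated by an arbitrarily small positive angle from $\ell_1$). $\tau(m_0,m_1,\ell_1)\in\{0,1\}$ is minus the degree of the shortest clockwise path of lines from $m_0$ to $m_1$. Restricted immersed arc: the image in $P$ of a smooth immersion $\widetilde L:I\to\mathbb R^2$ taking endpoints to $(\pi\mathbb Z)^2$ and interior to the complement of $(\pi\mathbb Z)^2$, such that after removing small neighborhoods of the corners it is an immersed arc with distinct endpoints on, and transverse to, the boundary whose lifts to the universal cover are embedded. Complex: $C(L_0,L_1)$ is the $\mathbb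 F_2$ vector space on the intersection points of $L_0,L_1$ (pairs of parameters with the same image in $P^*$). The differential is $\partial x=\sum_y \#\mathcal M(x,y)\,y$, where $\mathcal M(x,y)$ is the set of orientation preserving immersed bigons in $P^*$ with convex corners $x,y$, up to reparametrization, whose clockwise boundary runs along $L_0$ from $y$ to $x$ and then along $L_1$ from $x$ to $y$. $H^\natural(Y,T)$ is its homology. Relative grading: $gr(x,y)=\mu(L_0,\ell_1)_{\alpha_0}+\mu(L_1,\ell_1)_{\alpha_1}+\tau(L_0,L_1,\ell_1)_x-\tau(L_0,L_1,\ell_1)_y+z(L_0(\alpha_0)*L_1(\alpha_1))\in\mathbb Z/4$ for any path $\alpha_0$ along $L_0$ from $x$ to $y$ and $\alpha_1$ along $L_1$ from $y$ to $x$. It is promoted to an absolute grading $gr(x)\in\mathbb Z/4$ with $gr(x,y)=gr(x)-gr(y)$ by the convention $gr(r_+^\epsilon)=\sigma(K)\bmod 4$, $\sigma(K)$ the knot signature. *)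

(* Defs.v *)
From HB Require Import structures.
From mathcomp Require Import all_boot all_order all_algebra finmap.
From mathcomp Require Import all_classical all_reals all_analysis.

Set Implicit Arguments.
Unset Strict Implicit.
Unset Printing Implicit Defensive.

Import Order.TTheory GRing.Theory Num.Theory.
Import numFieldNormedType.Exports.

Local Open Scope classical_set_scope.
Local Open Scope ring_scope.
Local Open Scope quotient_scope.

Section Pillowcase.
Context {R : realType}.

(* The elements of the group G are the maps v |-> +-v + 2 pi (m, n). *)
Definition same_orbit (v w : R * R) : bool :=
  `[< exists (s : bool) (m n : int),
        w = ((-1) ^+ s * v.1 + 2 * pi * m%:~R,
             (-1) ^+ s * v.2 + 2 * pi * n%:~R) >].

Lemma same_orbit_equiv : equiv_class_of same_orbit.
Proof.
have sym v w : same_orbit v w -> same_orbit w v.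
  move=> /asboolP[s [m [n ->]]]; apply/asboolP.
  exists s, (- (-1) ^+ s * m), (- (-1) ^+ s * n); case: v => a b /=.
  rewrite !mulNr !intrN !intrM !rmorphXn/= !rmorphN1.
  by congr pair; case: s; rewrite /= ?expr1 ?expr0 ?mulN1r ?mul1r ?opprD ?opprK
    ?mulrN ?mulNr ?opprK ?addrNK ?addrK.
have trans u v w : same_orbit u v -> same_orbit v w -> same_orbit u w.
  move=> /asboolP[s [m [n ->]]] /asboolP[s' [m' [n' ->]]]; apply/asboolP.
  exists (s' (+) s), ((-1) ^+ s' * m + m'), ((-1) ^+ s' * n + n').
  case: u => a b /=; rewrite !intrD !intrM !rmorphXn/= !rmorphN1.
  by congr pair; rewrite signr_addb !mulrDr addrA mulrA;
    congr (_ + _ + _); rewrite mulrCA.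
split.
- move=> v; apply/asboolP; exists false, 0, 0.
  by rewrite expr0 !mul1r !mulr0 !addr0; case: v.
- by move=> v w; apply/idP/idP; exact: sym.
- by move=> v u w uv vw; exact: trans uv vw.
Qed.

Canonical same_orbit_equivRel := EquivRelPack same_orbit_equiv.
Canonical same_orbit_encModRel := defaultEncModRel same_orbit.

End Pillowcase.

Definition pillow (R : realType) : topologicalType :=
  quotient_topology {eq_quot (@same_orbit R)}.

Section Geometry.
Context {R : realType}.
Implicit Types T : topologicalType.

Definition proj (v : R * R) : pillow R := (\pi_({eq_quot (@same_orbit R)}) v)%qT.

Definition lattice : set (R * R) :=
  [set v | exists m n : int, v = (pi * m%:~R, pi * n%:~R)].

Definition pillow_star : set (pillow R) := ~` (proj @` lattice).

Definition cross (v w : R * R) : R := v.1 * w.2 - v.2 * w.1.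
Definition dot (v w : R * R) : R := v.1 * w.1 + v.2 * w.2.
Definition enorm (v : R * R) : R := Num.sqrt (dot v v).
Definition dir (theta : R) : R * R := (cos theta, sin theta).

(* Curves in the pillowcase are given by lifts R -> R^2; the line tangent to
   the curve does not depend on the lift because -1 preserves lines. *)
Definition velocity (L : R -> R * R) (s : R) : R * R :=
  (derive1 (fun u => (L u).1) s, derive1 (fun u => (L u).2) s).

(* A path is a function on R of which only the restriction to [0, 1] matters. *)
Definition path_in T (A : set T) (g : R -> T) : Prop :=
  {within `[0, 1]%classic, continuous g} /\
  forall u, 0 <= u <= 1 -> A (g u).

Definition concat T (g h : R -> T) (u : R) : T :=
  if u <= 2^-1 then g (2 * u) else h (2 * u - 1).

Definition null_homotopic T (g : R -> T) : Prop :=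
  exists H : R * R -> T,
  [/\ {within [set w : R * R | 0 <= w.1 <= 1 /\ 0 <= w.2 <= 1], continuous H},
      forall u, 0 <= u <= 1 -> H (u, 0) = g u,
      forall u, 0 <= u <= 1 -> H (u, 1) = g 0 &
      forall v, 0 <= v <= 1 -> H (0, v) = g 0 /\ H (1, v) = g 0].

Definition simply_connected T : Prop :=
  [/\ inhabited T,
      forall x y : T, exists g, [/\ path_in setT g, g 0 = x & g 1 = y] &
      forall g : R -> T, path_in setT g -> g 0 = g 1 -> null_homotopic g].

Definition covering_of T (A : set T) (E : topologicalType) (c : E -> T) : Prop :=
  [/\ continuous c, forall e, A (c e) &
   forall x, A x -> exists U : set T, [/\ open U, U x &
     exists (I : Type) (V : I -> set E) (s : I -> T -> E),
     [/\ forall i, open (V i),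
         forall i j e, V i e -> V j e -> i = j,
         forall e, U (c e) <-> exists i, V i e &
         forall i, [/\ {within U `&` A, continuous (s i)},
           forall y, U y -> A y -> V i (s i y) /\ c (s i y) = y &
           forall e, V i e -> s i (c e) = e]]]].

Definition universal_cover_of T (A : set T) (E : topologicalType) (c : E -> T) :=
  covering_of A c /\ simply_connected E.

Definition simplex2 : set (R * R) :=
  [set w | [/\ 0 <= w.1, 0 <= w.2 & w.1 + w.2 <= 1]].

(* Singular 1-cocycles of A with coefficients in Z/4. The value of a
   cohomology class on a loop is the value of any cocycle representing it. *)
Definition cocycle T (A : set T) (z : (R -> T) -> 'Z_4) : Prop :=
  (forall g h : R -> T, path_in A g ->
     (forall u, 0 <= u <= 1 -> g u = h u) -> z g = z h) /\
  forall sigma : R * R -> T,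
    {within simplex2, continuous sigma} ->
    (forall w, simplex2 w -> A (sigma w)) ->
    z (fun u => sigma (1 - u, u)) - z (fun u => sigma (0, u))
      + z (fun u => sigma (u, 0)) = 0.

(* A half turn around a lattice point in R^2 is a full loop in the pillowcase. *)
Definition corner_loop (m n : int) (rho : R) (u : R) : pillow R :=
  proj (pi * m%:~R + rho * cos (pi * u), pi * n%:~R + rho * sin (pi * u)).

Definition represents_z (z : (R -> pillow R) -> 'Z_4) : Prop :=
  cocycle pillow_star z /\
  forall m n rho, 0 < rho < pi / 2 -> z (corner_loop m n rho) = 1.

(* The slope is dy/dx in the projective line, so that dx = 0 is allowed. *)
Definition linearly_embedded_arc (a b : R) (L : R -> pillow R) (dy dx : R) :=
  (exists v0 v : R * R, [/\ v != 0, v.2 * dx = v.1 * dy &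
     forall t, a <= t <= b ->
       L t = proj (v0.1 + t * v.1, v0.2 + t * v.2)]) /\
  (forall s t, a <= s <= b -> a <= t <= b -> L s = L t -> s = t).

Definition smooth_on (a b : R) (f : R -> R) : Prop :=
  exists a' b', [/\ a' < a, b < b' &
    forall (n : nat) t, a' < t < b' -> derivable (derive1n n f) t 1].

Definition corner_nbhd (delta : R) : set (pillow R) :=
  proj @` [set v | exists2 c, lattice c & enorm (v - c) < delta].

Definition transverse_to_boundary (delta : R) (L : R -> R * R) (t : R) :=
  exists c, [/\ lattice c, enorm (L t - c) = delta &
                dot (L t - c) (velocity L t) != 0].

Definition restricted_immersed_arc (a b : R) (L : R -> pillow R) : Prop :=
  exists Lt : R -> R * R,
  [/\ [/\ smooth_on a b (fun t => (Lt t).1), smooth_on a b (fun t => (Lt t).2),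
          forall t, a <= t <= b -> velocity Lt t != 0 &
          forall t, a <= t <= b -> L t = proj (Lt t)],
      [/\ lattice (Lt a), lattice (Lt b) &
          forall t, a < t < b -> ~ lattice (Lt t)] &
      exists2 delta0, 0 < delta0 & forall delta, 0 < delta < delta0 ->
        exists a' b', [/\ a < a', a' < b', b' < b &
          [/\ forall t, a <= t <= b ->
                (~ corner_nbhd delta (L t) <-> a' <= t <= b'),
              L a' <> L b',
              transverse_to_boundary delta Lt a',
              transverse_to_boundary delta Lt b' &
              forall (E : topologicalType) (c : E -> pillow R),
                universal_cover_of (~` corner_nbhd delta) c ->
                forall g : R -> E, {within `[a', b']%classic, continuous g} ->
                (forall t, a' <= t <= b' -> c (g t) = L t) ->
                forall s t, a' <= s <= b' -> a' <= t <= b' ->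
                  g s = g t -> s = t]]].

Definition crossing_sign (f : R -> R) (u : R) (n : int) : Prop :=
  [\/ [/\ \forall x \near u^'-, f x < 0, \forall x \near u^'+, 0 < f x & n = 1],
      [/\ \forall x \near u^'-, 0 < f x, \forall x \near u^'+, f x < 0 & n = - 1],
      [/\ \forall x \near u^'-, f x < 0, \forall x \near u^'+, f x < 0 & n = 0] |
      [/\ \forall x \near u^'-, 0 < f x, \forall x \near u^'+, 0 < f x & n = 0]].

(* v u, for u in [0, 1], spans the u-th line of the path. The preimages of the
   line R w are the zeros of cross w v; at such a zero the line turns
   counterclockwise through R w when cross w v * dot w v, which does not change
   when v is replaced by - v, changes sign from - to +. *)
Definition is_degree (v : R -> R * R) (n : int) : Prop :=
  exists2 eta0 : R, 0 < eta0 & forall eta, 0 < eta < eta0 ->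
    let w := dir (pi / 4 + eta) in
    exists (us : seq R) (sg : R -> int),
    [/\ uniq us,
        forall u, 0 <= u <= 1 -> (cross w (v u) = 0 <-> u \in us),
        forall u, u \in us -> 0 < u < 1 /\
          crossing_sign (fun x => cross w (v x) * dot w (v x)) u (sg u) &
        n = \sum_(u <- us) sg u].

Definition is_maslov (L : R -> R * R) (alpha : R -> R) (n : int) : Prop :=
  is_degree (fun u => velocity L (alpha u)) n.

Definition is_tau (m0 m1 : R * R) (n : int) : Prop :=
  exists theta phi, [/\ 0 <= phi < pi,
    cross m0 (dir theta) = 0, cross m1 (dir (theta - phi)) = 0 &
    is_degree (fun u => dir (theta - u * phi)) (- n)].

Fixpoint Ck (k : nat) (U : set (R * R)) (f : R * R -> R * R) : Prop :=
  (forall w, U w -> {for w, continuous f}) /\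
  if k is k'.+1 then
    [/\ forall w, U w -> derivable f w (1, 0) /\ derivable f w (0, 1),
        Ck k' U (fun w => 'D_(1, 0) f w) & Ck k' U (fun w => 'D_(0, 1) f w)]
  else True.

Definition smooth2 (U : set (R * R)) f : Prop := forall k, Ck k U f.

Definition jacobian (f : R * R -> R * R) (w : R * R) : R :=
  cross ('D_(1, 0) f w) ('D_(0, 1) f w).

(* Source of the bigons: its two corners are (-1, 0) and (1, 0), and both are
   convex. *)
Definition half_disc : set (R * R) :=
  [set w | w.1 ^+ 2 + w.2 ^+ 2 <= 1 /\ 0 <= w.2].

Definition half_disc_diffeo (phi : R * R -> R * R) : Prop :=
  exists psi U,
  [/\ open U, half_disc `<=` U,
      smooth2 U phi /\ smooth2 U psi,
      forall w, half_disc w -> [/\ half_disc (phi w), half_disc (psi w),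
        psi (phi w) = w, phi (psi w) = w & 0 < jacobian phi w] &
      phi (-1, 0) = (-1, 0) /\ phi (1, 0) = (1, 0)].

Definition oriented_immersion (u : R * R -> pillow R) : Prop :=
  forall w, half_disc w -> exists U f,
    [/\ open U, U w, smooth2 U f, forall w', U w' -> 0 < jacobian f w' &
        forall w', U w' -> half_disc w' -> u w' = proj (f w')].

End Geometry.

Section Homology.
Variables (V : vectType 'F_2) (d : 'End(V)).

Definition cycles := subvs_of (lker d).
Definition boundary_pred (c : cycles) : bool := vsval c \in limg d.

Lemma boundary_zmod_closed : zmod_closed boundary_pred.
Proof.
split; first by rewrite /in_mem/= /boundary_pred linear0 mem0v.
move=> x y; rewrite /in_mem/= /boundary_pred => hx hy; rewrite raddfB/=; exact: memvB.
Qed.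

Definition boundaries : zmodClosed cycles :=
  HB.pack boundary_pred
    (GRing.isZmodClosed.Build cycles boundary_pred boundary_zmod_closed).

Definition homology : Type := Quotient.quot boundaries.
HB.instance Definition _ := GRing.Zmodule.on homology.

Definition homology_class (c : cycles) : homology :=
  \pi_(Quotient.quot boundaries) c.

Definition homology_scale (a : 'F_2) (x : homology) : homology :=
  homology_class (a *: (repr (x : Quotient.quot boundaries))).

Lemma homology_scaleE a c :
  homology_scale a (homology_class c) = homology_class (a *: c).
Proof.
apply/eqP; rewrite /homology_scale /homology_class -Quotient.idealrBE.
rewrite -scalerBr unfold_in /boundary_pred linearZ/= memvZ//.
have : \pi_(Quotient.quot boundaries)
   (repr (\pi_(Quotient.quot boundaries) c)) ==
   \pi_(Quotient.quot boundaries) c by rewrite reprK.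
by rewrite -Quotient.idealrBE.
Qed.

Lemma homology_classP (x : homology) : exists c, x = homology_class c.
Proof. by exists (repr (x : Quotient.quot boundaries)); rewrite /homology_class reprK. Qed.

Lemma homology_classD c c' :
  homology_class (c + c') = homology_class c + homology_class c'.
Proof. exact: (raddfD (\pi_(Quotient.quot boundaries))). Qed.

Lemma homology_scaleA a b x :
  homology_scale a (homology_scale b x) = homology_scale (a * b) x.
Proof. by have [c ->] := homology_classP x; rewrite !homology_scaleE scalerA. Qed.

Lemma homology_scale1 : left_id 1 homology_scale.
Proof. by move=> x; have [c ->] := homology_classP x; rewrite homology_scaleE scale1r. Qed.

Lemma homology_scaleDr : right_distributive homology_scale +%R.
Proof.
move=> a x y; have [c ->] := homology_classP x; have [c' ->] := homology_classP y.
by rewrite -homology_classD !homology_scaleE scalerDr homology_classD.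
Qed.

Lemma homology_scaleDl x : {morph homology_scale^~ x : a b / a + b}.
Proof.
move=> a b; have [c ->] := homology_classP x.
by rewrite !homology_scaleE scalerDl homology_classD.
Qed.

HB.instance Definition _ := GRing.Zmodule_isLmodule.Build 'F_2 homology
  homology_scaleA homology_scale1 homology_scaleDr homology_scaleDl.

End Homology.

Section Floer.
Context {R : realType}.

(* Lt0 lifts a closed curve parametrised by R / 2 pi Z, Lt1 lifts a curve
   parametrised by [0, pi]. *)
Variables Lt0 Lt1 : R -> R * R.

(* Pairs of parameters; a point of the circle is given by its representative
   in [0, 2 pi). *)
Definition generators : set (R * R) :=
  [set x | [/\ 0 <= x.1 < 2 * pi, 0 <= x.2 <= pi,
               proj (Lt0 x.1) = proj (Lt1 x.2) & pillow_star (proj (Lt0 x.1))]].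

(* Paths from x to y in the domain of L_0, lifted to the real line, and from y
   to x in the domain of L_1. *)
Definition connecting (x y : R * R) (alpha0 alpha1 : R -> R) : Prop :=
  [/\ [/\ {within `[0, 1]%classic, continuous alpha0}, alpha0 0 = x.1 &
          exists k : int, alpha0 1 = y.1 + 2 * pi * k%:~R],
      [/\ {within `[0, 1]%classic, continuous alpha1}, alpha1 0 = y.2 &
          alpha1 1 = x.2] &
      forall u, 0 <= u <= 1 -> [/\ 0 <= alpha1 u <= pi,
        pillow_star (proj (Lt0 (alpha0 u))) &
        pillow_star (proj (Lt1 (alpha1 u)))]].

Definition connecting_loop (alpha0 alpha1 : R -> R) : R -> pillow R :=
  concat (fun u => proj (Lt0 (alpha0 u))) (fun u => proj (Lt1 (alpha1 u))).

Definition is_tau_at (x : R * R) (n : int) : Prop :=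
  is_tau (velocity Lt0 x.1) (velocity Lt1 x.2) n.

Definition is_gr (z : (R -> pillow R) -> 'Z_4) (x y : R * R) (g : 'Z_4) :=
  exists alpha0 alpha1 (m0 m1 tx ty : int),
  [/\ connecting x y alpha0 alpha1,
      is_maslov Lt0 alpha0 m0 /\ is_maslov Lt1 alpha1 m1,
      is_tau_at x tx /\ is_tau_at y ty &
      g = (m0 + m1 + tx - ty)%:~R + z (connecting_loop alpha0 alpha1)].

(* The upper half circle run from (-1, 0) to (1, 0), then the diameter run from
   (1, 0) to (-1, 0), is the clockwise boundary of the half disc. *)
Definition is_bigon (x y : R * R) (u : R * R -> pillow R) : Prop :=
  [/\ oriented_immersion u, forall w, half_disc w -> pillow_star (u w) &
   exists beta0 beta1 : R -> R,
   [/\ {within `[0, 1]%classic, continuous beta0} /\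
         {within `[0, 1]%classic, continuous beta1},
       exists k l : int, beta0 0 = y.1 + 2 * pi * k%:~R /\
                         beta0 1 = x.1 + 2 * pi * l%:~R,
       beta1 0 = x.2 /\ beta1 1 = y.2 &
       forall t, 0 <= t <= 1 ->
         [/\ u (- cos (pi * t), sin (pi * t)) = proj (Lt0 (beta0 t)),
             0 <= beta1 t <= pi & u (1 - 2 * t, 0) = proj (Lt1 (beta1 t))]]].

Definition reparametrization (u u' : R * R -> pillow R) : Prop :=
  exists2 phi, half_disc_diffeo phi &
    forall w, half_disc w -> u' w = u (phi w).

Definition moduli (x y : R * R) : set (set (R * R -> pillow R)) :=
  (fun u => [set u' | is_bigon x y u' /\ reparametrization u u'])
    @` is_bigon x y.

Definition moduli_count (x y : R * R) : 'F_2 :=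
  (#|` fset_set (moduli x y)|)%:R.

Definition chains := {ffun fset_set generators -> ('F_2)^o}.
HB.instance Definition _ := Vector.on chains.

Definition differential_fun (c : chains) : chains :=
  [ffun y => \sum_x c x * moduli_count (val x) (val y)].

Lemma differential_fun_is_linear : linear differential_fun.
Proof.
move=> a b c; apply/ffunP => y; rewrite !ffunE.
rewrite scaler_sumr -big_split/=; apply: eq_bigr => x _.
by rewrite !ffunE mulrDl scalerAl.
Qed.
HB.instance Definition _ :=
  GRing.isLinear.Build 'F_2 chains chains *:%R differential_fun
    differential_fun_is_linear.

Definition differential : 'End(chains) := linfun differential_fun.

End Floer.

Record quaternion (R : realType) :=
  Quaternion { qre : R; qi : R; qj : R; qk : R }.

Section Quaternions.
Context {R : realType}.
Implicit Types x y : quaternion R.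

Definition qmul x y : quaternion R :=
  Quaternion
    (qre x * qre y - qi x * qi y - qj x * qj y - qk x * qk y)
    (qre x * qi y + qi x * qre y + qj x * qk y - qk x * qj y)
    (qre x * qj y - qi x * qk y + qj x * qre y + qk x * qi y)
    (qre x * qk y + qi x * qj y - qj x * qi y + qk x * qre y).

Definition qconj x : quaternion R :=
  Quaternion (qre x) (- qi x) (- qj x) (- qk x).

Definition SU2 : set (quaternion R) :=
  [set x | qre x ^+ 2 + qi x ^+ 2 + qj x ^+ 2 + qk x ^+ 2 = 1].

Definition pure_unit : set (quaternion R) := [set x | SU2 x /\ qre x = 0].

Definition quat_i : quaternion R := Quaternion 0 1 0 0.

Definition exp_k (theta : R) : quaternion R :=
  Quaternion (cos theta) 0 0 (sin theta).

(* qconj u is the inverse of u in SU(2) *)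
Definition conjugate (u x : quaternion R) := qmul (qmul u x) (qconj u).

End Quaternions.

(* The group stands for the fundamental group of the complement Y \ T, mer_a to
   mer_d for the images of the meridians of the 4-punctured boundary sphere.
   Every meridian of a 2-tangle without closed component is conjugate to one of
   these or to its inverse. *)
Record tangle_complement := TangleComplement {
  tangle_group :> groupType;
  mer_a : tangle_group;
  mer_b : tangle_group;
  mer_c : tangle_group;
  mer_d : tangle_group;
  mer_rel : (mer_b * mer_a = mer_c * mer_d)%g
}.

Section Representations.
Context {R : realType} (T : tangle_complement).
Implicit Types rho : T -> quaternion R.

Definition traceless_rep rho : Prop :=
  [/\ forall g, SU2 (rho g),
      forall g h, rho (g * h)%g = qmul (rho g) (rho h) &
      forall m, m \in [:: mer_a T; mer_b T; mer_c T; mer_d T] ->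
        pure_unit (rho m)].

Definition conjugate_reps rho rho' : Prop :=
  exists2 u, SU2 u & forall g, rho' g = conjugate u (rho g).

Definition has_coordinates rho (v : R * R) : Prop :=
  exists2 u, SU2 u &
    [/\ rho (mer_a T) = conjugate u quat_i,
        rho (mer_b T) = conjugate u (qmul (exp_k v.1) quat_i),
        rho (mer_c T) = conjugate u (qmul (exp_k v.2) quat_i) &
        rho (mer_d T) = conjugate u (qmul (exp_k (v.2 - v.1)) quat_i)].

(* Restriction to the boundary sphere, followed by the identification of the
   traceless character variety of the 4-punctured sphere with the pillowcase. *)
Definition restriction rho : pillow R :=
  xget (proj (0, 0)) [set x | exists2 v, proj v = x & has_coordinates rho v].

(* rho_ induces a homeomorphism from [0, pi] to the space of conjugacy classes
   of traceless representations. *)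
Definition parametrizes_R (rho_ : R -> T -> quaternion R) : Prop :=
  [/\ forall t, 0 <= t <= pi -> traceless_rep (rho_ t),
      forall g, [/\ {within `[0, pi]%classic, continuous (fun t => qre (rho_ t g))},
                    {within `[0, pi]%classic, continuous (fun t => qi (rho_ t g))},
                    {within `[0, pi]%classic, continuous (fun t => qj (rho_ t g))} &
                    {within `[0, pi]%classic, continuous (fun t => qk (rho_ t g))}] &
      forall rho, traceless_rep rho ->
        exists! t, 0 <= t <= pi /\ conjugate_reps (rho_ t) rho].

End Representations.

(* Numerator and denominator of 2 c_1 - 1 / (2 c_2 - 1 / ...). *)
Definition even_cf (cs : seq int) : int * int :=
  foldr (fun c nd => (2 * c * nd.1 - nd.2, nd.1)) (1, 0) cs.

(* K(p, q) bounds the linear plumbing of annuli with c_1, c_2, ... full twists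
   as soon as p / q' = 2 c_1 - 1 / (2 c_2 - 1 / ...) for some q' = q mod p: the
   double branched cover is then the boundary of the plumbing of disc bundles of
   Euler numbers 2 c_1, 2 c_2, ..., which is L(p, q) up to orientation. Changing
   the orientation changes the sign of the signature, which is even, so that its
   residue mod 4 is unaffected. *)
Definition plumbing_of (p q : int) (cs : seq int) : Prop :=
  exists k : int, (even_cf cs).1 * (q + k * p) = (even_cf cs).2 * p.

(* Linking numbers of the cores of the annuli with their push-offs. *)
Definition seifert_matrix (cs : seq int) : 'M[int]_(size cs) :=
  \matrix_(i, j) (if i == j then cs`_i else ((j == i.+1 :> nat)%:R)).

Definition is_signature (R : realType) (n : nat) (A : 'M[R]_n) (s : int) :=
  exists (P : 'M[R]_n) (d : 'rV[R]_n),
    [/\ P \in unitmx, P *m A *m P^T = diag_mx d & s = \sum_i sgz (d 0 i)].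

Definition is_knot_signature (R : realType) (cs : seq int) (s : int) : Prop :=
  let V := map_mx (intr : int -> R) (seifert_matrix cs) in
  is_signature (V + V^T) s.

Section Curves.
Context {R : realType}.

Definition L0_lift (e : R) (t : R) : R * R :=
  (t + e * sin t + pi / 2, t - e * sin t + pi / 2).

Variables (p : nat) (q : int).

Definition L1_lift (t : R) : R * R :=
  (q%:~R * t, (q - p%:Z)%:~R * t).

Definition x_pt (l : nat) : pillow R := proj (L1_lift (2 * pi * l%:R / p%:R)).

Definition gens (e : R) : set (R * R) := generators (L0_lift e) L1_lift.

Definition image_pt (x : R * R) : pillow R := proj (L1_lift x.2).

Definition slope_L0 (e s : R) : R :=
  (velocity (L0_lift e) s).2 / (velocity (L0_lift e) s).1.

Definition r_plus_branch (e0 : R) (r : R -> R * R) : Prop :=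
  [/\ forall e, 0 < e < e0 -> gens e (r e),
      forall e, 0 < e < e0 -> [/\ {for e, continuous (fun e' => cos (r e').1)},
        {for e, continuous (fun e' => sin (r e').1)} &
        {for e, continuous (fun e' => (r e').2)}] &
      (fun e => image_pt (r e)) @ 0^'+ --> x_pt 0].

(* plus = true for x_l^+, plus = false for x_l^-. *)
Definition x_branch (plus : bool) (l : nat) (e0 : R) (x : R -> R * R) : Prop :=
  ((fun e => image_pt (x e)) @ 0^'+ --> x_pt l) /\
  exists U : set (pillow R), [/\ open U, U (x_pt l) &
    forall e, 0 < e < e0 -> forall y,
      y = x e <-> [/\ gens e y, U (image_pt y) &
        if plus then slope_L0 e y.1 < 1 else 1 < slope_L0 e y.1]].

Definition x_circ (xp xm : nat -> R -> R * R) : nat -> R -> R * R :=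
  if 1 < `|(q - p%:Z)%:~R / q%:~R : R| then xp else xm.

Definition absolute_grading (z : (R -> pillow R) -> 'Z_4) (sigma : int)
    (e : R) (r : R * R) (gr : R * R -> 'Z_4) : Prop :=
  (forall x y, gens e x -> gens e y -> forall g,
     is_gr (L0_lift e) L1_lift z x y g <-> g = gr x - gr y) /\
  gr r = sigma%:~R.

Definition C_complex (e : R) := chains (L0_lift e) L1_lift.
HB.instance Definition _ e := Vector.on (C_complex e).

Definition C_differential (e : R) : 'End(C_complex e) :=
  differential (L0_lift e) L1_lift.

Definition H_natural (e : R) := homology (C_differential e).
HB.instance Definition _ e := GRing.Lmodule.on (H_natural e).

End Curves.

(* Main.v *)
From HB Require Import structures.
Require Import Defs.
From mathcomp Require Import all_boot all_order all_algebra finmap.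
From mathcomp Require Import all_classical all_reals all_analysis.
From mathcomp Require Import zify ring lra.

Set Implicit Arguments.
Unset Strict Implicit.
Unset Printing Implicit Defensive.

Import Order.TTheory GRing.Theory Num.Theory.
Import numFieldNormedType.Exports.

Local Open Scope classical_set_scope.
Local Open Scope ring_scope.

Local Notation proj := Defs.proj.

(** A point of [L_0] with parameter [s] and a point of [L_1] have the same image
    in the pillowcase exactly when
    [s - kappa e sin s = - pi / 2 +- 2 pi q k / p] modulo [2 pi],
    where [kappa = (2 q - p) / p]; the second parameter is then determined by [s]
    and [k].  For small [e] the left hand side is increasing in [s], so each
    [0 <= k <= (p - 1) / 2] and each sign give one solution; for [k = 0] only one
    of the two signs gives a second parameter in [[0, pi]].

    The line of slope one meets the tangents of [L_0] where [cos] vanishes and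
    never meets the tangent of [L_1]; hence the Maslov indices are the increments
    of the sign of [cos], as are the differences of the [tau]'s, and these two
    contributions to the relative grading cancel, leaving [z] of the loop.  As
    [L_0] itself is null for [z], the value of [z] on a connecting loop is a sum
    of a term for [L_0] and a term for [L_1] depending only on the endpoints.
    The loop through [x_l^+] and [x_l^-] lifts to a path from a point of the plane
    to its negative, a half turn about a corner, and so has value [1].

    There are no bigons.  A bigon lifts to the plane; a linear function constant
    on the lifts of [L_1] is injective along [L_0], so the parameter of the edge
    on [L_0] takes the same value at both ends.  By Rolle's theorem it has a
    critical point, which contradicts the immersion property. *)

(** Degrees and gradings are relations that quantify over all connecting paths, so each index needs
    both existence and uniqueness. For uniqueness the path is arbitrary: a signed count of zeros
    telescopes to the signs at its two ends. For existence a straight path is used, in a window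
    where [cos] is negative on one interval only.

    [L_0] is null for [z] because it is a figure eight: it makes a half turn about [(0, 0)] and one
    about [(pi, pi)] in opposite directions, and these cancel.

    One constant [c] sets the scale. Coprimality makes every [sin (phase k)] with [0 < k] and every
    difference of two distinct [cos (phase k)] nonzero; [c] bounds these finitely many numbers from
    below, and [e] is small against [c]. The point with [k = 0] escapes this bound, as its phase is
    [0]: there [cos] is only of order [e], and it is nonzero because [kappa] is, [p] being odd.

    Lifting a bigon to the plane uses that the projection is a covering away from the corners; the
    lift is assembled from small rectangles. *)

Lemma int_trichotomy (R : numDomainType) (k : int) :
  [\/ 1 <= k%:~R :> R, k = 0 | k%:~R <= -1 :> R].
Proof.
have [h|[->|h]] : (1 <= k)%R \/ k = 0 \/ (k <= -1)%R by lia.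
- by apply: Or31; rewrite (ler_int R 1).
- exact: Or32.
- by apply: Or33; rewrite (ler_int R _ (-1)).
Qed.

(** * The pillowcase and the arc *)

Section Trigonometry.
Context {R : realType}.
Implicit Types x y : R.

Lemma sin_cosDpin x (n : nat) :
  sin (x + pi * n%:R) = (-1) ^+ n * sin x /\ cos (x + pi * n%:R) = (-1) ^+ n * cos x.
Proof.
elim: n => [|n [IHs IHc]]; first by rewrite mulr0 addr0 expr0 !mul1r.
rewrite -natr1 mulrDr mulr1 addrA sinDpi cosDpi IHs IHc exprS.
by split; rewrite mulN1r mulNr.
Qed.

Lemma sin_cosDpiz x (m : int) :
  sin (x + pi * m%:~R) = (-1) ^+ `|m|%N * sin x /\
  cos (x + pi * m%:~R) = (-1) ^+ `|m|%N * cos x.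
Proof.
case: (intP m) => [|n|n]; first by rewrite mulr0 addr0 expr0 !mul1r.
- exact: sin_cosDpin.
rewrite abszN /=; have := sin_cosDpin (x + pi * (- (n.+1)%:Z)%:~R) n.+1.
have -> : x + pi * (- (n.+1)%:Z)%:~R + pi * n.+1%:R = x.
  by rewrite mulrNz; lra.
by case=> -> ->; rewrite !mulrA -!expr2 -!exprM !(mulnC _ 2%N) !exprM sqrrN !expr1n !mul1r.
Qed.

Lemma sinD2piz x (m : int) : sin (x + 2 * pi * m%:~R) = sin x.
Proof.
have -> : 2 * pi * m%:~R = pi * (m * 2)%:~R :> R by rewrite intrM; ring.
by rewrite (sin_cosDpiz _ _).1 abszM/= mulnC exprM sqrrN !expr1n mul1r.
Qed.

Lemma cosD2piz x (m : int) : cos (x + 2 * pi * m%:~R) = cos x.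
Proof.
have -> : 2 * pi * m%:~R = pi * (m * 2)%:~R :> R by rewrite intrM; ring.
by rewrite (sin_cosDpiz _ _).2 abszM/= mulnC exprM sqrrN !expr1n mul1r.
Qed.

Lemma sin_eq0 x : sin x = 0 -> exists m : int, x = pi * m%:~R.
Proof.
move=> sx; have p0 := @pi_gt0 R.
pose m := Num.floor (x / pi); exists m.
have /andP[h1 h2] : m%:~R <= x / pi < (m + 1)%:~R.
  by rewrite floor_le_tmp ?floorD1_gt.
have {}h1 : 0 <= x - pi * m%:~R.
  by rewrite subr_ge0 mulrC -ler_pdivlMr.
have {}h2 : x - pi * m%:~R < pi.
  rewrite intrD -[1%:~R]/1 ltr_pdivrMr// in h2; lra.
have := (sin_cosDpiz x (- m)).1; rewrite sx mulr0 mulrNz mulrN => s0.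
have [/eqP|h3] := eqVneq (x - pi * m%:~R) 0; first by rewrite subr_eq0 => /eqP.
by have := @sin_gt0_pi R (x - pi * m%:~R); rewrite s0 ltxx lt_neqAle eq_sym h3 h1 h2 => /(_ isT).
Qed.

Lemma cos_sin_eq x y : cos x = cos y -> sin x = sin y ->
  exists m : int, y = x + 2 * pi * m%:~R.
Proof.
move=> cxy sxy.
have c1 : cos (y - x) = 1 by rewrite cosB cxy sxy -!expr2 cos2Dsin2.
have : sin ((y - x) / 2) = 0.
  have := cos_mulr2n ((y - x) / 2).
  have -> : (y - x) / 2 *+ 2 = y - x by lra.
  rewrite c1 => h.
  have := cos2Dsin2 ((y - x) / 2) => h2.
  by apply/eqP; rewrite -sqrf_eq0; apply/eqP; rewrite -mulr_natr in h; lra.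
by move=> /sin_eq0[m hm]; exists m; lra.
Qed.

Lemma sin_lip x y : `|sin x - sin y| <= `|x - y|.
Proof.
wlog xy : x y / x < y.
  move=> H; have [xy|yx|->] := ltgtP x y; first exact: H.
    by rewrite distrC [leRHS]distrC; exact: H.
  by rewrite !subrr.
rewrite distrC [leRHS]distrC.
have [|c _ ->] := MVT xy (fun z _ => is_derive_sin z).
  exact/continuous_subspaceT/continuous_sin.
by rewrite normrM ler_piMl// cos_max.
Qed.

Lemma cos_lip x y : `|cos x - cos y| <= `|x - y|.
Proof.
rewrite -!sinDpihalf (le_trans (sin_lip _ _))//.
by rewrite (_ : x + pi / 2 - (y + pi / 2) = x - y)//; ring.
Qed.

End Trigonometry.

Section PillowcaseTheory.
Context {R : realType}.
Implicit Types v w : R * R.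

Lemma projP v w : proj v = proj w <-> exists (s : bool) (m n : int),
  w = ((-1) ^+ s * v.1 + 2 * pi * m%:~R, (-1) ^+ s * v.2 + 2 * pi * n%:~R).
Proof.
by split=> [/eqmodP/asboolP|h] //; apply/eqmodP/asboolP.
Qed.

Lemma projN v : proj (- v.1, - v.2) = proj v.
Proof. by apply/esym/projP; exists true, 0, 0; rewrite !mulr0 !addr0 !mulN1r. Qed.

Lemma projD2pi v (m n : int) :
  proj (v.1 + 2 * pi * m%:~R, v.2 + 2 * pi * n%:~R) = proj v.
Proof. by apply/esym/projP; exists false, m, n; rewrite !mul1r. Qed.

Lemma continuous_proj : continuous (@proj R).
Proof. exact: pi_continuous. Qed.

Lemma latticeP v : lattice v <-> sin v.1 = 0 /\ sin v.2 = 0.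
Proof.
split => [[m [n ->]]/=|[/sin_eq0[m hm] /sin_eq0[n hn]]]; last first.
  by exists m, n; case: v hm hn => ? ? /= -> ->.
have h k : sin (pi * k%:~R) = 0 :> R.
  by have := (sin_cosDpiz (0 : R) k).1; rewrite add0r sin0 mulr0.
by rewrite !h.
Qed.

Lemma lattice_orbit v w : proj v = proj w -> lattice v -> lattice w.
Proof.
move=> /projP[s [m [n ->]]] /latticeP[h1 h2]; apply/latticeP; rewrite /= !sinD2piz.
by case: s; rewrite ?mulN1r ?mul1r ?sinN h1 h2 ?oppr0.
Qed.

Lemma pillow_starP v : pillow_star (proj v) <-> ~ lattice v.
Proof.
split=> [h l|h [w wl /esym e]]; first by apply: h; exists v.
exact/h/lattice_orbit/wl.
Qed.

Lemma cos_orbit v w : proj v = proj w ->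
  [/\ cos v.1 = cos w.1, cos v.2 = cos w.2 & cos (v.2 - v.1) = cos (w.2 - w.1)].
Proof.
move=> /projP[s [m [n ->]]] /=; rewrite !cosD2piz.
have -> : (-1) ^+ s * v.2 + 2 * pi * n%:~R - ((-1) ^+ s * v.1 + 2 * pi * m%:~R)
   = (-1) ^+ s * (v.2 - v.1) + 2 * pi * (n - m)%:~R :> R by rewrite intrB; ring.
by rewrite cosD2piz; case: s; rewrite ?mulN1r ?mul1r ?cosN.
Qed.

(** The first two equations determine each coordinate up to sign modulo [2 pi]. The third one
    equates the products of the sines, so that the two signs agree unless a sine vanishes, in which
    case its sign is free. *)
Lemma orbit_cos v w :
  cos v.1 = cos w.1 -> cos v.2 = cos w.2 -> cos (v.2 - v.1) = cos (w.2 - w.1) ->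
  proj v = proj w.
Proof.
move=> h1 h2; rewrite !cosB h1 h2 => /addrI h3.
have sq (x y : R) : cos x = cos y -> sin x = sin y \/ sin x = - sin y.
  move=> /(congr1 (fun x : R => x ^+ 2)).
  by rewrite !cos2sin2 => /addrI/oppr_inj/eqP; rewrite eqf_sqr => /orP[]/eqP; auto.
have same : sin v.1 = sin w.1 -> sin v.2 = sin w.2 -> proj v = proj w.
  move=> s1 s2; have [m hm] := cos_sin_eq h1 s1; have [n hn] := cos_sin_eq h2 s2.
  apply/projP; exists false, m, n.
  by rewrite !mul1r -hm -hn; case: (w).
have opposite : sin v.1 = - sin w.1 -> sin v.2 = - sin w.2 -> proj v = proj w.
  move=> s1 s2.
  have [||m hm] := @cos_sin_eq R (- v.1) w.1; rewrite ?cosN ?sinN ?s1 ?opprK//.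
  have [||n hn] := @cos_sin_eq R (- v.2) w.2; rewrite ?cosN ?sinN ?s2 ?opprK//.
  by apply/projP; exists true, m, n; rewrite !mulN1r -hm -hn; case: (w).
have [e1|e1] := sq _ _ h1; have [e2|e2] := sq _ _ h2; [exact: same| | |exact: opposite].
- rewrite e1 e2 in h3; have /eqP : sin w.2 * sin w.1 = 0 by lra.
  rewrite mulf_eq0 => /orP[]/eqP h0; first by apply: same; rewrite ?e2 ?h0 ?oppr0.
  by apply: opposite; rewrite ?e1 ?h0 ?oppr0.
- rewrite e1 e2 in h3; have /eqP : sin w.2 * sin w.1 = 0 by lra.
  rewrite mulf_eq0 => /orP[]/eqP h0; first by apply: opposite; rewrite ?e2 ?h0 ?oppr0.
  by apply: same; rewrite ?e1 ?h0 ?oppr0.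
Qed.

(** The cosine of the first coordinate is invariant under the group, so these sets are open in the
    quotient; they serve to separate the points [x_l]. *)
Lemma open_cos1_nbhd (c d : R) : open [set x : pillow R | exists v, x = proj v /\ `|cos v.1 - c| < d].
Proof.
rewrite /open/= /quotient_open.
have -> : \pi_({eq_quot (@same_orbit R)})%qT @^-1`
    [set x : pillow R | exists v, x = proj v /\ `|cos v.1 - c| < d] =
    (fun v : R * R => `|cos v.1 - c|) @^-1` [set x | x < d].
  apply/seteqP; split=> v /=; last by move=> h; exists v.
  by move=> [w [/cos_orbit[-> _ _]]].
apply: open_comp => [v _|]; last exact: open_lt.
rewrite /continuous_at; apply: cvg_norm; apply: cvgB; last exact: cvg_cst.
by apply: continuous_cvg; [exact: continuous_cos|exact: cvg_fst].
Qed.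

End PillowcaseTheory.

(** * The restriction map and the injectivity of the arc *)

Section Restriction.
Context {R : realType}.

Lemma orbit_fund_itv (s t : R) (b : bool) (k : int) :
  0 <= s <= pi -> 0 <= t <= pi -> t = (-1) ^+ b * s + 2 * pi * k%:~R -> s = t.
Proof.
move=> hs ht; have p0 := @pi_gt0 R.
have [h|h|h] := int_trichotomy R k; case: b; rewrite ?expr1 ?expr0 ?mul1r ?mulN1r ?h => e; nra.
Qed.

Variables (p : nat) (q : int).
Hypothesis pq_coprime : coprimez p%:Z q.
Implicit Types s t : R.

(** By Bezout: with [c] the sign, both [p * (t - c * s)] and [q * (t - c * s)] are integer multiples
    of [2 pi], hence so is [t - c * s]. *)
Lemma L1_orbit s t : proj (L1_lift p q s) = proj (L1_lift p q t) ->
  exists (b : bool) (k : int), t = (-1) ^+ b * s + 2 * pi * k%:~R.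
Proof.
move=> /projP[b [m [n [e1 e2]]]]; exists b.
have /coprimezP[[u v]/= uv] := pq_coprime.
have uvR : u%:~R * p%:~R + v%:~R * q%:~R = 1 :> R by rewrite -!intrM -intrD uv.
exists (u * (m - n) + v * m); rewrite !(intrD, intrM, intrB) /=.
rewrite intrB in e2; move: e1 e2 uvR.
set c := (-1) ^+ b; set P := (p%:Z)%:~R; set Q := q%:~R => e1 e2 uvR.
have eQ : Q * (t - c * s) = 2 * pi * m%:~R by lra.
have eP : P * (t - c * s) = 2 * pi * (m%:~R - n%:~R) by lra.
have -> : t = c * s + (u%:~R * P + v%:~R * Q) * (t - c * s) by rewrite uvR; ring.
by rewrite mulrDl -!mulrA eP eQ; ring.
Qed.

Lemma L1_inj s t : 0 <= s <= pi -> 0 <= t <= pi ->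
  proj (L1_lift p q s) = proj (L1_lift p q t) -> s = t.
Proof. by move=> hs ht /L1_orbit[b [k]]; exact: orbit_fund_itv. Qed.

Lemma L1_lattice t : lattice (L1_lift p q t) -> exists k : int, t = pi * k%:~R.
Proof.
move=> [m [n [e1 e2]]].
have /coprimezP[[u v]/= uv] := pq_coprime.
have uvR : u%:~R * p%:~R + v%:~R * q%:~R = 1 :> R by rewrite -!intrM -intrD uv.
exists (u * (m - n) + v * m); rewrite !(intrD, intrM, intrB) /=.
rewrite intrB in e2; move: e1 e2 uvR.
set P := (p%:Z)%:~R; set Q := q%:~R => e1 e2 uvR.
have eP : P * t = pi * (m%:~R - n%:~R) by lra.
have -> : t = (u%:~R * P + v%:~R * Q) * t by rewrite uvR mul1r.
by rewrite mulrDl -!mulrA eP e1; ring.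
Qed.

Lemma L1_interior t : 0 < t < pi -> ~ lattice (L1_lift p q t).
Proof.
move=> ht /L1_lattice[k hk]; have p0 := @pi_gt0 R.
by have [h|h|h] := int_trichotomy R k; move: ht; rewrite hk ?h; nra.
Qed.

Lemma L1_velocity_neq0 : ((q%:~R : R), ((q - p%:Z)%:~R : R)) != 0.
Proof.
apply/eqP => -[/eqP + /eqP]; rewrite !intr_eq0 => /eqP q0 /eqP qp.
by move: pq_coprime; rewrite (_ : p%:Z = 0) ?q0 //; lia.
Qed.

Lemma velocity_L1 t : velocity (L1_lift p q) t = (q%:~R, (q - p%:Z)%:~R).
Proof.
have h (c : R) : derive1 (fun u : R => c * u) t = c.
  by rewrite derive1E; apply: derive_val; apply: is_derive_eq; rewrite [_ *: _]mulr1 ?addr0.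
by rewrite /velocity /L1_lift/= !h.
Qed.

Implicit Types x y u : quaternion R.

(** The Euclidean inner product of the quaternions, invariant under conjugation by units. Pairing
    the image of [a] with those of [b], [c], [d] gives the three cosines of [orbit_cos]. *)
Definition qdot x y := qre x * qre y + qi x * qi y + qj x * qj y + qk x * qk y.

Lemma qdot_conjugate u x y : SU2 u -> qdot (conjugate u x) (conjugate u y) = qdot x y.
Proof.
rewrite /SU2/= => h.
have -> : qdot (conjugate u x) (conjugate u y) =
  (qre u ^+ 2 + qi u ^+ 2 + qj u ^+ 2 + qk u ^+ 2) ^+ 2 * qdot x y.
  by rewrite /qdot /conjugate /qmul /qconj /=; ring.
by rewrite h expr1n mul1r.
Qed.

Lemma has_coordinates_proj (T : tangle_complement) (rho : T -> quaternion R) v w :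
  has_coordinates rho v -> has_coordinates rho w -> proj v = proj w.
Proof.
move=> [u hu [ea eb ec ed]] [u' hu' [ea' eb' ec' ed']].
have e x y x' y' a b : rho a = conjugate u x -> rho b = conjugate u y ->
    rho a = conjugate u' x' -> rho b = conjugate u' y' -> qdot x y = qdot x' y'.
  move=> h1 h2 h3 h4.
  by rewrite -(qdot_conjugate x y hu) -(qdot_conjugate x' y' hu') -h1 -h2 -h3 -h4.
apply: orbit_cos.
- by have := e _ _ _ _ _ _ ea eb ea' eb'; rewrite /qdot/=; lra.
- by have := e _ _ _ _ _ _ ea ec ea' ec'; rewrite /qdot/=; lra.
- by have := e _ _ _ _ _ _ ea ed ea' ed'; rewrite /qdot/=; lra.
Qed.

Lemma restrictionE (T : tangle_complement) (rho : T -> quaternion R) v :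
  has_coordinates rho v -> restriction rho = proj v.
Proof.
move=> h; rewrite /restriction; case: xgetP => [x -> [w <- hw]|/(_ (proj v))[]].
  exact: has_coordinates_proj hw h.
by exists v.
Qed.

Lemma L1_linear : linearly_embedded_arc 0 pi (fun t => proj (L1_lift p q t))
  (q - p%:Z)%:~R q%:~R.
Proof.
split; last by move=> s t; exact: L1_inj.
exists 0, (q%:~R, (q - p%:Z)%:~R); split.
- exact: L1_velocity_neq0.
- by rewrite mulrC.
- by move=> t _; rewrite /L1_lift !add0r ![t * _]mulrC.
Qed.

End Restriction.

(** * The arc near the corners *)

Section RestrictedArc.
Context {R : realType}.

Lemma derive1_affine (a b : R) : derive1 (fun u : R => a * u + b) = cst a.
Proof.
apply/funext => t; rewrite derive1E; apply: derive_val; apply: is_derive_eq.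
by rewrite [_ *: _]mulr1 ?addr0.
Qed.

Lemma smooth_on_affine (a b c d : R) : smooth_on a b (fun t : R => c * t + d).
Proof.
exists (a - 1), (b + 1); split; rewrite ?ltrBlDr ?ltrDl//.
move=> n t _.
have [c' [d' ->]] : exists c' d', derive1n n (fun t : R => c * t + d) = (fun t => c' * t + d').
  elim: n => [|n [c' [d' IH]]]; first by exists c, d.
  by exists 0, c'; rewrite derive1nS IH derive1_affine; apply/funext=> x; rewrite mul0r add0r.
by apply: ex_derive.
Qed.

Lemma enorm_ge0 (v : R * R) : 0 <= enorm v.
Proof. exact: sqrtr_ge0. Qed.

Lemma enormE (v : R * R) : enorm v ^+ 2 = v.1 ^+ 2 + v.2 ^+ 2.
Proof. by rewrite sqr_sqrtr /dot -!expr2 // addr_ge0// sqr_ge0. Qed.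

Lemma enormP (v : R * R) (c : R) : 0 <= c -> c ^+ 2 = v.1 ^+ 2 + v.2 ^+ 2 -> enorm v = c.
Proof.
move=> c0 h; apply/eqP; rewrite -(@eqrXn2 _ 2%N) ?enorm_ge0//.
by rewrite enormE h.
Qed.

Lemma enorm_orbit (v w : R * R) (delta : R) : proj v = proj w ->
  (exists2 c, lattice c & enorm (v - c) < delta) ->
  exists2 c, lattice c & enorm (w - c) < delta.
Proof.
move=> /projP[s [m [n ->]]] [_ [m' [n' ->]]] h.
pose e : int := (-1) ^+ s.
exists (pi * (e * m' + 2 * m)%:~R, pi * (e * n' + 2 * n)%:~R).
  by eexists; eexists; reflexivity.
rewrite (_ : enorm _ = enorm (v - (pi * m'%:~R, pi * n'%:~R)))//.
apply: enormP; first exact: enorm_ge0.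
by rewrite enormE /= /e !intrD !intrM !rmorphXn/= !rmorphN1; case: (s); rewrite ?expr1 ?expr0/=; ring.
Qed.

Variables (p : nat) (q : int).
Hypothesis pq_coprime : coprimez p%:Z q.
Local Notation vnorm := (enorm ((q%:~R : R), ((q - p%:Z)%:~R : R))).

Lemma vnorm_gt0 : 0 < vnorm.
Proof.
rewrite lt_neqAle enorm_ge0 andbT eq_sym; apply/eqP => h.
have /eqP := enormE ((q%:~R : R), ((q - p%:Z)%:~R : R)).
rewrite h expr0n/= eq_sym paddr_eq0 ?sqr_ge0// !sqrf_eq0 => /andP[/eqP h1 /eqP h2].
by have := L1_velocity_neq0 (R := R) pq_coprime; rewrite h1 h2 eqxx.
Qed.

Lemma cross_le (v w : R * R) : `|cross v w| <= enorm v * enorm w.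
Proof.
rewrite -(@ler_pXn2r _ 2%N) ?nnegrE ?mulr_ge0 ?enorm_ge0//.
rewrite real_normK ?num_real// exprMn !enormE /cross -subr_ge0.
by rewrite (_ : _ - _ = (v.1 * w.1 + v.2 * w.2) ^+ 2) ?sqr_ge0//; ring.
Qed.

Lemma enorm_collinear (t u : R) :
  enorm (L1_lift p q t - L1_lift p q u) = `|t - u| * vnorm.
Proof.
apply: enormP; first by rewrite mulr_ge0 ?enorm_ge0.
by rewrite exprMn enormE real_normK ?num_real//=; ring.
Qed.

(** The cross product of the displacement with the direction of the arc is [pi] times an integer and
    smaller than [pi], hence zero. So [c] lies on the line of the arc, and coprimality makes it one
    of the evenly spaced lattice points there. *)
Lemma L1_near_lattice t c : 0 <= t <= pi -> lattice c ->
  enorm (L1_lift p q t - c) * vnorm < pi ->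
  exists k : int, c = L1_lift p q (pi * k%:~R).
Proof.
move=> ht [m [n ->]] h; have p0 := @pi_gt0 R.
have := cross_le (L1_lift p q t - (pi * m%:~R, pi * n%:~R)) (q%:~R, (q - p%:Z)%:~R).
move=> /le_lt_trans/(_ h).
have -> : cross (L1_lift p q t - (pi * m%:~R, pi * n%:~R)) (q%:~R, (q - p%:Z)%:~R) =
  pi * (n * q - m * (q - p%:Z))%:~R by rewrite /cross/= !(intrB, intrM); ring.
rewrite normrM (gtr0_norm p0) -ltr_pdivlMl// mulVf ?gt_eqF// -intr_norm (ltr_int _ _ 1) => e.
have {}e : n * q = m * (q - p%:Z) by lia.
have /coprimezP[[u v]/= uv] := pq_coprime.
pose k := u * (m - n) + v * m; exists k; rewrite /L1_lift.
have [hm hn] : m = q * k /\ n = (q - p%:Z) * k.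
  have := (congr1 ( *%R m) uv, congr1 ( *%R n) uv, congr1 ( *%R u) e, congr1 ( *%R v) e).
  by rewrite /k => -[[[h1 h2] h3] h4]; split; lra.
by rewrite {1}hm {1}hn !intrM; congr pair; ring.
Qed.

Lemma L1_restricted (L : R -> pillow R) :
  (forall t, 0 <= t <= pi -> L t = proj (L1_lift p q t)) ->
  restricted_immersed_arc 0 pi L.
Proof.
move=> hL; have p0 := @pi_gt0 R; have v0 := vnorm_gt0.
exists (L1_lift p q); split.
- split=> //; last by move=> t ht; rewrite velocity_L1; exact: L1_velocity_neq0.
  + have -> : (fun t : R => (L1_lift p q t).1) = (fun t => q%:~R * t + 0).
      by apply/funext => t; rewrite addr0.
    exact: smooth_on_affine.
  + have -> : (fun t : R => (L1_lift p q t).2) = (fun t => (q - p%:Z)%:~R * t + 0).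
      by apply/funext => t; rewrite addr0.
    exact: smooth_on_affine.
- split; last by move=> t; exact: L1_interior.
  + by exists 0, 0; rewrite /L1_lift !mulr0.
  + by exists q, (q - p%:Z); rewrite /L1_lift ![_%:~R * _]mulrC.
have lat (k : int) : lattice (L1_lift p q (pi * k%:~R : R)).
  by exists (q * k), ((q - p%:Z) * k); rewrite /L1_lift !intrM; congr pair; ring.
(* The first bound is what [L1_near_lattice] asks for. The second makes the parameter length
   [d / vnorm] cut off at each end less than [pi / 4], so that a middle part remains. *)
exists (Num.min (pi / vnorm) (pi * vnorm / 4)).
  by rewrite lt_min !divr_gt0// ?mulr_gt0.
move=> d /andP[d0]; rewrite lt_min => /andP[d1 d2].
rewrite ltr_pdivlMr// in d1.
pose a := d / vnorm; have av : a * vnorm = d by rewrite divfK// gt_eqF.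
have a0 : 0 < a by rewrite divr_gt0.
have a4 : a < pi / 4 by rewrite ltr_pdivrMr//; lra.
exists a, (pi - a); split; [lra|lra|lra|split].
- move=> t ht; rewrite hL//.
  have -> : corner_nbhd d (proj (L1_lift p q t)) <->
    exists2 c, lattice c & enorm (L1_lift p q t - c) < d.
    split=> [[w /= wc wp]|h]; last by exists (L1_lift p q t).
    exact: enorm_orbit wp wc.
  split=> [h|h [c lc]]; last first.
    move=> hc; have [|k ck] := L1_near_lattice ht lc.
      by apply: le_lt_trans d1; rewrite ler_pM2r// ltW.
    move: hc; rewrite ck enorm_collinear -av ltr_pM2r// ltr_norml => /andP[h1 h2].
    have [k0|k0|k0] := int_trichotomy R k.
    - by have : pi * 1 <= pi * k%:~R :> R by [rewrite ler_pM2l]; lra.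
    - by move: h2; rewrite k0 mulr0; lra.
    - by have : pi * k%:~R <= pi * (-1) :> R by [rewrite ler_pM2l]; lra.
  apply/andP; split; rewrite leNgt; apply/negP => ta; apply: h.
    exists (L1_lift p q (pi * 0%:~R)); first exact: lat.
    by rewrite enorm_collinear mulr0 subr0 -av ltr_pM2r// ger0_norm//; lra.
  exists (L1_lift p q (pi * 1%:~R)); first exact: lat.
  by rewrite enorm_collinear mulr1 -av ltr_pM2r// ler0_norm//; lra.
- by rewrite !hL; [move/(L1_inj pq_coprime)|lra|lra] => H; have := H _ _; lra.
- exists (L1_lift p q (pi * 0%:~R)); split; first exact: lat.
    by rewrite enorm_collinear mulr0 subr0 -av gtr0_norm.
  rewrite velocity_L1 /dot/=.
  rewrite (_ : _ + _ = a * vnorm ^+ 2); last by rewrite enormE/=; ring.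
  by rewrite mulf_neq0 ?sqrf_eq0 ?gt_eqF.
- exists (L1_lift p q (pi * 1%:~R)); split; first exact: lat.
    by rewrite enorm_collinear mulr1 -av ler0_norm; [congr (_ * _); ring|lra].
  rewrite velocity_L1 /dot/=.
  rewrite (_ : _ + _ = - a * vnorm ^+ 2); last by rewrite enormE/=; ring.
  by rewrite mulf_neq0 ?oppr_eq0 ?sqrf_eq0 ?gt_eqF.
(* The arc is already injective in the pillowcase, so every lift of it is. *)
- move=> E c _ g _ hg s t hs ht gst.
  apply: (L1_inj pq_coprime); [lra|lra|].
  by rewrite -!hL -?hg ?gst//; lra.
Qed.

End RestrictedArc.

(** * Cocycles and half turns *)

Section Continuity.
Context {R : realType}.

Lemma continuous_comp_within {X Y Z : topologicalType} (f : X -> Y) (B : set Y) (g : Y -> Z) :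
  continuous f -> (forall x, B (f x)) -> {within B, continuous g} ->
  continuous (g \o f).
Proof.
move=> cf fB /subspace_continuousP cg x.
have h : f @ x --> within B (nbhs (f x)).
  move=> P /= hP; have := cf x _ hP; rewrite /= !nbhs_simpl/=.
  by apply: filterS => y; apply.
exact: cvg_comp h (cg _ (fB x)).
Qed.

Lemma continuousT_comp {X Y Z : topologicalType} (f : X -> Y) (g : Y -> Z) :
  continuous f -> continuous g -> continuous (fun x => g (f x)).
Proof. by move=> cf cg x; apply: continuous_comp; [exact: cf|exact: cg]. Qed.

Lemma continuousT_pair {X Y Z : topologicalType} (f : X -> Y) (g : X -> Z) :
  continuous f -> continuous g -> continuous (fun x => (f x, g x)).
Proof. by move=> cf cg x; apply: cvg_pair; [exact: cf|exact: cg]. Qed.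

Lemma continuousT_fst {X Y : topologicalType} : continuous (@fst X Y).
Proof. by move=> x; exact: cvg_fst. Qed.

Lemma continuousT_snd {X Y : topologicalType} : continuous (@snd X Y).
Proof. by move=> x; exact: cvg_snd. Qed.

Lemma continuousTD {X : topologicalType} {V : normedModType R} (f g : X -> V) :
  continuous f -> continuous g -> continuous (fun x => f x + g x).
Proof. by move=> cf cg x; apply: cvgD; [exact: cf|exact: cg]. Qed.

Lemma continuousTB {X : topologicalType} {V : normedModType R} (f g : X -> V) :
  continuous f -> continuous g -> continuous (fun x => f x - g x).
Proof. by move=> cf cg x; apply: cvgB; [exact: cf|exact: cg]. Qed.

Lemma continuousTZ {X : topologicalType} {V : normedModType R} (f : X -> R) (g : X -> V) :
  continuous f -> continuous g -> continuous (fun x => f x *: g x).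
Proof. by move=> cf cg x; apply: cvgZ; [exact: cf|exact: cg]. Qed.

Lemma continuousTM {X : topologicalType} (f g : X -> R) :
  continuous f -> continuous g -> continuous (fun x => f x * g x).
Proof. by move=> cf cg x; apply: cvgM; [exact: cf|exact: cg]. Qed.

(** Retraction of the line onto [[0, 1]]: composing with it turns a path continuous on [[0, 1]] into
    a globally continuous one without changing its value under a cocycle. *)
Definition clamp (u : R) : R := Num.max 0 (Num.min 1 u).

Lemma clamp_itv u : 0 <= clamp u <= 1.
Proof. by rewrite /clamp le_max lexx/= ge_max ler01 ge_min lexx. Qed.

Lemma clamp_id u : 0 <= u <= 1 -> clamp u = u.
Proof. by move=> /andP[u0 u1]; rewrite /clamp (min_idPr u1) (max_idPr u0). Qed.

Lemma continuous_clamp : continuous clamp.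
Proof.
move=> u; rewrite /clamp.
apply: (@continuous_max R R (cst 0) (cst 1 \min id)); first exact: cvg_cst.
by apply: continuous_min; [exact: cvg_cst|exact: cvg_id].
Qed.

Lemma continuous_clamped {Z : topologicalType} (g : R -> Z) :
  {within `[0, 1]%classic, continuous g} -> continuous (g \o clamp).
Proof.
apply: continuous_comp_within; first exact: continuous_clamp.
by move=> x /=; rewrite in_itv/= clamp_itv.
Qed.

End Continuity.

Section Cocycle.
Context {R : realType} (T : topologicalType) (A : set T).
Variables (z : (R -> T) -> 'Z_4) (zA : cocycle A z).

Lemma cocycle_ext (g h : R -> T) : path_in A g ->
  (forall u, 0 <= u <= 1 -> g u = h u) -> z g = z h.
Proof. exact: zA.1. Qed.

Lemma cocycle_triangle (sigma : R * R -> T) : continuous sigma ->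
  (forall w, simplex2 w -> A (sigma w)) ->
  z (fun u => sigma (0, u)) = z (fun u => sigma (1 - u, u)) + z (fun u => sigma (u, 0)).
Proof.
move=> cs hs; have := zA.2 sigma (continuous_subspaceT cs) hs.
by move/eqP; rewrite addrAC subr_eq0 => /eqP.
Qed.

Lemma cocycle_const (x : T) : A x -> z (cst x) = 0.
Proof.
move=> Ax; have h : z (cst x) = z (cst x) + z (cst x).
  by apply: (@cocycle_triangle (cst x)) => //; exact: cst_continuous.
by apply: (@addrI _ (z (cst x))); rewrite addr0 -h.
Qed.

(** The diagonal cuts the square into two singular simplices, and each of them computes [z] of the
    diagonal. *)
Lemma cocycle_square (H : R * R -> T) : continuous H ->
  (forall u v, 0 <= u <= 1 -> 0 <= v <= 1 -> A (H (u, v))) ->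
  z (fun u => H (u, 0)) + z (fun v => H (1, v)) =
  z (fun v => H (0, v)) + z (fun u => H (u, 1)).
Proof.
move=> cH hH.
have h1 := @cocycle_triangle (fun w => H (w.1 + w.2, w.2)).
have h2 := @cocycle_triangle (fun w => H (w.2, w.1 + w.2)).
have cfst := @continuousT_fst R R; have csnd := @continuousT_snd R R.
have cadd := continuousTD cfst csnd.
have c1 := continuousT_comp (continuousT_pair cadd csnd) cH.
have c2 := continuousT_comp (continuousT_pair csnd cadd) cH.
have {}h1 := h1 c1; have {}h2 := h2 c2.
have e1 : (fun u : R => H (1 - u + u, u)) = (fun v => H (1, v)).
  by apply/funext => u; rewrite subrK.
have e2 : (fun u : R => H (u, 1 - u + u)) = (fun u => H (u, 1)).
  by apply/funext => u; rewrite subrK.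
have e3 : (fun u : R => H (0 + u, u)) = (fun u => H (u, 0 + u)).
  by apply/funext => u; rewrite add0r.
have e4 : (fun u : R => H (u + 0, 0)) = (fun u => H (u, 0)).
  by apply/funext => u; rewrite addr0.
have e5 : (fun u : R => H (0, u + 0)) = (fun u => H (0, u)).
  by apply/funext => u; rewrite addr0.
rewrite /= e1 e3 e4 in h1; rewrite /= e2 e5 in h2.
rewrite [LHS]addrC [RHS]addrC -h1 -?h2// => -[u v] [/= u0 v0 uv]; apply: hH; lra.
Qed.

Lemma continuous_concat (g h : R -> T) : continuous g -> continuous h ->
  g 1 = h 0 -> continuous (Defs.concat g h).
Proof.
move=> cg ch gh.
have cg2 : continuous (fun u : R => g (2 * u)).
  apply: continuousT_comp cg; apply: continuousTM; last by move=> x; exact: cvg_id.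
  by move=> x; exact: cvg_cst.
have ch2 : continuous (fun u : R => h (2 * u - 1)).
  apply: continuousT_comp ch; apply: continuousTB; last by move=> x; exact: cvg_cst.
  apply: continuousTM; last by move=> x; exact: cvg_id.
  by move=> x; exact: cvg_cst.
have : {within [set u : R | u <= 2^-1] `|` [set u : R | 2^-1 <= u],
    continuous (Defs.concat g h)}.
  apply: withinU_continuous; [exact: closed_le|exact: closed_ge| |].
  - apply: subspace_eq_continuous (continuous_subspaceT cg2) => u.
    by rewrite inE /= => hu; rewrite /from_subspace /= /Defs.concat hu.
  - apply: subspace_eq_continuous (continuous_subspaceT ch2) => u.
    rewrite inE /= => hu; rewrite /from_subspace /= /Defs.concat; case: ifP => // hu'.
    have -> : u = 2^-1 :> R by apply/eqP; rewrite eq_le hu' hu.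
    by rewrite divff// subrr gh.
have -> : [set u : R | u <= 2^-1] `|` [set u : R | 2^-1 <= u] = setT.
  by apply/seteqP; split=> // u _ /=; case: (leP u 2^-1) => [|/ltW]; [left|right].
rewrite continuous_open_subspace; last exact: openT.
by move=> c x; apply: c; rewrite inE.
Qed.

Lemma clamped_path_in (g : R -> T) : path_in A g ->
  [/\ continuous (g \o clamp), forall u, A (g (clamp u)) & z (g \o clamp) = z g].
Proof.
move=> gA; have hA u : A (g (clamp u)) by apply: gA.2; exact: clamp_itv.
split=> //; first exact: continuous_clamped gA.1.
by apply/esym/cocycle_ext => // u hu /=; rewrite clamp_id.
Qed.

Lemma cocycle_concat (g h : R -> T) : path_in A g -> path_in A h -> g 1 = h 0 ->
  z (Defs.concat g h) = z g + z h.
Proof.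
move=> gA hA gh.
have [cg Ag <-] := clamped_path_in gA; have [ch Ah <-] := clamped_path_in hA.
have c1 : clamp 1 = 1 :> R by rewrite clamp_id ?ler01 ?lexx.
have c0 : clamp 0 = 0 :> R by rewrite clamp_id ?ler01 ?lexx.
set g' := g \o clamp; set h' := h \o clamp.
have gh' : g' 1 = h' 0 by rewrite /g' /h' /= c1 c0.
have cc := continuous_concat cg ch gh'.
have Ac u : A (Defs.concat g' h' u) by rewrite /Defs.concat; case: ifP => _; [exact: Ag|exact: Ah].
(* Evaluating the concatenation at [w.1 / 2 + w.2] gives a simplex whose edge [w.1 = 0] runs through
   the whole concatenation, while the other two edges trace [g] and [h]. *)
have half_cont : continuous (fun w : R * R => 2^-1 * w.1 + w.2).
  apply: continuousTD; last exact: continuousT_snd.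
  by apply: continuousTM; [move=> x; exact: cvg_cst|exact: continuousT_fst].
have := cocycle_triangle (continuousT_comp half_cont cc) (fun w _ => Ac _) => /=.
have -> : (fun u : R => Defs.concat g' h' (2^-1 * 0 + u)) = Defs.concat g' h'.
  by apply/funext => u; rewrite mulr0 add0r.
have -> : z (Defs.concat g' h') = z (Defs.concat g h).
  apply: cocycle_ext; first by split=> //; exact: continuous_subspaceT.
  move=> u hu; rewrite /Defs.concat /g' /h' /=; case: leP => hu'; rewrite clamp_id//; lra.
move=> ->; rewrite addrC; congr (_ + _); apply/esym/cocycle_ext.
- by split=> [|u _]; [apply: continuous_subspaceT; exact: cg|exact: Ag].
- move=> u hu; rewrite /Defs.concat addr0 ifT; last by lra.
  by rewrite mulrA divff// mul1r.
- by split=> [|u _]; [apply: continuous_subspaceT; exact: ch|exact: Ah].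
- move=> u hu; rewrite /Defs.concat; case: leP => hu'.
    have -> : u = 0 by lra.
    rewrite (_ : 2 * _ = 1); last by lra.
    exact/esym.
  by congr h'; lra.
Qed.

Lemma cocycle_cst_eq (g : R -> T) x : A x -> (forall u, g u = x) -> z g = 0.
Proof. by move=> Ax gx; rewrite (_ : g = cst x) ?cocycle_const//; apply/funext. Qed.

Section Segment.
Variables (E : normedModType R) (F : E -> T) (D : set E).
Hypotheses (cF : continuous F) (FD : forall x, D x -> A (F x)).
Hypothesis convD : forall a b (t : R), D a -> D b -> 0 <= t <= 1 ->
  D ((1 - t) *: a + t *: b).

Definition seg (a b : E) (u : R) : E := (1 - u) *: a + u *: b.
(** The value of [z] on the image of a straight segment. On a convex set it serves as a normal form:
    every path there has the value of the segment between its ends. *)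
Definition zseg (a b : E) := z (F \o seg a b).

Lemma continuous_seg a b : continuous (seg a b).
Proof.
apply: continuousTD; apply: continuousTZ; try by move=> x; exact: cvg_cst.
  by apply: continuousTB; [move=> x; exact: cvg_cst|move=> x; exact: cvg_id].
by move=> x; exact: cvg_id.
Qed.

Lemma seg0 a b : seg a b 0 = a.
Proof. by rewrite /seg subr0 scale1r scale0r addr0. Qed.

Lemma seg1 a b : seg a b 1 = b.
Proof. by rewrite /seg subrr scale1r scale0r add0r. Qed.

Lemma segxx a u : seg a a u = a.
Proof. by rewrite /seg -scalerDl subrK scale1r. Qed.

(** The straight-line homotopy keeps the ends fixed, so two sides of its square are constant and
    contribute nothing. *)
Lemma zseg_path (g : R -> E) : continuous g -> (forall u, 0 <= u <= 1 -> D (g u)) ->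
  z (F \o g) = zseg (g 0) (g 1).
Proof.
move=> cg gD.
pose H (w : R * R) := F (seg (g w.1) (seg (g 0) (g 1) w.1) w.2).
have cfst := @continuousT_fst R R; have csnd := @continuousT_snd R R.
have c1 : continuous (fun w : R * R => 1 - w.2).
  by apply: continuousTB => //; move=> x; exact: cvg_cst.
have cH : continuous H.
  apply: continuousT_comp cF; apply: continuousTD; apply: continuousTZ => //.
    exact: continuousT_comp cfst cg.
  have cs := @continuous_seg (g 0) (g 1).
  exact: continuousT_comp cfst cs.
have D0 : D (g 0) by apply: gD; rewrite lexx ler01.
have D1 : D (g 1) by apply: gD; rewrite lexx ler01.
have := cocycle_square cH.
rewrite (@cocycle_cst_eq (fun v => H (1, v)) (F (g 1))) ?addr0; last 2 first.
- exact: FD.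
- by move=> u; rewrite /H /= seg1 segxx.
rewrite (@cocycle_cst_eq (fun v => H (0, v)) (F (g 0))) ?add0r; last 2 first.
- exact: FD.
- by move=> u; rewrite /H /= seg0 segxx.
have -> : (fun u => H (u, 0)) = F \o g by apply/funext => u; rewrite /H/= seg0.
have -> : (fun u => H (u, 1)) = F \o seg (g 0) (g 1) by apply/funext => u; rewrite /H/= seg1.
apply=> u v hu hv; apply: FD; apply: convD => //; first exact: gD.
exact: convD.
Qed.

Lemma zseg_xx a : D a -> zseg a a = 0.
Proof. by move=> Da; apply: (@cocycle_cst_eq _ (F a)); [exact: FD|move=> u; rewrite /= segxx]. Qed.

(** The square is the cone from [a] over the segment from [b] to [c]; its collapsed side contributes
    nothing. *)
Lemma zseg_add a b c : D a -> D b -> D c -> zseg a b + zseg b c = zseg a c.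
Proof.
move=> Da Db Dc; pose H (w : R * R) := F (seg a (seg b c w.2) w.1).
have cfst := @continuousT_fst R R; have csnd := @continuousT_snd R R.
have cH : continuous H.
  apply: continuousT_comp cF; apply: continuousTD; apply: continuousTZ => //.
  - by apply: continuousTB => //; move=> x; exact: cvg_cst.
  - by move=> x; exact: cvg_cst.
  - by have cs := @continuous_seg b c; exact: continuousT_comp csnd cs.
have := cocycle_square cH.
rewrite (@cocycle_cst_eq (fun v => H (0, v)) (F a)) ?add0r; last 2 first.
- exact: FD.
- by move=> u; rewrite /H /= seg0.
have -> : (fun u => H (u, 0)) = F \o seg a b by apply/funext => u; rewrite /H/= seg0.
have -> : (fun u => H (1, u)) = F \o seg b c by apply/funext => u; rewrite /H/= seg1.
have -> : (fun u => H (u, 1)) = F \o seg a c by apply/funext => u; rewrite /H/= seg1.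
apply=> u v hu hv; apply: FD; apply: convD => //.
exact: convD.
Qed.

End Segment.
End Cocycle.

(** * Half turns about a corner have value one *)

Section HalfTurn.
Context {R : realType}.
Variables (z : (R -> pillow R) -> 'Z_4) (z_class : represents_z z).
Implicit Types v w Q B : R * R.

Definition near_corner v := `|v.1| < pi /\ `|v.2| < pi.

(* The two half squares overlap along the upper half of the antidiagonal and
   avoid the corner; being convex, they determine [z] of a path inside by its
   endpoints. *)
Definition upper_right v :=
  near_corner v /\ (0 < v.1 + v.2 \/ v.1 + v.2 = 0 /\ 0 < v.2 - v.1).

Definition upper_left v :=
  near_corner v /\ (v.1 + v.2 < 0 \/ v.1 + v.2 = 0 /\ 0 < v.2 - v.1).

Lemma pair_ext v w : v.1 = w.1 -> v.2 = w.2 -> v = w.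
Proof. by case: v w => ? ? [? ?] /= -> ->. Qed.

Lemma segE (a b u : R) : seg (a : R^o) b u = (1 - u) * a + u * b.
Proof. by []. Qed.

Lemma unit_itv_convex (a b : R^o) (t : R) : 0 <= a <= 1 -> 0 <= b <= 1 ->
  0 <= t <= 1 -> 0 <= (1 - t) *: a + t *: b <= 1.
Proof.
move: a b => a b ha hb ht.
have [a0 a1] := andP ha; have [b0 b1] := andP hb; have [t0 t1] := andP ht.
have t1' : 0 <= 1 - t by rewrite subr_ge0.
rewrite ![_ *: _]/(_ * _) addr_ge0 ?mulr_ge0//= -[leRHS](subrK t) lerD// ler_piMr//.
Qed.

Lemma combine1 v w (s t : R) : (s *: v + t *: w).1 = s * v.1 + t * w.1.
Proof. by []. Qed.

Lemma combine2 v w (s t : R) : (s *: v + t *: w).2 = s * v.2 + t * w.2.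
Proof. by []. Qed.

Lemma near_corner_convex v w (t : R) : near_corner v -> near_corner w ->
  0 <= t <= 1 -> near_corner ((1 - t) *: v + t *: w).
Proof.
move=> [v1 v2] [w1 w2] t01; rewrite /near_corner /=.
have h (x y : R) : `|x| < pi -> `|y| < pi -> `|(1 - t) * x + t * y| < pi.
  rewrite !ltr_norml => /andP[x1 x2] /andP[y1 y2].
  have [->|t0] := eqVneq t 0; first by rewrite subr0 mul0r mul1r addr0 x1.
  have {}t0 : 0 < t by rewrite lt_neqAle eq_sym t0; case/andP: t01.
  by apply/andP; split; nra.
by split; apply: h.
Qed.

(** Up to sign, both half squares are the points where the pair of sum and difference of coordinates
    is lexicographically positive, a condition preserved by convex combinations. *)
Lemma lex_convex (s t a b a' b' : R) : s = 1 - t -> 0 <= t <= 1 ->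
  (0 < a \/ a = 0 /\ 0 < b) -> (0 < a' \/ a' = 0 /\ 0 < b') ->
  0 < s * a + t * a' \/ s * a + t * a' = 0 /\ 0 < s * b + t * b'.
Proof.
move=> -> t01 h h'.
have [->|t0] := eqVneq t 0; first by rewrite subr0 !mul1r !mul0r !addr0.
have [->|t1] := eqVneq t 1; first by rewrite subrr !mul1r !mul0r !add0r.
have {}t0 : 0 < t by rewrite lt_neqAle eq_sym t0; case/andP: t01.
have {}t1 : 0 < 1 - t by rewrite subr_gt0 lt_neqAle t1; case/andP: t01.
case: h => [h|[-> h]]; case: h' => [h'|[-> h']]; rewrite ?mulr0 ?add0r ?addr0.
- by left; rewrite addr_gt0// mulr_gt0.
- by left; rewrite mulr_gt0.
- by left; rewrite mulr_gt0.
- by right; rewrite addr_gt0// mulr_gt0.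
Qed.

Lemma upper_right_convex v w (t : R) : upper_right v -> upper_right w ->
  0 <= t <= 1 -> upper_right ((1 - t) *: v + t *: w).
Proof.
move=> [cv hv] [cw hw] t01; split; first exact: near_corner_convex.
have := lex_convex erefl t01 hv hw; rewrite combine1 combine2.
by move=> [h|[h1 h2]]; [left|right; split]; lra.
Qed.

Lemma upper_left_convex v w (t : R) : upper_left v -> upper_left w ->
  0 <= t <= 1 -> upper_left ((1 - t) *: v + t *: w).
Proof.
move=> [cv hv] [cw hw] t01; split; first exact: near_corner_convex.
have flip x : (x.1 + x.2 < 0 \/ x.1 + x.2 = 0 /\ 0 < x.2 - x.1) ->
    0 < - (x.1 + x.2) \/ - (x.1 + x.2) = 0 /\ 0 < x.2 - x.1 :> R.
  by move=> [h|[h1 h2]]; [left|right; split]; lra.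
have := lex_convex erefl t01 (flip _ hv) (flip _ hw); rewrite combine1 combine2.
by move=> [h|[h1 h2]]; [left|right; split]; lra.
Qed.

Lemma near_corner_lattice (m n : int) v : near_corner v ->
  lattice ((pi * m%:~R, pi * n%:~R) + v) -> v = 0.
Proof.
move=> [v1 v2] [m' [n' [/= e1 e2]]].
have h (x : R) (k k' : int) : `|x| < pi -> pi * k%:~R + x = pi * k'%:~R -> x = 0.
  move=> hx e; have xe : x = pi * (k' - k)%:~R by rewrite intrB; lra.
  have p0 := @pi_gt0 R; rewrite xe normrM gtr0_norm// gtr_pMr// -intr_norm in hx.
  have : k' - k = 0 by move: hx; rewrite (ltr_int R _ 1); lia.
  by move=> h; rewrite xe h mulr0.
by case: v v1 v2 e1 e2 => x y /= v1 v2 /(h _ _ _ v1) -> /(h _ _ _ v2) ->.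
Qed.

Variables m n : int.
Definition centered v : pillow R := proj ((pi * m%:~R, pi * n%:~R) + v).

Lemma continuous_centered : continuous centered.
Proof.
apply: continuousT_comp (@continuous_proj R).
by apply: continuousTD; [move=> x; exact: cvg_cst|move=> x; exact: cvg_id].
Qed.

(** The central symmetry about a lattice point belongs to the group; this is what closes a half turn
    up to a loop. *)
Lemma centeredN v : centered (- v) = centered v.
Proof.
rewrite /centered -[RHS]projN -[RHS](projD2pi _ m n); congr proj.
by apply: pair_ext => /=; ring.
Qed.

Lemma upper_right_star v : upper_right v -> pillow_star (centered v).
Proof.
move=> [cv hv]; apply/pillow_starP => /(near_corner_lattice cv) v0.
by move: hv; rewrite v0 /= !addr0 subrr ltxx => -[|[]].
Qed.

Lemma upper_left_star v : upper_left v -> pillow_star (centered v).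
Proof.
move=> [cv hv]; apply/pillow_starP => /(near_corner_lattice cv) v0.
by move: hv; rewrite v0 /= !addr0 subrr ltxx => -[|[]].
Qed.

Local Notation zc := (zseg z centered).

Let addR := zseg_add z_class.1 continuous_centered upper_right_star upper_right_convex.
Let addL := zseg_add z_class.1 continuous_centered upper_left_star upper_left_convex.
Let pathR := zseg_path z_class.1 continuous_centered upper_right_star upper_right_convex.
Let pathL := zseg_path z_class.1 continuous_centered upper_left_star upper_left_convex.
Let zxxR := zseg_xx z_class.1 upper_right_star.

Lemma upper_leftN Q : upper_right Q -> 0 < Q.1 + Q.2 -> upper_left (- Q).
Proof. by move=> [[q1 q2] _] q0; split; [split; rewrite normrN|left => /=; lra]. Qed.

(** Moving the start from [Q] to [Q'] also moves the end from [- Q] to [- Q'], and the two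
    corrections cancel since antipodal segments have the same image. The crossing point [B] can be
    moved inside the overlap, where both half squares compute the same value. *)
Lemma half_turn_move Q B Q' B' : upper_right Q -> 0 < Q.1 + Q.2 ->
  upper_right Q' -> 0 < Q'.1 + Q'.2 ->
  upper_right B -> upper_left B -> upper_right B' -> upper_left B' ->
  zc Q B + zc B (- Q) = zc Q' B' + zc B' (- Q').
Proof.
move=> hQ q hQ' q' rB lB rB' lB'.
have nQ := upper_leftN hQ q; have nQ' := upper_leftN hQ' q'.
rewrite -(addR hQ hQ' rB) -(addR hQ' rB' rB) -(addL lB nQ' nQ) -(addL lB lB' nQ').
have -> : zc (- Q') (- Q) = zc Q' Q.
  congr z; apply/funext => u /=; rewrite -(centeredN (seg Q' Q u)); congr centered.
  by rewrite /seg !scalerN opprD.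
have e1 : zc Q Q' + zc Q' Q = 0 by rewrite addR// zxxR.
have e2 : zc B' B + zc B B' = 0 by rewrite addR// zxxR.
rewrite addrCA; transitivity (zc Q Q' + zc Q' Q + (zc B' B + zc B B') + (zc Q' B' + zc B' (- Q')));
  last by rewrite e1 e2 !add0r.
by ring.
Qed.


Lemma cos_piquarter_gt0 : 0 < cos (pi / 4) :> R.
Proof. by apply: cos_gt0_pihalf; have := @pi_gt0 R; lra. Qed.

Lemma sin_piquarter : sin (pi / 4) = cos (pi / 4) :> R.
Proof.
have -> : pi / 4 = - (pi / 4) + pi / 2 :> R by lra.
by rewrite sinDpihalf cosN; congr cos; lra.
Qed.

(** A lift of [corner_loop] of radius [1 / 2] with the corner moved to the origin. At [u = 3 / 4] it
    crosses the upper antidiagonal and passes from one half square to the other. *)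
Let arc (u : R) : R * R := (2^-1 * cos (pi * u), 2^-1 * sin (pi * u)).

Let arc_near u : near_corner (arc u).
Proof.
have h x : `|x| <= 1 -> `|2^-1 * x| < pi :> R.
  by move=> hx; rewrite normrM gtr0_norm//; have := @pi_ge2 R; lra.
by split; apply: h; [exact: cos_max|exact: sin_max].
Qed.

Let arc_sum u : (arc u).1 + (arc u).2 = (2 * cos (pi / 4))^-1 * sin (pi * u + pi / 4).
Proof.
have := cos_piquarter_gt0 => c0; rewrite sinD sin_piquarter /arc/=.
by field; rewrite gt_eqF.
Qed.

Let arc_diff u : (arc u).2 - (arc u).1 = (2 * cos (pi / 4))^-1 * sin (pi * u - pi / 4).
Proof.
have := cos_piquarter_gt0 => c0; rewrite sinB sin_piquarter /arc/=.
by field; rewrite gt_eqF.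
Qed.

Let c4 : 0 < (2 * cos (pi / 4))^-1 :> R.
Proof. by rewrite invr_gt0 mulr_gt0// cos_piquarter_gt0. Qed.

Let arc_mid : (arc (3 / 4)).1 + (arc (3 / 4)).2 = 0 /\ 0 < (arc (3 / 4)).2 - (arc (3 / 4)).1.
Proof.
rewrite arc_sum arc_diff; have -> : pi * (3 / 4) + pi / 4 = pi :> R by lra.
have -> : pi * (3 / 4) - pi / 4 = pi / 2 :> R by lra.
by rewrite sinpi mulr0 sin_pihalf mulr1 c4.
Qed.

Let arc_right u : 0 <= u <= 3 / 4 -> upper_right (arc u).
Proof.
move=> hu; split; first exact: arc_near.
have [->|u34] := eqVneq u (3 / 4); first by right; exact: arc_mid.
have {}u34 : u < 3 / 4 by rewrite lt_neqAle u34; case/andP: hu.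
left; rewrite arc_sum mulr_gt0// sin_gt0_pi//; have := @pi_gt0 R; nra.
Qed.

Let arc_left u : 3 / 4 <= u <= 1 -> upper_left (arc u).
Proof.
move=> hu; split; first exact: arc_near.
have [->|u34] := eqVneq u (3 / 4); first by right; exact: arc_mid.
have {}u34 : 3 / 4 < u by rewrite lt_neqAle eq_sym u34; case/andP: hu.
left; rewrite arc_sum pmulr_rlt0// -[ltRHS]oppr0 -ltrNr -sinN.
have -> : - (pi * u + pi / 4) = - (pi * u - 3 / 4 * pi) - pi :> R by lra.
rewrite -[X in 0 < X]opprK -sinDpi subrK sinN opprK sin_gt0_pi//; have := @pi_gt0 R; nra.
Qed.

Lemma half_turn Q B : upper_right Q -> 0 < Q.1 + Q.2 -> upper_right B -> upper_left B ->
  zc Q B + zc B (- Q) = 1.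
Proof.
move=> hQ q rB lB.
have r0 : upper_right (arc 0) by apply: arc_right; lra.
have r34 : upper_right (arc (3 / 4)) by apply: arc_right; lra.
have l34 : upper_left (arc (3 / 4)) by apply: arc_left; lra.
have a0 : 0 < (arc 0).1 + (arc 0).2 by rewrite /arc mulr0/= cos0 sin0; lra.
rewrite (half_turn_move hQ q r0 a0 rB lB r34 l34).
have carc : continuous arc.
  apply: continuousT_pair; apply: continuousTM; try by move=> x; exact: cvg_cst.
    apply: continuousT_comp (@continuous_cos R); apply: continuousTM.
      by move=> x; exact: cvg_cst.
    by move=> x; exact: cvg_id.
  apply: continuousT_comp (@continuous_sin R); apply: continuousTM.
    by move=> x; exact: cvg_cst.
  by move=> x; exact: cvg_id.
pose D (u : R^o) := (0 <= u <= 1 : Prop).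
have FD (u : R^o) : D u -> pillow_star (centered (arc u)).
  move=> hu; have [u34|u34] := lerP u (3 / 4).
    by apply: upper_right_star; apply: arc_right; rewrite /D in hu; lra.
  by apply: upper_left_star; apply: arc_left; rewrite /D in hu; lra.
have cF : continuous (centered \o arc : R^o -> _).
  exact: continuousT_comp carc continuous_centered.
have convD (a b : R^o) (t : R) : D a -> D b -> 0 <= t <= 1 -> D ((1 - t) *: a + t *: b).
  exact: unit_itv_convex.
have D0 : D 0 by rewrite /D lexx ler01.
have D1 : D 1 by rewrite /D lexx ler01.
have D34 : D (3 / 4) by rewrite /D; lra.
have cid : continuous (id : R -> R^o) by move=> x; exact: cvg_id.
have := zseg_path z_class.1 cF FD convD cid (fun u hu => hu).
rewrite -(zseg_add z_class.1 cF FD convD D0 D34 D1).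
have cseg (a b : R^o) : continuous (arc \o seg a b).
  exact: continuousT_comp (continuous_seg (a := a) (b := b)) carc.
rewrite /zseg -![(centered \o arc) \o _]/(centered \o (arc \o _)).
rewrite (pathR (cseg 0 (3 / 4))); last first.
  by move=> u hu; apply: arc_right; rewrite (segE 0 (3 / 4)); lra.
rewrite (pathL (cseg (3 / 4) 1)); last first.
  by move=> u hu; apply: arc_left; rewrite (segE (3 / 4) 1); lra.
rewrite /= !seg0 !seg1.
have -> : arc 1 = - arc 0.
  by apply: pair_ext; rewrite /arc/= !mulr1 !mulr0 ?cospi ?sinpi ?cos0 ?sin0; lra.
move=> <-; have := z_class.2 m n 2^-1.
have -> : corner_loop m n 2^-1 = centered \o arc \o id :> (R -> pillow R) by [].
by apply; have := @pi_ge2 R; lra.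
Qed.

(* The loop runs along [G] from the right of the corner to its left, and then
   straight to the antipode of its starting point. *)
Lemma half_turn_curve (G : R -> R * R) (s0 s1 s2 : R) : continuous G ->
  (forall u, 0 <= u <= 1 -> upper_right (G (seg (s0 : R^o) s1 u))) ->
  (forall u, 0 <= u <= 1 -> upper_left (G (seg (s1 : R^o) s2 u))) ->
  0 < (G s0).1 + (G s0).2 ->
  z (fun u => centered (G (seg (s0 : R^o) s1 u))) +
  z (fun u => centered (G (seg (s1 : R^o) s2 u))) + zc (G s2) (- G s0) = 1.
Proof.
move=> cG hR hL G0.
have cseg (a b : R^o) : continuous (G \o seg a b).
  exact: continuousT_comp (continuous_seg (a := a) (b := b)) cG.
have e1 := pathR (cseg s0 s1) hR; have e2 := pathL (cseg s1 s2) hL.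
rewrite -[X in z X + _]/(centered \o (G \o seg (s0 : R^o) s1)) e1.
rewrite -[X in _ + z X]/(centered \o (G \o seg (s1 : R^o) s2)) e2.
have h01 : 0 <= (0 : R) <= 1 by rewrite lexx ler01.
have h11 : 0 <= (1 : R) <= 1 by rewrite lexx ler01.
have := hR _ h01; have := hR _ h11; have := hL _ h01; have := hL _ h11.
rewrite /= !seg0 !seg1 => l2 l1 r1 r0.
by rewrite -addrA addL ?half_turn//; exact: upper_leftN.
Qed.

End HalfTurn.

(** * Degrees and Maslov indices *)

Section SignCount.
Context {R : realType}.
Implicit Types f : R -> R.

Lemma crossing_up f (a u b : R) : a < u < b -> (forall x, a < x < u -> f x < 0) ->
  (forall x, u < x < b -> 0 < f x) -> crossing_sign f u 1.
Proof.
move=> /andP[au ub] h1 h2; apply: Or41; split=> //.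
- near=> x; apply: h1; apply/andP; split; near: x; [exact: nbhs_left_gt|exact: nbhs_left_lt].
- near=> x; apply: h2; apply/andP; split; near: x; [exact: nbhs_right_gt|exact: nbhs_right_lt].
Unshelve. all: by end_near. Qed.

Lemma crossing_down f (a u b : R) : a < u < b -> (forall x, a < x < u -> 0 < f x) ->
  (forall x, u < x < b -> f x < 0) -> crossing_sign f u (-1).
Proof.
move=> /andP[au ub] h1 h2; apply: Or42; split=> //.
- near=> x; apply: h1; apply/andP; split; near: x; [exact: nbhs_left_gt|exact: nbhs_left_lt].
- near=> x; apply: h2; apply/andP; split; near: x; [exact: nbhs_right_gt|exact: nbhs_right_lt].
Unshelve. all: by end_near. Qed.

(** The four cases of [crossing_sign] become one formula: the sign is the jump of the indicator of
    [0 < f]. The points [x] and [y] are close enough to [u] that no other listed zero lies between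
    them. *)
Lemma crossing_near f (u a b : R) (s : int) (us : seq R) : crossing_sign f u s ->
  a < u < b -> exists x y,
  [/\ a < x < u, u < y < b, forall v, v \in us -> v < u -> v < x,
      forall v, v \in us -> u < v -> y < v &
      f x != 0 /\ f y != 0 /\ s = (0 < f y)%R%:Z - (0 < f x)%R%:Z].
Proof.
move=> cs /andP[au ub].
have L' (vs : seq R) : \forall x \near u^'-, forall v, v \in vs -> v < u -> v < x.
  elim: vs => [|w vs IH]; first by apply: nearW.
  have Lw : \forall x \near u^'-, w < u -> w < x.
    by have [wu|_] := boolP (w < u); [near do move=> _; exact: nbhs_left_gt|exact: nearW].
  by apply: filterS2 IH Lw => x h hw v; rewrite inE => /orP[/eqP->|/h].
have M' (vs : seq R) : \forall x \near u^'+, forall v, v \in vs -> u < v -> x < v.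
  elim: vs => [|w vs IH]; first by apply: nearW.
  have Mw : \forall x \near u^'+, u < w -> x < w.
    by have [wu|_] := boolP (u < w); [near do move=> _; exact: nbhs_right_lt|exact: nearW].
  by apply: filterS2 IH Mw => x h hw v; rewrite inE => /orP[/eqP->|/h].
have L : \forall x \near u^'-, [/\ a < x, x < u & forall v, v \in us -> v < u -> v < x].
  near=> x; split; near: x; [exact: nbhs_left_gt|exact: nbhs_left_lt|exact: L'].
have M : \forall y \near u^'+, [/\ u < y, y < b & forall v, v \in us -> u < v -> y < v].
  near=> x; split; near: x; [exact: nbhs_right_gt|exact: nbhs_right_lt|exact: M'].
have K (P Q : R -> Prop) : (\forall x \near u^'-, P x) -> (\forall x \near u^'+, Q x) ->
  exists x y, [/\ a < x < u, u < y < b, forall v, v \in us -> v < u -> v < x,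
      forall v, v \in us -> u < v -> y < v & P x /\ Q y].
  move=> hP hQ.
  have [x [[ax xu hx] px]] := filter_ex (filterI L hP).
  have [y [[uy yb hy] qy]] := filter_ex (filterI M hQ).
  by exists x, y; split=> //; apply/andP.
case: cs => -[hl hr ->]; have [x [y [h1 h2 h3 h4 [fx fy]]]] := K _ _ hl hr;
  exists x, y; split=> //; rewrite ?(lt_eqF fx) ?(lt_eqF fy) ?(gt_eqF fx) ?(gt_eqF fy);
  rewrite ?fx ?fy ?(lt_gtF fx) ?(lt_gtF fy) //.
Unshelve. all: by end_near. Qed.

Lemma no_zero_sign f (a b : R) : a <= b -> {within `[a, b]%classic, continuous f} ->
  (forall u, a <= u <= b -> f u != 0) -> (0 < f b) = (0 < f a).
Proof.
move=> ab cf nz; apply/idP/idP => h.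
  rewrite ltNge; apply/negP => fa.
  have [|c] := @IVT R f a b 0 ab cf; first by rewrite ge_min fa/= le_max (ltW h) orbT.
  by rewrite in_itv/= => /nz/eqP.
rewrite ltNge; apply/negP => fa.
have [|c] := @IVT R f a b 0 ab cf; first by rewrite ge_min fa orbT/= le_max (ltW h).
by rewrite in_itv/= => /nz/eqP.
Qed.

(** The jumps of the indicator of [0 < f] telescope. As the list of zeros is not sorted, the
    induction removes its head [u], splits the other zeros into those left and right of [u], and
    treats the intervals [[a, x]] and [[y, b]] on both sides of [u]. *)
Lemma sign_count f (sg : R -> int) (a b : R) (us : seq R) :
  a <= b -> {within `[a, b]%classic, continuous f} -> uniq us ->
  (forall u, a <= u <= b -> (f u = 0 <-> u \in us)) ->
  (forall u, u \in us -> a < u < b /\ crossing_sign f u (sg u)) ->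
  \sum_(u <- us) sg u = (0 < f b)%R%:Z - (0 < f a)%R%:Z.
Proof.
have [n] := ubnP (size us); elim: n => // n IH in a b us *.
case: us => [|u us].
  move=> _ ab cf _ nz _; rewrite big_nil (@no_zero_sign f a b) ?subrr// => u hu.
  by apply/eqP => /(nz _ hu).
rewrite /= ltnS => sn ab cf /andP[uus us_uniq] zf cs.
have [uab cu] := cs u (mem_head _ _).
have [x [y [axu uyb hx hy [fx [fy e]]]]] := crossing_near us cu uab.
rewrite big_cons (bigID (fun v => v < u)) /=.
rewrite -[X in _ + (X + _)]big_filter -[X in _ + (_ + X)]big_filter.
rewrite (IH a x); first last.
- move=> v; rewrite mem_filter => /andP[vu vus].
  have [|/andP[av vb] cv] := cs v; first by rewrite inE vus orbT.
  by split=> //; rewrite av hx.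
- move=> v hv; rewrite zf ?inE ?mem_filter; last by lra.
  split=> [/orP[/eqP vu|->]|/andP[_ ->]]; rewrite ?orbT//; [lra|].
  by rewrite andbT; lra.
- by rewrite filter_uniq.
- by apply: continuous_subspaceW cf => v /=; rewrite !in_itv/=; lra.
- lra.
- by rewrite (leq_ltn_trans _ sn)// size_filter count_size.
rewrite (IH y b); first last.
- move=> v; rewrite mem_filter -leNgt => /andP[vu vus].
  have [|/andP[av vb] cv] := cs v; first by rewrite inE vus orbT.
  split=> //; rewrite vb andbT; apply: hy => //; rewrite lt_neqAle vu andbT.
  by apply: contraNneq uus => ->.
- move=> v hv; rewrite zf ?inE ?mem_filter -?leNgt; last by lra.
  split=> [/orP[/eqP vu|->]|/andP[_ ->]]; rewrite ?orbT//; [lra|].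
  by rewrite andbT; lra.
- by rewrite filter_uniq.
- by apply: continuous_subspaceW cf => v /=; rewrite !in_itv/=; lra.
- lra.
- by rewrite (leq_ltn_trans _ sn)// size_filter count_size.
by rewrite e; ring.
Qed.

End SignCount.

Section Degrees.
Context {R : realType}.
Implicit Types (v w : R * R) (eta : R).

Lemma is_degree_none (v : R -> R * R) (eta0 : R) : 0 < eta0 ->
  (forall eta u, 0 < eta < eta0 -> 0 <= u <= 1 -> cross (dir (pi / 4 + eta)) (v u) != 0) ->
  is_degree v 0 /\ forall n, is_degree v n -> n = 0.
Proof.
move=> e0 h; split.
  exists eta0 => // eta heta /=; exists [::], (fun=> 0); split=> //.
  - by move=> u hu; split=> // /eqP; rewrite (negPf (h _ _ heta hu)).
  - by rewrite big_nil.
move=> n [eta1 e1 /(_ (Num.min eta0 eta1 / 2))].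
have m0 : 0 < Num.min eta0 eta1 by rewrite lt_min e0.
have ms : Num.min eta0 eta1 / 2 < Num.min eta0 eta1 by lra.
case=> [|us [sg [_ hz hin ->]]].
  by rewrite divr_gt0//= (lt_le_trans ms)// ge_min lexx orbT.
have hm : 0 < Num.min eta0 eta1 / 2 < eta0.
  by rewrite divr_gt0//= (lt_le_trans ms)// ge_min lexx.
case: us hz hin => [|u us] hz hin; first by rewrite big_nil.
have [/andP[u0 u1] _] := hin u (mem_head _ _).
have hu : 0 <= u <= 1 by rewrite !ltW.
by have := h _ _ hm hu; rewrite (hz _ hu).2 ?eqxx// mem_head.
Qed.

Lemma is_degree_up (v : R -> R * R) (eta0 : R) : 0 < eta0 ->
  (forall eta, 0 < eta < eta0 -> let w := dir (pi / 4 + eta) in exists2 u0, 0 < u0 < 1 &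
    cross w (v u0) = 0 /\ forall u, 0 <= u <= 1 ->
    (u < u0 -> cross w (v u) * dot w (v u) < 0) /\
    (u0 < u -> 0 < cross w (v u) * dot w (v u))) ->
  is_degree v 1.
Proof.
move=> e0 h; exists eta0 => // eta /h [u0 hu0 [z0 hs]] /=.
exists [:: u0], (fun=> 1); split=> //; last by rewrite big_seq1.
- move=> u hu; rewrite inE; split=> [cu|/eqP->//].
  apply/eqP; have [h1 h2] := hs u hu; rewrite cu mul0r in h1 h2.
  by have [/h1|/h2|] := ltgtP u u0; rewrite ?ltxx.
- move=> u; rewrite inE => /eqP->; split=> //.
  by apply: (crossing_up hu0) => x hx; apply hs; lra.
Qed.

(** Signs are only prescribed in a window of width [a] around [u0]: along a turn by almost [pi] the
    factor [dot] changes sign as well, although the lines meet only once. *)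
Lemma is_degree_down (v : R -> R * R) (eta0 : R) : 0 < eta0 ->
  (forall eta, 0 < eta < eta0 -> let w := dir (pi / 4 + eta) in exists2 u0, 0 < u0 < 1 &
    cross w (v u0) = 0 /\ exists2 a, 0 < a & forall u, 0 <= u <= 1 -> u != u0 ->
    cross w (v u) != 0 /\
    (u0 - a < u < u0 -> 0 < cross w (v u) * dot w (v u)) /\
    (u0 < u < u0 + a -> cross w (v u) * dot w (v u) < 0)) ->
  is_degree v (-1).
Proof.
move=> e0 h; exists eta0 => // eta /h [u0 hu0 [z0 [a a0 hs]]] /=.
exists [:: u0], (fun=> -1); split=> //; last by rewrite big_seq1.
- move=> u hu; rewrite inE; split=> [cu|/eqP->//].
  apply/negPn/negP => /(hs u hu)[/eqP]; by rewrite cu.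
- move=> u; rewrite inE => /eqP->; split=> //.
  have hm : Num.max (u0 - a) 0 < u0 < Num.min (u0 + a) 1.
    by rewrite gt_max lt_min; apply/andP; split; apply/andP; split; lra.
  apply: (crossing_down hm) => x; rewrite ?gt_max ?lt_min => /andP[].
    move=> /andP[x1 x2] x3; have [||_ [h1 _]] := hs x; [lra|by rewrite lt_eqF|].
    by apply: h1; lra.
  move=> x3 /andP[x1 x2]; have [||_ [_ h1]] := hs x; [lra|by rewrite gt_eqF|].
  by apply: h1; lra.
Qed.

(* Coordinates along and across the diagonal: [(x, y)] becomes [(x + y, y - x)]. *)
Lemma cross_dir eta v : cross (dir (pi / 4 + eta)) v =
  cos (pi / 4) * ((v.2 - v.1) * cos eta - (v.1 + v.2) * sin eta).
Proof. by rewrite /cross /dir /= cosD sinD sin_piquarter; ring. Qed.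

Lemma dot_dir eta v : dot (dir (pi / 4 + eta)) v =
  cos (pi / 4) * ((v.1 + v.2) * cos eta + (v.2 - v.1) * sin eta).
Proof. by rewrite /dot /dir /= cosD sinD sin_piquarter; ring. Qed.

Lemma small_angle eta : 0 < eta < 1 / 4 ->
  [/\ 0 < sin eta, sin eta <= eta & 3 / 4 <= cos eta <= 1].
Proof.
move=> he; have := @pi_ge2 R => p2; split.
- by apply: sin_gt0_pi; lra.
- have := sin_lip eta 0; rewrite sin0 !subr0 [X in _ <= X]ger0_norm; last lra.
  exact: le_trans (ler_norm _).
- have := cos_lip eta 0; rewrite cos0 subr0 [X in _ <= X]ger0_norm; last lra.
  by rewrite cos_le1 andbT distrC => /(le_trans (ler_norm _)); lra.
Qed.

Lemma small_combination (k eta : R) : k != 0 -> 0 < eta < 1 / 4 -> eta < `|k| / 2 ->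
  (0 < k * cos eta + sin eta) = (0 < k) /\ (0 < - (k * cos eta + sin eta)) = (k < 0).
Proof.
move=> k0 he; have [s0 s1 /andP[c0 c1]] := small_angle he.
case: (ltgtP k 0) k0 => // hk _; rewrite ?(ltr0_norm hk) ?(gtr0_norm hk) => h.
  have : k * cos eta + sin eta < 0 by nra.
  by move=> hh; split; [rewrite lt_gtF|rewrite oppr_gt0 hh].
have : 0 < k * cos eta + sin eta by nra.
by move=> hh; split; [rewrite hh|rewrite oppr_gt0 lt_gtF].
Qed.

Lemma velocity_L0 (e s : R) :
  velocity (L0_lift e) s = (1 + e * cos s, 1 - e * cos s).
Proof.
rewrite /velocity /L0_lift /= !derive1E; congr pair.
  apply: derive_val; apply: is_derive_eq.
  by rewrite ?scaler0 ?addr0 /GRing.scale/= ?mulr0 ?mulr1 ?add0r ?addr0.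
apply: derive_val; apply: is_derive_eq.
by rewrite ?scaler0 ?addr0 /GRing.scale/= ?mulr0 ?mulr1 ?add0r ?addr0.
Qed.

End Degrees.

Section Maslov.
Context {R : realType}.

Definition L0_tangent (e s : R) : R * R := (1 + e * cos s, 1 - e * cos s).

Lemma cross_L0 (eta e s : R) : cross (dir (pi / 4 + eta)) (L0_tangent e s) =
  - (2 * cos (pi / 4)) * (e * cos s * cos eta + sin eta).
Proof. by rewrite cross_dir /L0_tangent /=; ring. Qed.

(** The tangent of [L_0] stays within a right angle of the reference direction, so [dot] is positive
    and the sign comes from [cross] alone. *)
Lemma cross_dot_L0 (eta e s : R) : 0 < e < 1 -> 0 < eta < 1 / 4 -> exists2 c, 0 < c &
  cross (dir (pi / 4 + eta)) (L0_tangent e s) * dot (dir (pi / 4 + eta)) (L0_tangent e s) =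
  - (c * (e * cos s * cos eta + sin eta)).
Proof.
move=> he heta; have [s0 s1 /andP[c0 c1]] := small_angle heta; have c4 := @cos_piquarter_gt0 R.
exists (4 * cos (pi / 4) ^+ 2 * (cos eta - e * cos s * sin eta)); last first.
  by rewrite cross_L0 dot_dir /L0_tangent /=; ring.
rewrite !mulr_gt0// ?exprn_gt0// subr_gt0.
have h : e * cos s <= 1 by have := cos_le1 s; nra.
nra.
Qed.

(** With [eta] below half of [|e cos|] at both ends, the sign of [cross * dot] there is opposite to
    that of [cos], and [sign_count] reduces any degree to these end values, however the path runs in
    between. *)
Lemma maslov_L0_unique (e : R) (alpha : R -> R) (n : int) : 0 < e < 1 ->
  {within `[0, 1]%classic, continuous alpha} ->
  cos (alpha 0) != 0 -> cos (alpha 1) != 0 -> is_maslov (L0_lift e) alpha n ->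
  n = (cos (alpha 1) < 0)%R%:Z - (cos (alpha 0) < 0)%R%:Z.
Proof.
move=> he ca a0 a1 [eta1 e1].
have ek x : x != 0 -> e * x != 0 by move=> hx; rewrite mulf_neq0// gt_eqF//; case/andP: he.
pose m := Num.min (Num.min eta1 (1 / 4)) (Num.min (`|e * cos (alpha 0)| / 2) (`|e * cos (alpha 1)| / 2)).
have m0 : 0 < m by rewrite !lt_min e1 !divr_gt0 ?normr_gt0 ?ek.
have ms : m / 2 < m by lra.
have {ms m0} : 0 < m / 2 < m by rewrite divr_gt0.
move: (m / 2) => eta /andP[h0]; rewrite !lt_min => /andP[/andP[h1 h2] /andP[h3 h4]].
move=> /(_ eta); rewrite h0 h1 => /(_ isT) /= [us [sg [us_uniq hz hs ->]]].
have heta : 0 < eta < 1 / 4 by rewrite h0.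
have c4 := @cos_piquarter_gt0 R.
pose K x := cross (dir (pi / 4 + eta)) (L0_tangent e x) * dot (dir (pi / 4 + eta)) (L0_tangent e x).
have KE x : velocity (L0_lift e) x = L0_tangent e x by rewrite velocity_L0.
have cK : continuous K.
  have -> : K = fun x => (- (2 * cos (pi / 4)) * (cos eta * (e * cos x) + sin eta)) *
     (cos (pi / 4) * (2 * cos eta - 2 * sin eta * (e * cos x))).
    by apply/funext => x; rewrite /K cross_L0 dot_dir /L0_tangent /=; ring.
  have cst_cont (c : R) : continuous (fun _ : R => c) by move=> x; exact: cvg_cst.
  have cc : continuous (fun x => e * cos x) by exact: continuousTM (cst_cont _) (@continuous_cos R).
  apply: continuousTM; apply: continuousTM => //.
    by apply: continuousTD => //; exact: continuousTM.
  by apply: continuousTB => //; exact: continuousTM.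
rewrite (@sign_count R (K \o alpha) _ 0 1) //=.
- rewrite /K; have [c c0 ->] := cross_dot_L0 (alpha 1) he heta; have [c' c0' ->] := cross_dot_L0 (alpha 0) he heta.
  rewrite -!mulrN !pmulr_rgt0// (small_combination (ek _ a0) heta h3).2 (small_combination (ek _ a1) heta h4).2.
  by rewrite !pmulr_rlt0//; case/andP: he.
- exact: continuousT_comp ca cK.
- move=> u hu; rewrite -hz// KE /K /=; have [c c0 ->] := cross_dot_L0 (alpha u) he heta.
  rewrite cross_L0; split=> /eqP.
    by rewrite oppr_eq0 mulf_eq0 gt_eqF//= => /eqP->; rewrite mulr0.
  by rewrite mulf_eq0 oppr_eq0 gt_eqF ?mulr_gt0//= => /eqP->; rewrite mulr0 oppr0.
- move=> u /hs[hu]; have -> : (fun x => cross (dir (pi / 4 + eta)) (velocity (L0_lift e) (alpha x)) *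
      dot (dir (pi / 4 + eta)) (velocity (L0_lift e) (alpha x))) = K \o alpha.
    by apply/funext => x /=; rewrite KE.
  by [].
Qed.

Lemma cos_gt_level (c s : R) : 0 < c <= 1 -> - (pi / 2) < s < acos (- c) -> - c < cos s.
Proof.
move=> hc /andP[s1 s2]; have hc' : -1 <= - c <= 1 by lra.
have [s0|s0] := lerP s 0.
  by have : 0 <= cos s by [apply: cos_ge0_pihalf; have := @pi_gt0 R; lra]; lra.
have ap := acos_lepi hc'; have a0 := acos_ge0 hc'.
rewrite -[X in X < _](acosK (x := - c)) ?in_itv//=.
by rewrite ltr_cos ?in_itv/= //; lra.
Qed.

Lemma cos_lt_level (c s : R) : 0 < c <= 1 -> acos (- c) < s < 2 * pi - acos (- c) -> cos s < - c.
Proof.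
move=> hc; have hc' : -1 <= - c <= 1 by lra.
have ap := acos_lepi hc'; have a0 := acos_ge0 hc'.
have main x : acos (- c) < x <= pi -> cos x < - c.
  move=> hx; rewrite -[X in _ < X](acosK (x := - c)) ?in_itv//=.
  by rewrite ltr_cos ?in_itv/= //; lra.
have [s0|s0] := lerP s pi => hs; first by apply: main; lra.
have -> : cos s = cos (2 * pi - s).
  by rewrite -[RHS]cosN opprB -[RHS](cosD2piz _ 1) mulr1 subrK.
by apply: main; lra.
Qed.

(** On the window from [- pi / 2] to [3 pi / 2] the set where [cos] is below [- c] is the single
    interval from [acos (- c)] to [2 pi - acos (- c)]. A point whose [|cos|] exceeds [c] lies inside
    it or to its left, according to the sign of [cos]. *)
Lemma level_side (c s : R) : 0 < c -> c < `|cos s| -> - (pi / 2) < s < 3 / 2 * pi ->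
  if cos s < 0 then acos (- c) < s < 2 * pi - acos (- c) else s < acos (- c).
Proof.
move=> c0 cs hs; have c1 : c < 1 by exact: lt_le_trans cs (cos_max s).
have hc' : -1 <= - c <= 1 by lra.
have ap := acos_lepi hc'; have a0 := acos_ge0 hc'.
have aK : cos (acos (- c)) = - c by rewrite acosK ?in_itv.
have a2 : pi / 2 < acos (- c).
  rewrite ltNge; apply/negP => h.
  have : 0 <= cos (acos (- c)) by apply: cos_ge0_pihalf; have := @pi_gt0 R; lra.
  by lra.
have main x : 0 <= x <= pi -> cos x < - c -> acos (- c) < x.
  by move=> hx; rewrite -[X in _ < X -> _]aK ltr_cos ?in_itv/= ?a0 ?ap.
case: ltP => h.
  rewrite ltr0_norm// in cs.
  have s2 : pi / 2 < s.
    rewrite ltNge; apply/negP => h'.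
    by have : 0 <= cos s by [apply: cos_ge0_pihalf; lra]; lra.
  have [s0|s0] := lerP s pi.
    by have := main s; have := @pi_gt0 R; lra.
  have := main (2 * pi - s); have -> : cos (2 * pi - s) = cos s.
    by rewrite -[LHS]cosN opprB -[LHS](cosD2piz _ 1) mulr1 subrK.
  by have := @pi_gt0 R; lra.
rewrite ltNge; apply/negP => h'.
rewrite ger0_norm// in cs.
have s3 : pi < s.
  rewrite ltNge; apply/negP => h2.
  have : cos s <= cos (acos (- c)) by rewrite leNgt ltr_cos -?leNgt ?in_itv/= //; lra.
  by lra.
have : cos (s - pi) > 0 by apply: cos_gt0_pihalf; lra.
by have := cosDpi (s - pi); rewrite subrK; lra.
Qed.

End Maslov.

Section MaslovExists.
Context {R : realType}.

(** The level [- c], with [c = tan eta / e], is the value of [cos] at which the tangent of [L_0] has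
    angle [pi / 4 + eta]. *)
Lemma L0_level (e eta s : R) : 0 < e < 1 -> 0 < eta < 1 / 4 ->
  let c := sin eta / (e * cos eta) in let w := dir (pi / 4 + eta) in
  [/\ 0 < c, cos s = - c -> cross w (L0_tangent e s) = 0,
      cos s < - c -> 0 < cross w (L0_tangent e s) * dot w (L0_tangent e s),
      - c < cos s -> cross w (L0_tangent e s) * dot w (L0_tangent e s) < 0 &
      eta < `|e * cos s| / 2 -> c < `|cos s|].
Proof.
move=> he heta c w; have [s0 s1 /andP[c0 c1]] := small_angle heta.
have [e0 e1] := andP he.
have ec : 0 < e * cos eta by apply: mulr_gt0 => //; lra.
have cE : e * cos s * cos eta + sin eta = e * cos eta * (cos s + c).
  by rewrite mulrDr /c [_ * (sin eta / _)]mulrCA divff ?gt_eqF// mulr1; ring.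
have [k k0 dE] := cross_dot_L0 s he heta.
split.
- exact: divr_gt0.
- by move=> cs; rewrite cross_L0 cE cs addNr !mulr0.
- by move=> cs; rewrite dE cE oppr_gt0 !pmulr_rlt0//; lra.
- by move=> cs; rewrite dE cE oppr_lt0 !mulr_gt0//; lra.
- move=> h; rewrite ltr_pdivrMr//; rewrite normrM gtr0_norm// in h.
  have := normr_ge0 (cos s) => n0.
  apply: le_lt_trans s1 (lt_le_trans h _).
  rewrite [leRHS]mulrA [_ * e]mulrC ler_wpM2l//; last by lra.
  by rewrite mulr_ge0// ltW.
Qed.

(** Neither end lies beyond [2 pi - acos (- c)], so a straight path can cross the level only at
    [acos (- c)], at most once; the signs of [cos] at the two ends decide between the degrees [0],
    [1] and [-1]. *)
Lemma maslov_L0_exists (e x y : R) : 0 < e < 1 ->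
  - (pi / 2) < x < 3 / 2 * pi -> - (pi / 2) < y < 3 / 2 * pi ->
  cos x != 0 -> cos y != 0 ->
  is_degree (fun u => L0_tangent e (seg (x : R^o) y u))
    ((cos y < 0)%R%:Z - (cos x < 0)%R%:Z).
Proof.
move=> he hx hy cx cy; have [e0 e1] := andP he.
have ek a : a != 0 -> e * a != 0 by move=> ha; rewrite mulf_neq0// gt_eqF.
pose m := Num.min (1 / 4) (Num.min (`|e * cos x| / 2) (`|e * cos y| / 2)).
have m0 : 0 < m by rewrite !lt_min !divr_gt0 ?normr_gt0 ?ek.
have side eta : 0 < eta < m -> let c := sin eta / (e * cos eta) in
   [/\ 0 < eta < 1 / 4, 0 < c, c <= 1,
     if cos x < 0 then acos (- c) < x < 2 * pi - acos (- c) else x < acos (- c) &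
     if cos y < 0 then acos (- c) < y < 2 * pi - acos (- c) else y < acos (- c)].
  rewrite !lt_min => /andP[h0 /andP[h1 /andP[h2 h3]]] c.
  have heta : 0 < eta < 1 / 4 by rewrite h0.
  have [c0 _ _ _ /(_ h2) lx] := L0_level x he heta.
  have [_ _ _ _ /(_ h3) ly] := L0_level y he heta.
  split=> //; [|exact: level_side|exact: level_side].
  exact: ltW (lt_le_trans lx (cos_max _)).
have convex (a b u : R) : 0 <= u <= 1 -> Num.min a b <= seg (a : R^o) b u <= Num.max a b.
  move=> hu; rewrite segE ge_min le_max.
  by case: (lerP a b) => ab; apply/andP; split; apply/orP; [left|right|right|left]; nra.
have convex_lt (a b c u : R) : 0 <= u <= 1 -> a < c -> b < c -> seg (a : R^o) b u < c.
  move=> hu ac bc; have /andP[_ h] := convex a b u hu.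
  by apply: le_lt_trans h _; rewrite gt_max ac.
have convex_gt (a b c u : R) : 0 <= u <= 1 -> c < a -> c < b -> c < seg (a : R^o) b u.
  move=> hu ac bc; have /andP[h _] := convex a b u hu.
  by apply: lt_le_trans h; rewrite lt_min ac.
have seg_gt u : 0 <= u <= 1 -> - (pi / 2) < seg (x : R^o) y u.
  by move=> hu; apply: convex_gt => //; lra.
case: ltP => sy; case: ltP => sx.
- rewrite subrr; apply: (is_degree_none m0 _).1 => eta u /side[heta c0 c1].
  rewrite sx sy => /andP[x1 x2] /andP[y1 y2] hu.
  have [_ _ h _ _] := L0_level (seg (x : R^o) y u) he heta.
  apply: contraTneq (h _) => [->|]; first by rewrite mul0r ltxx.
  by apply: cos_lt_level; [rewrite c0|rewrite convex_gt// convex_lt].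
- rewrite subr0; apply: (is_degree_up m0) => eta /side[heta c0 c1].
  rewrite sy (ltNge (cos x)) sx /=; set c := _ / _ in c0 c1 *; set s0 := acos (- c) => xs /andP[ys1 ys2].
  have xy : 0 < y - x by lra.
  have s0p : s0 <= pi by apply: acos_lepi; lra.
  pose u0 := (s0 - x) / (y - x).
  have segu u : seg (x : R^o) y u - s0 = (u - u0) * (y - x).
    by rewrite segE /u0; field; rewrite gt_eqF.
  have su0 : seg (x : R^o) y u0 = s0 by apply/eqP; rewrite -subr_eq0 segu subrr mul0r.
  exists u0; first by apply/andP; split; [rewrite divr_gt0// subr_gt0; lra|rewrite ltr_pdivrMr// mul1r; lra].
  split.
    rewrite su0; have [_ h _ _ _] := L0_level s0 he heta; apply: h.
    by rewrite acosK// in_itv/=; lra.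
  move=> u hu; have [_ _ h1 h2 _] := L0_level (seg (x : R^o) y u) he heta.
  split=> uu.
    apply: h2; apply: cos_gt_level; [by rewrite c0|rewrite seg_gt//=].
    by rewrite -subr_lt0 segu pmulr_llt0// subr_lt0.
  apply: h1; apply: cos_lt_level; first by rewrite c0.
  apply/andP; split; first by rewrite -subr_gt0 segu mulr_gt0// subr_gt0.
  by rewrite -/c -/s0; apply: convex_lt => //; lra.
- rewrite sub0r; apply: (is_degree_down m0) => eta /side[heta c0 c1].
  rewrite sx (ltNge (cos y)) sy /=; set c := _ / _ in c0 c1 *; set s0 := acos (- c) => /andP[xs1 xs2] ys.
  have xy : 0 < x - y by lra.
  have s0p : s0 <= pi by apply: acos_lepi; lra.
  pose u0 := (x - s0) / (x - y).
  have segu u : seg (x : R^o) y u - s0 = (u0 - u) * (x - y).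
    by rewrite segE /u0; field; rewrite gt_eqF.
  have su0 : seg (x : R^o) y u0 = s0 by apply/eqP; rewrite -subr_eq0 segu subrr mul0r.
  exists u0; first by apply/andP; split; [rewrite divr_gt0// subr_gt0; lra|rewrite ltr_pdivrMr// mul1r; lra].
  split.
    rewrite su0; have [_ h _ _ _] := L0_level s0 he heta; apply: h.
    by rewrite acosK// in_itv/=; lra.
  exists 1 => // u hu uu0; have [_ _ h1 h2 _] := L0_level (seg (x : R^o) y u) he heta.
  have hup : u0 < u -> cross (dir (pi / 4 + eta)) (L0_tangent e (seg (x : R^o) y u)) *
      dot (dir (pi / 4 + eta)) (L0_tangent e (seg (x : R^o) y u)) < 0.
    move=> uu; apply: h2; apply: cos_gt_level; [by rewrite c0|rewrite seg_gt//=].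
    by rewrite -subr_lt0 segu pmulr_llt0// subr_lt0.
  have hdown : u < u0 -> 0 < cross (dir (pi / 4 + eta)) (L0_tangent e (seg (x : R^o) y u)) *
      dot (dir (pi / 4 + eta)) (L0_tangent e (seg (x : R^o) y u)).
    move=> uu; apply: h1; apply: cos_lt_level; first by rewrite c0.
    apply/andP; split; first by rewrite -subr_gt0 segu mulr_gt0// subr_gt0.
    by rewrite -/c -/s0; apply: convex_lt => //; lra.
  split; last by split=> /andP[? ?]; [exact: hdown|exact: hup].
  apply/eqP => z0; rewrite z0 mul0r ltxx in hup hdown.
  by case: (ltgtP u u0) uu0 => [/hdown|/hup|].
- rewrite subrr; apply: (is_degree_none m0 _).1 => eta u /side[heta c0 c1].
  rewrite (ltNge (cos x)) (ltNge (cos y)) sx sy /= => xs ys hu.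
  have [_ _ _ h _] := L0_level (seg (x : R^o) y u) he heta.
  apply: contraTneq (h _) => [->|]; first by rewrite mul0r ltxx.
  by apply: cos_gt_level; [rewrite c0|rewrite seg_gt//= convex_lt].
Qed.

End MaslovExists.

(** * Clockwise turns between tangent lines *)

Section Tau.
Context {R : realType}.

Lemma cross_dir_dir (a b : R) : cross (dir a) (dir b) = sin (b - a).
Proof. by rewrite /cross /dir/= sinB; ring. Qed.

Lemma dot_dir_dir (a b : R) : dot (dir a) (dir b) = cos (b - a).
Proof. by rewrite /dot /dir/= cosB; ring. Qed.

Lemma cos_gt0_sum (x : R) : - pi < x < pi -> 0 < cos x -> - (pi / 2) < x < pi / 2.
Proof.
move=> hx; rewrite -cosN => cx; apply/andP; split; rewrite ltNge; apply/negP => h.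
  have := sin_ge0_pi (x := - x - pi / 2); rewrite sinBpihalf; lra.
by have := sin_ge0_pi (x := x - pi / 2); rewrite sinBpihalf -cosN; lra.
Qed.

Section Turn.
Variables (theta phi k : R) (m : R * R).
Hypotheses (hphi : 0 <= phi < pi) (k0 : k != 0).
Hypothesis m_cross : 0 < - (m.2 - m.1) - k * (m.1 + m.2).
Hypothesis m_below : m.2 - m.1 < 0.
Hypothesis start : cross (1 + k, 1 - k) (dir theta) = 0.
Hypothesis finish : cross m (dir (theta - phi)) = 0.

Local Notation g eta u := (cross (dir (pi / 4 + eta)) (dir (theta - u * phi))).
Local Notation h eta u := (dot (dir (pi / 4 + eta)) (dir (theta - u * phi))).

(** [A] and [B] are the sum and difference of the coordinates of the turning direction, at the start
    and at the end. The two tangency conditions express [sin phi] as a negative multiple of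
    [A0 * B1]; as [phi] is in [[0, pi)] this fixes the sign of [A0 * B1]. What is left of the
    product of the end values is a positive factor times [k * cos eta + sin eta], which for small
    [eta] has the sign of [k]. *)
Lemma turn_ends : 0 < phi /\ exists2 eta0, 0 < eta0 & forall eta, 0 < eta < eta0 ->
  if k < 0 then g eta 0 * g eta 1 < 0 else 0 < g eta 0 * g eta 1.
Proof.
pose A0 := (dir theta).1 + (dir theta).2; pose B0 := (dir theta).2 - (dir theta).1.
pose A1 := (dir (theta - phi)).1 + (dir (theta - phi)).2.
pose B1 := (dir (theta - phi)).2 - (dir (theta - phi)).1.
pose S := m.1 + m.2; pose P := - (m.2 - m.1).
have P0 : 0 < P by rewrite oppr_gt0.
have PS : 0 < P - k * S by exact: m_cross.
have e0 : B0 = - k * A0 by move: start; rewrite /cross /A0 /B0 /dir/=; lra.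
have e1 : P * A1 = - S * B1 by move: finish; rewrite /cross /A1 /B1 /P /S /dir/=; lra.
have unit0 : A0 ^+ 2 + B0 ^+ 2 = 2.
  have := cos2Dsin2 theta; rewrite /A0 /B0 /dir/=; lra.
have unit1 : A1 ^+ 2 + B1 ^+ 2 = 2.
  have := cos2Dsin2 (theta - phi); rewrite /A1 /B1 /dir/=; lra.
have A0n : A0 != 0.
  by apply/eqP => a0; move: unit0; rewrite e0 a0; lra.
have B1n : B1 != 0.
  apply/eqP => b0; move: e1 unit1; rewrite b0 mulr0 => /eqP.
  by rewrite mulf_eq0 gt_eqF//= => /eqP->; lra.
have sphi : 2 * P * sin phi = - (A0 * B1) * (P - k * S).
  have -> : sin phi = cross (dir (theta - phi)) (dir theta).
    by rewrite cross_dir_dir; congr sin; lra.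
  have -> : 2 * P * cross (dir (theta - phi)) (dir theta) = P * A1 * B0 - P * B1 * A0.
    by rewrite /cross /A0 /A1 /B0 /B1; ring.
  by rewrite e1 e0; ring.
have phi0 : 0 < phi.
  have [ph _] := andP hphi; rewrite lt_neqAle ph andbT eq_sym; apply/eqP => p0.
  move: sphi; rewrite p0 sin0 mulr0 => /esym/eqP.
  by rewrite mulf_eq0 (gt_eqF PS) orbF oppr_eq0 mulf_eq0 (negPf A0n) (negPf B1n).
split=> //.
have AB : A0 * B1 < 0.
  have : 0 < 2 * P * sin phi.
    by rewrite !mulr_gt0// sin_gt0_pi// phi0; case/andP: hphi.
  by rewrite sphi pmulr_lgt0// oppr_gt0.
(* [S] may vanish, whereas [S1] can be divided by. The three bounds on [eta] give the estimates of
   [small_angle], the sign of [k * cos eta + sin eta], and [0 < P * cos eta + S * sin eta]. *)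
pose S1 := Num.max 1 `|S|.
have S10 : 0 < S1 by rewrite lt_max ltr01.
pose eta0 := Num.min (1 / 4) (Num.min (`|k| / 2) (P / (2 * S1))).
exists eta0; first by rewrite !lt_min !divr_gt0 ?normr_gt0 ?mulr_gt0.
move=> eta; rewrite !lt_min => /andP[h0 /andP[h1 /andP[h2 h3]]].
have heta : 0 < eta < 1 / 4 by rewrite h0.
have [s0 s1 /andP[c0 c1]] := small_angle heta.
have c4 := @cos_piquarter_gt0 R.
have g0E : g eta 0 = cos (pi / 4) * (- A0 * (k * cos eta + sin eta)).
  rewrite mul0r subr0 cross_dir -/A0 -/B0 e0; ring.
have g1E : P * g eta 1 = cos (pi / 4) * (B1 * (P * cos eta + S * sin eta)).
  rewrite mul1r cross_dir -/A1 -/B1.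
  have -> : P * (cos (pi / 4) * (B1 * cos eta - A1 * sin eta)) =
    cos (pi / 4) * (P * B1 * cos eta - P * A1 * sin eta) by ring.
  by rewrite e1; ring.
have pos : 0 < P * cos eta + S * sin eta.
  have hS : - S1 <= S.
    by rewrite lerNl; apply: le_trans (ler_norm _) _; rewrite normrN le_max lexx orbT.
  rewrite ltr_pdivlMr ?mulr_gt0// in h3.
  by nra.
have [sc1 sc2] := small_combination k0 heta h2.
have prodE : P * (g eta 0 * g eta 1) =
   cos (pi / 4) ^+ 2 * (- (A0 * B1)) * (P * cos eta + S * sin eta) * (k * cos eta + sin eta).
  by rewrite mulrCA g1E g0E; ring.
have C0 : 0 < cos (pi / 4) ^+ 2 * (- (A0 * B1)) * (P * cos eta + S * sin eta).
  by rewrite !mulr_gt0// ?exprn_gt0// oppr_gt0.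
case: ltgtP k0 => // hk _.
  rewrite -(pmulr_rlt0 _ P0) prodE pmulr_rlt0// -oppr_gt0 sc2//.
by rewrite -(pmulr_rgt0 _ P0) prodE pmulr_rgt0// sc1.
Qed.

(** Measured from the reference line, the turning line has angle [(u0 - u) * phi]. The unit [s]
    records that the two direction vectors may be opposite at [u0]; it drops out of the product. *)
Lemma turn_zero (eta u0 : R) : 0 < phi -> 0 <= u0 <= 1 -> g eta u0 = 0 ->
  exists2 s : R, s ^+ 2 = 1 & forall u, g eta u = s * sin ((u0 - u) * phi) /\
    g eta u * h eta u = sin ((u0 - u) * phi) * cos ((u0 - u) * phi).
Proof.
move=> p0 hu0; rewrite cross_dir_dir; set d0 := _ - _ => s0.
exists (cos d0); first by have := cos2Dsin2 d0; rewrite s0; lra.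
have c0 : cos d0 ^+ 2 = 1 by have := cos2Dsin2 d0; rewrite s0; lra.
move=> u; rewrite cross_dir_dir dot_dir_dir.
have -> : theta - u * phi - (pi / 4 + eta) = d0 + (u0 - u) * phi by rewrite /d0; ring.
rewrite (sinD d0) (cosD d0) s0; split; first by ring.
by transitivity (cos d0 ^+ 2 * (sin ((u0 - u) * phi) * cos ((u0 - u) * phi))); [ring|rewrite c0 mul1r].
Qed.

Lemma turn_sign (eta u0 : R) : 0 < phi -> 0 <= u0 <= 1 -> g eta u0 = 0 ->
  [/\ g eta 0 * g eta 1 <= 0,
    forall u, 0 <= u <= 1 -> u != u0 -> g eta u != 0,
    forall u, u0 - pi / (2 * phi) < u < u0 -> 0 < g eta u * h eta u &
    forall u, u0 < u < u0 + pi / (2 * phi) -> g eta u * h eta u < 0].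
Proof.
move=> p0 hu0 /(turn_zero p0 hu0)[s s1 hs]; have [p1 p2] := andP hphi.
have s0 : s != 0 by apply/eqP => s0; move: s1; rewrite s0 expr0n/= => /eqP; rewrite eq_sym oner_eq0.
have a0 : pi / (2 * phi) * phi = pi / 2 by field; rewrite gt_eqF.
split.
- rewrite (hs 0).1 (hs 1).1 mulrACA -expr2 s1 mul1r subr0.
  rewrite -[u0 - 1]opprB mulNr sinN mulrN oppr_le0 mulr_ge0// sin_ge0_pi//; nra.
- move=> u hu uu0; rewrite (hs u).1 mulf_neq0//.
  have [uu|uu|uu] := ltgtP u u0; last by rewrite uu eqxx in uu0.
    by rewrite gt_eqF// sin_gt0_pi//; nra.
  by rewrite -[u0 - u]opprB mulNr sinN oppr_eq0 gt_eqF// sin_gt0_pi//; nra.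
- move=> u hu; rewrite (hs u).2 mulr_gt0//; [apply: sin_gt0_pihalf|apply: cos_gt0_pihalf]; nra.
- move=> u hu; rewrite (hs u).2 -[u0 - u]opprB mulNr sinN cosN mulNr oppr_lt0 mulr_gt0//;
  [apply: sin_gt0_pihalf|apply: cos_gt0_pihalf]; nra.
Qed.

Lemma turn_ivt (eta : R) : g eta 0 * g eta 1 < 0 -> exists2 u0, 0 < u0 < 1 & g eta u0 = 0.
Proof.
move=> h; have cg : continuous (fun u : R => g eta u).
  have -> : (fun u : R => g eta u) = (fun u => sin (theta - (pi / 4 + eta) - u * phi)).
    by apply/funext => u; rewrite cross_dir_dir; congr sin; ring.
  apply: continuousT_comp (@continuous_sin R); apply: continuousTB; first by move=> x; exact: cvg_cst.
  by apply: continuousTM; [move=> x; exact: cvg_id|move=> x; exact: cvg_cst].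
have [|u] := @IVT R (fun u : R => g eta u) 0 1 0 ler01 (continuous_subspaceT cg).
  move: h; move: (g eta 0) (g eta 1) => a b ab; rewrite ge_min le_max.
  by have [a0|a0] := lerP a 0; have [b0|b0] := lerP b 0; rewrite ?orbT//; nra.
rewrite in_itv/= => /andP[u0 u1] gu; exists u => //.
rewrite !lt_neqAle u0 u1 !andbT; apply/andP; split; apply/eqP => e; move: gu.
  by rewrite -e => gu; rewrite gu mul0r ltxx in h.
by rewrite e => gu; rewrite gu mulr0 ltxx in h.
Qed.

(** A turn by less than [pi] meets the reference line at most once; by [turn_ends] it does so
    exactly when [k < 0], and then clockwise. *)
Lemma turn_degree : is_degree (fun u => dir (theta - u * phi)) (- (k < 0)%R%:Z) /\
  forall n, is_degree (fun u => dir (theta - u * phi)) n -> n = - (k < 0)%R%:Z.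
Proof.
have [phi0 [eta0 e0 hends]] := turn_ends.
case: ltP hends => hk hends; last first.
  rewrite oppr0; apply: (is_degree_none e0) => eta u /hends g01 hu.
  apply/eqP => gu; have [h1 _ _ _] := turn_sign phi0 hu gu.
  by rewrite leNgt g01 in h1.
have a0 : 0 < pi / (2 * phi) by rewrite divr_gt0 ?pi_gt0 ?mulr_gt0.
split.
  apply: (is_degree_down e0) => eta /hends/turn_ivt[u0 hu0 gu]; exists u0 => //.
  have hu0' : 0 <= u0 <= 1 by lra.
  have [_ h1 h2 h3] := turn_sign phi0 hu0' gu.
  split=> //; exists (pi / (2 * phi)) => // u hu uu0.
  by split; [exact: h1|split; [exact: h2|exact: h3]].
move=> n [eta1 e1 H]; pose eta := Num.min eta0 eta1 / 2.
have m0 : 0 < Num.min eta0 eta1 by rewrite lt_min e0.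
have : 0 < eta < Num.min eta0 eta1 by rewrite /eta; lra.
rewrite lt_min => /andP[h0 /andP[h1 h2]].
have := H eta; rewrite h0 h2 => /(_ isT)/=[us [sg [us_uniq hz hs ->]]].
have := hends eta; rewrite h0 h1 => /(_ isT)/turn_ivt[u0 hu0 gu].
have hu0' : 0 <= u0 <= 1 by lra.
have [_ h3 h4 h5] := turn_sign phi0 hu0' gu.
have u0us : u0 \in us by apply/hz.
have usE : us =i [:: u0].
  move=> u; rewrite inE; apply/idP/eqP => [uus|->//].
  apply/eqP/negPn/negP => uu0; have [/andP[ua ub] _] := hs u uus.
  have hu : 0 <= u <= 1 by lra.
  by have /eqP := h3 u hu uu0; apply; apply/hz.
have -> : \sum_(u <- us) sg u = sg u0.
  by rewrite (perm_big [:: u0]) ?big_seq1//; apply: uniq_perm.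
have [_ cs] := hs u0 u0us.
have hw : u0 - pi / (2 * phi) < u0 < u0 + pi / (2 * phi) by lra.
have [x [y [hx hy _ _ [_ [_ ->]]]]] := crossing_near [::] cs hw.
by rewrite (lt_gtF (h5 _ hy)) (h4 _ hx).
Qed.

End Turn.

Lemma is_tau_L0 (e s : R) (m : R * R) (n : int) :
  e * cos s != 0 -> m.2 - m.1 < 0 -> 0 < - (m.2 - m.1) - e * cos s * (m.1 + m.2) ->
  0 < e ->
  is_tau (L0_tangent e s) m n <-> n = (cos s < 0)%R%:Z.
Proof.
move=> k0 m_below m_cross e0.
have ke : (e * cos s < 0) = (cos s < 0) by rewrite pmulr_rlt0.
split=> [[theta [phi [hphi st fi]]]|->].
  have [_ h] := turn_degree hphi k0 m_cross m_below st fi.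
  by move=> /h/oppr_inj; rewrite ke.
(* The line of [L0_tangent] has angle [pi / 4 - x] and that of [m] has angle [pi / 4 + y - pi / 2],
   hence the turn [pi / 2 - y - x]. The third hypothesis says [0 < cos (x + y)], which puts this
   turn between [0] and [pi]. *)
pose y := atan ((m.1 + m.2) / - (m.2 - m.1)); pose x := atan (e * cos s).
have D0 : 0 < - (m.2 - m.1) by rewrite oppr_gt0.
have y1 : - (pi / 2) < y by exact: atan_gtNpi2.
have y2 : y < pi / 2 by exact: atan_ltpi2.
have x1 : - (pi / 2) < x by exact: atan_gtNpi2.
have x2 : x < pi / 2 by exact: atan_ltpi2.
have cy : 0 < cos y by apply: cos_gt0_pihalf; rewrite y1.
have cx : 0 < cos x by apply: cos_gt0_pihalf; rewrite x1.
have sy : - (m.2 - m.1) * sin y = (m.1 + m.2) * cos y.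
  have : tan y = (m.1 + m.2) / - (m.2 - m.1) by exact: atanK.
  rewrite /tan => h; have -> : sin y = (m.1 + m.2) / - (m.2 - m.1) * cos y.
    by rewrite -h divfK// gt_eqF.
  by rewrite mulrA mulrCA divff ?mulr1// gt_eqF.
have sx : sin x = e * cos s * cos x.
  have : tan x = e * cos s by exact: atanK.
  by rewrite /tan => <-; rewrite divfK// gt_eqF.
have xy : - (pi / 2) < x + y < pi / 2.
  apply: cos_gt0_sum; first lra.
  rewrite cosD sx -(pmulr_rgt0 _ D0).
  have -> : - (m.2 - m.1) * (cos x * cos y - e * cos s * cos x * sin y) =
    cos x * (- (m.2 - m.1) * cos y - e * cos s * (- (m.2 - m.1) * sin y)) by ring.
  rewrite sy.
  have -> : cos x * (- (m.2 - m.1) * cos y - e * cos s * ((m.1 + m.2) * cos y)) =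
    cos x * cos y * (- (m.2 - m.1) - e * cos s * (m.1 + m.2)) by ring.
  by rewrite !mulr_gt0.
have cross_sym (v w : R * R) : cross v w = - cross w v by rewrite /cross; ring.
have hphi : 0 <= pi / 2 - y - x < pi by lra.
have st : cross (L0_tangent e s) (dir (pi / 4 - x)) = 0.
  by rewrite cross_sym cross_dir cosN sinN sx /L0_tangent/=; ring.
have fi : cross m (dir (pi / 4 - x - (pi / 2 - y - x))) = 0.
  have -> : pi / 4 - x - (pi / 2 - y - x) = pi / 4 + (y - pi / 2) by ring.
  rewrite cross_sym cross_dir cosBpihalf sinBpihalf.
  have -> : (m.2 - m.1) * sin y = - ((m.1 + m.2) * cos y) by rewrite -sy; ring.
  by ring.
exists (pi / 4 - x), (pi / 2 - y - x); split=> //.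
by have [h _] := turn_degree hphi k0 m_cross m_below st fi; rewrite -ke.
Qed.

End Tau.

(** * Bigons *)

Section RealInduction.
Context {R : realType}.

(** Passage from local to global by a supremum. It is applied to the agreement of two lifts, where
    [Q] is an implication, and to the existence of lifts, where [Q] says that a rectangle over
    [[x, y]] can be lifted. *)
Lemma real_induction (Q : R -> R -> Prop) (a b : R) : a <= b ->
  (forall x y w, a <= x -> x <= y -> y <= w -> w <= b -> Q x y -> Q y w -> Q x w) ->
  (forall x, a <= x <= b -> exists2 d, 0 < d & forall y w, a <= y -> y <= w -> w <= b ->
    `|y - x| < d -> `|w - x| < d -> Q y w) ->
  Q a b.
Proof.
move=> ab Qadd Qloc.
pose S := [set x | a <= x <= b /\ Q a x].
have Sa : S a.
  split; first by rewrite lexx.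
  have [|d d0 h] := Qloc a; first by rewrite lexx.
  by apply: h; rewrite ?subrr ?normr0.
have Sb : has_ubound S by exists b => x [/andP[]].
have hS : has_sup S by split; [exists a|].
pose c := sup S.
have ac : a <= c by exact: (ub_le_sup Sb).
have cb : c <= b by apply: ge_sup; [exists a|move=> x [/andP[]]].
have [|d d0 h] := Qloc c; first by rewrite ac.
have [x [/andP[ax xb] Qx] cx] := sup_adherent d0 hS.
have xc : x <= c by apply: (ub_le_sup Sb); split=> //; rewrite ax.
have cdx : c - d < x by exact: cx.
have {cx} step w : c <= w <= b -> w <= c + d / 2 -> w <= c.
  move=> /andP[cw wb] wc; apply: (ub_le_sup Sb); split; first by rewrite wb (le_trans ac).
  apply: (Qadd _ x) => //; first exact: le_trans cw.
  clearbody c; apply: h => //; first exact: le_trans cw.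
    by rewrite ler0_norm; lra.
  by rewrite ger0_norm; lra.
have cbE : c = b.
  apply: le_anti; rewrite cb /=; clearbody c; have [h1|h1] := lerP b (c + d / 2).
    by apply: step; rewrite ?cb ?lexx.
  by have := step (c + d / 2); lra.
apply: (Qadd _ x) => //; clearbody c; apply: h => //.
  by rewrite ler0_norm; lra.
by rewrite cbE subrr normr0.
Qed.

End RealInduction.

(** * Lifting maps from the pillowcase to the plane *)

Section Lifting.
Context {R : realType}.
Implicit Types v w : R * R.

Lemma within_comp {X Y Z : topologicalType} (A : set X) (B : set Y) (f : X -> Y) (g : Y -> Z) :
  {within A, continuous f} -> (forall x, A x -> B (f x)) -> {within B, continuous g} ->
  {within A, continuous (g \o f)}.
Proof.
move=> /subspace_continuousP cf fB /subspace_continuousP cg.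
apply/subspace_continuousP => x Ax.
have h : f @ within A (nbhs x) --> within B (nbhs (f x)).
  move=> P /= hP; have := cf x Ax _ hP; rewrite /= !nbhs_simpl /= /within/= => hx.
  by near=> y => Ay; apply: (near hx) => //; exact: fB.
exact: cvg_comp h (cg _ (fB _ Ax)).
Unshelve. all: by end_near. Qed.

Lemma within_dist (A : set R) (f : R -> R) (x r : R) :
  {within A, continuous f} -> A x -> 0 < r ->
  exists2 d, 0 < d & forall y, A y -> `|y - x| < d -> `|f y - f x| < r.
Proof.
move=> /subspace_continuousP cf Ax r0.
have /cvgrPdist_lt/(_ r r0) := cf x Ax.
rewrite near_withinE => /nbhs_ballP[d /= d0 h]; exists d => // y Ay yx.
by rewrite distrC; apply: h => //; rewrite /ball/= distrC.
Qed.

Definition deck (s : bool) (m n : int) v : R * R :=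
  ((-1) ^+ s * v.1 + 2 * pi * m%:~R, (-1) ^+ s * v.2 + 2 * pi * n%:~R).

Lemma proj_deck s m n v : proj (deck s m n v) = proj v.
Proof. by apply/esym/projP; exists s, m, n. Qed.

Lemma continuous_deck s m n : continuous (deck s m n).
Proof.
apply: continuousT_pair; apply: continuousTD; try by move=> x; exact: cvg_cst.
  by apply: continuousTM; [move=> x; exact: cvg_cst|exact: continuousT_fst].
by apply: continuousTM; [move=> x; exact: cvg_cst|exact: continuousT_snd].
Qed.

(** Two points near [v] related by a translation coincide, as [2 r] is less than [2 pi]. If they are
    related by a symmetry instead, their midpoint is in the lattice, so both sines at [v] are less
    than [r]; the maximum in [r] excludes this. *)
Lemma proj_locally_injective v : ~ lattice v -> exists2 r, 0 < r & forall u w,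
  `|u.1 - v.1| < r -> `|u.2 - v.2| < r -> `|w.1 - v.1| < r -> `|w.2 - v.2| < r ->
  proj u = proj w -> u = w.
Proof.
move=> vl; pose r := Num.min 1 (Num.max `|sin v.1| `|sin v.2|).
have r0 : 0 < r.
  rewrite lt_min ltr01 lt_max !normr_gt0 /= -negb_and; apply/negP => /andP[/eqP s1 /eqP s2].
  by apply: vl; apply/latticeP.
exists r => // u w u1 u2 w1 w2 /projP[s [m [n]]].
have p2 := @pi_ge2 R.
have r1 : r <= 1 by rewrite ge_min lexx.
have rot (a b : R) (k : int) (c : R) : `|a - c| < r -> `|b - c| < r ->
    b = a + 2 * pi * k%:~R -> b = a.
  rewrite !ltr_norml => /andP[a1 a2] /andP[b1 b2] e.
  have [h|h|h] := int_trichotomy R k; last 1 first.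
  - by have : 2 * pi * k%:~R <= 2 * pi * (-1) :> R by [rewrite ler_pM2l; lra]; lra.
  - by have : 2 * pi * 1 <= 2 * pi * k%:~R :> R by [rewrite ler_pM2l; lra]; lra.
  - by rewrite e h mulr0 addr0.
have flip (a b : R) (k : int) (c : R) : `|a - c| < r -> `|b - c| < r ->
    b = - a + 2 * pi * k%:~R -> `|sin c| < r.
  rewrite !ltr_norml => /andP[a1 a2] /andP[b1 b2] e.
  have : `|sin c - sin (0 + pi * k%:~R)| <= `|c - (0 + pi * k%:~R)| by exact: sin_lip.
  rewrite (sin_cosDpiz _ _).1 sin0 mulr0 subr0 add0r -ltr_norml; move=> /le_lt_trans; apply.
  by rewrite ltr_norml; lra.
case: s; rewrite ?expr0 ?expr1 ?mul1r ?mulN1r => e; last first.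
  by case: u w e u1 u2 w1 w2 => [a b] [a' b'] /= [e1 e2] u1 u2 w1 w2;
    rewrite (rot _ _ _ _ u1 w1 e1) (rot _ _ _ _ u2 w2 e2).
case: u w e u1 u2 w1 w2 => [a b] [a' b'] /= [e1 e2] u1 u2 w1 w2.
have := flip _ _ _ _ u1 w1 e1; have := flip _ _ _ _ u2 w2 e2.
by rewrite /r !lt_min !lt_max !ltxx /= orbF => /andP[_ h1] /andP[_ h2]; have := lt_trans h1 h2; rewrite ltxx.
Qed.

(** The group element is read off at [a], after which agreement propagates: near a point of
    agreement by local injectivity away from the lattice, near any other point vacuously. *)
Lemma lift_unique (f g : R -> R * R) (a b : R) : a <= b ->
  {within `[a, b]%classic, continuous f} -> {within `[a, b]%classic, continuous g} ->
  (forall x, a <= x <= b -> proj (f x) = proj (g x)) ->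
  (forall x, a <= x <= b -> ~ lattice (f x)) ->
  exists s m n, forall x, a <= x <= b -> g x = deck s m n (f x).
Proof.
move=> ab cf cg fg fl.
have aab : a <= a <= b by rewrite lexx.
have /projP[s [m [n gfa]]] := fg a aab; exists s, m, n => c /andP[ac cb].
pose f' := deck s m n \o f.
have cf' : {within `[a, b]%classic, continuous f'}.
  exact: continuousT_comp cf (@continuous_deck s m n).
have f'g x : a <= x <= b -> proj (f' x) = proj (g x).
  by move=> hx; rewrite /f' /= proj_deck fg.
have comp1 (h : R -> R * R) : {within `[a, b]%classic, continuous h} ->
    {within `[a, b]%classic, continuous (fun x => (h x).1)}.
  by move=> ch; exact: continuousT_comp ch continuousT_fst.
have comp2 (h : R -> R * R) : {within `[a, b]%classic, continuous h} ->
    {within `[a, b]%classic, continuous (fun x => (h x).2)}.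
  by move=> ch; exact: continuousT_comp ch continuousT_snd.
have close (h : R -> R * R) (x r : R) : {within `[a, b]%classic, continuous h} -> a <= x <= b -> 0 < r ->
    exists2 d : R, 0 < d & forall y, a <= y <= b -> `|y - x| < d ->
      `|(h y).1 - (h x).1| < r /\ `|(h y).2 - (h x).2| < r.
  move=> ch hx r0; have xab : x \in `[a, b]%R by rewrite in_itv.
  have [d1 d10 h1] := within_dist (comp1 _ ch) xab r0.
  have [d2 d20 h2] := within_dist (comp2 _ ch) xab r0.
  exists (Num.min d1 d2); first by rewrite lt_min d10.
  move=> y hy; rewrite lt_min => /andP[y1 y2].
  have yab : y \in `[a, b]%R by rewrite in_itv.
  by split; [exact: h1|exact: h2].
suff : f' a = g a -> f' c = g c by move=> <-.
apply: (@real_induction _ (fun x y => f' x = g x -> f' y = g y)) => //.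
  by move=> x y w _ _ _ _ h1 h2 /h1/h2.
move=> x /andP[ax xc]; have hx : a <= x <= b by rewrite ax (le_trans xc).
have [fgx|fgx] := eqVneq (f' x) (g x).
  have f'l : ~ lattice (f' x).
    by move=> l; apply: (fl x hx); apply: lattice_orbit l; rewrite /f'/= proj_deck.
  have [r r0 hr] := proj_locally_injective f'l.
  have [d1 d10 h1] := close _ _ _ cf' hx r0.
  have [d2 d20 h2] := close _ _ _ cg hx r0.
  exists (Num.min d1 d2); first by rewrite lt_min d10.
  move=> y w ay yw wc _; rewrite lt_min => /andP[w1 w2] _.
  have hw : a <= w <= b by lra.
  have [? ?] := h1 w hw w1; have := h2 w hw w2; rewrite -fgx => -[? ?].
  by apply: hr => //; exact: f'g.
(* Where the lifts differ, half of their distance is a tolerance within which they cannot come to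
   agree. *)
pose r : R := Num.max `|(f' x).1 - (g x).1| `|(f' x).2 - (g x).2| / 2.
have r0 : 0 < r.
  rewrite divr_gt0// lt_max !normr_gt0 !subr_eq0 -negb_and.
  by apply: contra fgx => /andP[/eqP e1 /eqP e2]; apply/eqP; move: e1 e2; case: (f' x) (g x) => ? ? [? ?] /= -> ->.
have [d1 d10 h1] := close _ _ _ cf' hx r0.
have [d2 d20 h2] := close _ _ _ cg hx r0.
exists (Num.min d1 d2); first by rewrite lt_min d10.
move=> y w ay yw wc; rewrite lt_min => /andP[y1 y2] _ fgy.
have hy : a <= y <= b by lra.
have [a1 a2] := h1 y hy y1; have := h2 y hy y2; rewrite -fgy => -[b1 b2].
have tri (u v t : R) : `|u - v| < r -> `|u - t| < r -> `|v - t| < 2 * r.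
  by rewrite !ltr_norml; lra.
have : Num.max `|(f' x).1 - (g x).1| `|(f' x).2 - (g x).2| < 2 * r.
  by rewrite gt_max (tri _ _ _ a1 b1) (tri _ _ _ a2 b2).
by rewrite /r [2 * _]mulrC divfK// ltxx.
Qed.

Section SquareLift.
Variable K : R * R -> pillow R.

Definition has_lift (A : set (R * R)) := exists G : R * R -> R * R,
  {within A, continuous G} /\ forall w, A w -> K w = proj (G w).

Definition rect (a b c d : R) : set (R * R) :=
  [set w | a <= w.1 <= b /\ c <= w.2 <= d].

Lemma closed_rect a b c d : closed (rect a b c d).
Proof.
have -> : rect a b c d = (fst @^-1` `[a, b]%classic) `&` (snd @^-1` `[c, d]%classic).
  by apply/seteqP; split=> w /=; rewrite !in_itv.
apply: closedI; apply: closed_comp; try by move=> w _; [exact: continuousT_fst|exact: continuousT_snd].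
- by move=> w _; exact: continuousT_fst.
- exact: interval_closed.
- by move=> w _; exact: continuousT_snd.
- exact: interval_closed.
Qed.

(** The two lifts differ on the common edge by one element of the group; applying it to one of them
    makes them match. *)
Lemma lift_glue (A B : set (R * R)) (edge : R -> R * R) (c d : R) : c <= d ->
  closed A -> closed B -> continuous edge ->
  (forall y, c <= y <= d -> A (edge y) /\ B (edge y)) ->
  (forall w, A w -> B w -> exists2 y, c <= y <= d & w = edge y) ->
  (forall w, A w -> pillow_star (K w)) ->
  has_lift A -> has_lift B -> has_lift (A `|` B).
Proof.
move=> cd clA clB ce eAB ABe KA [G1 [c1 K1]] [G2 [c2 K2]].
have [||||s [m [n e12]]] := @lift_unique (G2 \o edge) (G1 \o edge) c d cd.
- by apply: within_comp c2; [exact: continuous_subspaceT|move=> y /=; rewrite in_itv/= => /eAB[]].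
- by apply: within_comp c1; [exact: continuous_subspaceT|move=> y /=; rewrite in_itv/= => /eAB[]].
- by move=> y /eAB[Ay By] /=; rewrite -K1// -K2.
- by move=> y /eAB[Ay By] /=; apply/pillow_starP; rewrite -K2//; exact: KA.
have [inA notA] : (forall w, w \in A -> A w) /\ (forall w, w \notin A -> ~ A w).
  by split=> w; rewrite ?inE// notin_setE.
exists (fun w => if w \in A then G1 w else deck s m n (G2 w)); split; last first.
  move=> w; case: ifPn => [/inA Aw _|/notA nA [//|Bw]]; first exact: K1.
  by rewrite proj_deck; exact: K2.
apply: withinU_continuous => //.
  apply: subspace_eq_continuous c1 => w wA.
  by rewrite /from_subspace /= wA.
have c2' : {within B, continuous (deck s m n \o G2)}.
  exact: continuousT_comp c2 (@continuous_deck s m n).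
apply: subspace_eq_continuous c2' => w.
rewrite inE => wB; rewrite /from_subspace /=; case: ifPn => // /inA wA.
by have [y yc ->] := ABe w wA wB; rewrite -e12.
Qed.

Lemma square_lift :
  (forall w, rect 0 1 0 1 w -> pillow_star (K w)) ->
  (forall w, rect 0 1 0 1 w -> exists U G, [/\ open U, U w,
     forall w', U w' -> {for w', continuous G} &
     forall w', U w' -> rect 0 1 0 1 w' -> K w' = proj (G w')]) ->
  has_lift (rect 0 1 0 1).
Proof.
move=> Kstar Kloc.
have sub (a b c d : R) : 0 <= a -> b <= 1 -> 0 <= c -> d <= 1 -> rect a b c d `<=` rect 0 1 0 1.
  by move=> a0 b1 c0 d1 w [h1 h2]; split; lra.
apply: (@real_induction _ (fun a b => has_lift (rect a b 0 1)) 0 1 ler01).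
  move=> x y w x0 xy yw w1 hx hy.
  have -> : rect x w 0 1 = rect x y 0 1 `|` rect y w 0 1.
    apply/seteqP; split=> v /=; rewrite /rect /=.
      by move=> [/andP[v1 v2] v3]; have [h|/ltW h] := lerP v.1 y; [left|right]; split=> //; apply/andP.
    by move=> [[/andP[v1 v2] v3]|[/andP[v1 v2] v3]]; split=> //; lra.
  apply: (@lift_glue _ _ (fun t => (y, t)) 0 1 ler01) => //; try exact: closed_rect.
  - by apply: continuousT_pair; [move=> t; exact: cvg_cst|move=> t; exact: cvg_id].
  - by move=> t ht; rewrite /rect/= lexx xy yw; split; split.
  - move=> v [/andP[_ v1] h] [/andP[v2 _] _]; exists v.2 => //.
    by case: v v1 v2 {h} => v1 v2 /= h1 h2; congr pair; apply: le_anti; rewrite h1 h2.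
  - by move=> v hv; apply: Kstar; apply: sub hv; lra.
move=> x hx.
(* Inner induction on the height. The width [r] of the strip around [x] is part of [Q], so it may
   shrink whenever two heights are joined. *)
pose Q c d := exists2 r : R, 0 < r & forall y w : R, 0 <= y -> y <= w -> w <= 1 ->
  `|y - x| < r -> `|w - x| < r -> has_lift (rect y w c d).
suff : Q 0 1 by [].
apply: real_induction; first exact: ler01.
  move=> c d d' c0 cd dd' d1 [r1 r10 h1] [r2 r20 h2].
  exists (Num.min r1 r2); first by rewrite lt_min r10.
  move=> y w y0 yw w1; rewrite !lt_min => /andP[y1 y2] /andP[w1' w2].
  have -> : rect y w c d' = rect y w c d `|` rect y w d d'.
    apply/seteqP; split=> v /=; rewrite /rect /=.
      by move=> [v3 /andP[v1 v2]]; have [h|/ltW h] := lerP v.2 d; [left|right]; split=> //; apply/andP.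
    by move=> [[v3 /andP[v1 v2]]|[v3 /andP[v1 v2]]]; split=> //; lra.
  apply: (@lift_glue _ _ (fun t => (t, d)) y w yw) => //; try exact: closed_rect.
  - by apply: continuousT_pair; [move=> t; exact: cvg_id|move=> t; exact: cvg_cst].
  - by move=> t ht; rewrite /rect/= lexx cd dd'; split; split.
  - move=> v [h /andP[_ v1]] [_ /andP[v2 _]]; exists v.1 => //.
    by case: v v1 v2 {h} => v1 v2 /= h1' h2'; congr pair; apply: le_anti; rewrite h1' h2'.
  - by move=> v hv; apply: Kstar; apply: sub hv; lra.
  - exact: h1.
  - exact: h2.
move=> y hy; have hxy : rect 0 1 0 1 (x, y) by split.
have [U [G [oU Uxy cG KG]]] := Kloc _ hxy.
have /nbhs_ballP[r /= r0 hr] : nbhs (x, y) U by exact: open_nbhs_nbhs.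
exists r => // c d c0 cd d1 cr dr; exists r => // a b a0 ab b1 ar br.
have Urect w : rect a b c d w -> U w.
  move=> [/andP[w1 w2] /andP[w3 w4]]; apply: hr.
  move: ar br cr dr; rewrite !ltr_norml => *.
  by split; rewrite /ball/= ltr_norml; lra.
exists G; split; last by move=> w hw; apply: KG; [exact: Urect|apply: sub hw].
apply/subspace_continuousP => w /Urect/cG cw.
exact: cvg_within_filter cw.
Qed.

End SquareLift.

End Lifting.

(** * Chain rule along curves for functions with continuous partial derivatives *)

Section ChainRule.
Context {R : realType}.
Implicit Types w : R * R.

Lemma is_derive_slice1 (F : R * R -> R) (s y : R) : derivable F (s, y) (1, 0) ->
  is_derive s 1 (fun s => F (s, y)) ('D_(1, 0) F (s, y)).
Proof.
have E : (fun h : R => h^-1 *: (F (h *: (1, 0) + (s, y)) - F (s, y))) =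
    (fun h : R => h^-1 *: (F (h *: 1 + s, y) - F (s, y))).
  apply/funext => h; congr (_ *: (F _ - _)).
  by congr pair; rewrite /= [_ *: _]mulr0 add0r.
by move=> d; split; move: d; rewrite /derivable /derive /= E.
Qed.

Lemma is_derive_slice2 (F : R * R -> R) (x s : R) : derivable F (x, s) (0, 1) ->
  is_derive s 1 (fun s => F (x, s)) ('D_(0, 1) F (x, s)).
Proof.
have E : (fun h : R => h^-1 *: (F (h *: (0, 1) + (x, s)) - F (x, s))) =
    (fun h : R => h^-1 *: (F (x, h *: 1 + s) - F (x, s))).
  apply/funext => h; congr (_ *: (F _ - _)).
  by congr pair; rewrite /= [_ *: _]mulr0 add0r.
by move=> d; split; move: d; rewrite /derivable /derive /= E.
Qed.

Lemma mvt_near (g dg : R -> R) (x r x' : R) : `|x' - x| < r ->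
  (forall s, `|s - x| < r -> is_derive s 1 g (dg s)) ->
  exists2 xi, `|xi - x| <= `|x' - x| & g x' - g x = dg xi * (x' - x).
Proof.
move=> xr hg; have [xx|xx|->] := ltgtP x x'.
- have close s : x <= s <= x' -> `|s - x| <= `|x' - x|.
    by move=> hs; rewrite !ger0_norm; lra.
  have [||xi] := @MVT R g dg x x' xx.
  + by move=> s; rewrite in_itv/= => hs; apply: hg; apply: le_lt_trans xr; apply: close; lra.
  + apply/derivable_within_continuous => s; rewrite in_itv/= => hs.
    by have [] := hg s (le_lt_trans (close s hs) xr).
  + by rewrite in_itv/= => hxi e; exists xi; [apply: close; lra|].
- have close s : x' <= s <= x -> `|s - x| <= `|x' - x|.
    by move=> hs; rewrite !ler0_norm; lra.
  have [||xi] := @MVT R g dg x' x xx.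
  + by move=> s; rewrite in_itv/= => hs; apply: hg; apply: le_lt_trans xr; apply: close; lra.
  + apply/derivable_within_continuous => s; rewrite in_itv/= => hs.
    by have [] := hg s (le_lt_trans (close s hs) xr).
  + by rewrite in_itv/= => hxi e; exists xi; [apply: close; lra|lra].
- by exists x'; rewrite ?subrr ?mulr0.
Qed.

(* Hadamard's form of differentiability at [w0]. *)
Lemma increment_C1 (F : R * R -> R) (U : set (R * R)) (w0 : R * R) : open U -> U w0 ->
  (forall w, U w -> derivable F w (1, 0) /\ derivable F w (0, 1)) ->
  {for w0, continuous (fun w => 'D_(1, 0) F w)} ->
  {for w0, continuous (fun w => 'D_(0, 1) F w)} ->
  exists d1 d2 : R * R -> R,
  [/\ d1 @ w0 --> 'D_(1, 0) F w0, d2 @ w0 --> 'D_(0, 1) F w0 &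
      \forall w \near w0, F w - F w0 = d1 w * (w.1 - w0.1) + d2 w * (w.2 - w0.2)].
Proof.
move=> oU Uw0 dF c1 c2.
have /nbhs_ballP[r /= r0 hr] : nbhs w0 U by exact: open_nbhs_nbhs.
have inU x y : `|x - w0.1| < r -> `|y - w0.2| < r -> U (x, y).
  by move=> hx hy; apply: hr; split; rewrite /ball/= distrC.
(* The increment is split at the corner [(w0.1, w.2)] and the mean value theorem is applied to each
   side. Away from [w0] the point [w0] itself is a dummy value, so that [choice] gives functions on
   the whole plane. *)
have ex w : exists p : R * R, [/\ `|p.1 - w0.1| <= `|w.1 - w0.1|,
    `|p.2 - w0.2| <= `|w.2 - w0.2| &
    `|w.1 - w0.1| < r -> `|w.2 - w0.2| < r -> F w - F w0 =
     'D_(1, 0) F (p.1, w.2) * (w.1 - w0.1) + 'D_(0, 1) F (w0.1, p.2) * (w.2 - w0.2)].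
  have [h1|h1] := ltP `|w.1 - w0.1| r; last first.
    by exists w0; split; rewrite ?subrr ?normr0// ltNge h1.
  have [h2|h2] := ltP `|w.2 - w0.2| r; last first.
    by exists w0; split; rewrite ?subrr ?normr0// => _; rewrite ltNge h2.
  have [s hs|xi xi1 e1] := @mvt_near (fun s => F (s, w.2)) (fun s => 'D_(1, 0) F (s, w.2)) _ _ _ h1.
    by have [dd _] := dF _ (inU _ _ hs h2); exact: is_derive_slice1 dd.
  have [s hs|eta eta1 e2] := @mvt_near (fun s => F (w0.1, s)) (fun s => 'D_(0, 1) F (w0.1, s)) _ _ _ h2.
    have h0 : `|w0.1 - w0.1| < r by rewrite subrr normr0.
    by have [_ dd] := dF _ (inU _ _ h0 hs); exact: is_derive_slice2 dd.
  exists (xi, eta); split=> // _ _ /=; rewrite -e1 -e2.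
  by rewrite -!surjective_pairing addrA subrK.
have [p hp] := choice ex.
exists (fun w => 'D_(1, 0) F ((p w).1, w.2)), (fun w => 'D_(0, 1) F (w0.1, (p w).2)).
have n1 (e : R) : 0 < e -> \forall w \near w0, `|w.1 - w0.1| < e.
  move=> e0; have /cvgrPdist_lt/(_ e e0) := @continuousT_fst R R w0.
  by apply: filterS => w; rewrite distrC.
have n2 (e : R) : 0 < e -> \forall w \near w0, `|w.2 - w0.2| < e.
  move=> e0; have /cvgrPdist_lt/(_ e e0) := @continuousT_snd R R w0.
  by apply: filterS => w; rewrite distrC.
have p1 : (fun w => (p w).1) @ w0 --> w0.1.
  apply/cvgrPdist_lt => e e0; near=> w; have [h _ _] := hp w.
  rewrite distrC; apply: le_lt_trans h _.
  by near: w; exact: n1.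
have p2 : (fun w => (p w).2) @ w0 --> w0.2.
  apply/cvgrPdist_lt => e e0; near=> w; have [_ h _] := hp w.
  rewrite distrC; apply: le_lt_trans h _.
  by near: w; exact: n2.
split.
- have h : (fun w => ((p w).1, w.2)) @ w0 --> w0.
    exact: (cvg_pair p1 (@continuousT_snd R R w0)).
  exact: cvg_comp h c1.
- have h : (fun w => (w0.1, (p w).2)) @ w0 --> w0.
    exact: (cvg_pair (@cvg_cst _ w0.1 _ (nbhs w0) _) p2).
  exact: cvg_comp h c2.
- near=> w; have [_ _] := hp w; apply.
    by near: w; exact: n1.
  by near: w; exact: n2.
Unshelve. all: by end_near. Qed.

(** Hadamard's form is composed with the curve: the coefficients converge to the partial derivatives
    and the difference quotients of [a1] and [a2] to their derivatives. *)
Lemma is_derive_curve (F : R * R -> R) (U : set (R * R)) (a1 a2 : R -> R) (t a1' a2' : R) :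
  open U -> U (a1 t, a2 t) ->
  (forall w, U w -> derivable F w (1, 0) /\ derivable F w (0, 1)) ->
  {for (a1 t, a2 t), continuous (fun w => 'D_(1, 0) F w)} ->
  {for (a1 t, a2 t), continuous (fun w => 'D_(0, 1) F w)} ->
  is_derive t 1 a1 a1' -> is_derive t 1 a2 a2' ->
  is_derive t 1 (fun s => F (a1 s, a2 s))
    ('D_(1, 0) F (a1 t, a2 t) * a1' + 'D_(0, 1) F (a1 t, a2 t) * a2').
Proof.
move=> oU Ut dF c1 c2 da1 da2.
have [d1 [d2 [hd1 hd2 hF]]] := increment_C1 oU Ut dF c1 c2.
have quot (a : R -> R) (a' : R) : is_derive t 1 a a' ->
    (fun h : R => h^-1 *: (a (h *: 1 + t) - a t)) @ 0^' --> a'.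
  by move=> [da <-]; exact: da.
have cont (a : R -> R) (a' : R) : is_derive t 1 a a' -> (fun h : R => a (h *: 1 + t)) @ 0^' --> a t.
  move=> [da _]; have ca : {for t, continuous a}.
    exact/differentiable_continuous/derivable1_diffP.
  have h0 : (fun h : R => h *: 1 + t) @ 0^' --> t.
    apply: cvg_trans (_ : (fun h : R => h *: 1 + t) @ 0 --> t).
      exact: cvg_fmap2 (@nbhs_dnbhs _ _).
    rewrite -[X in _ --> X]add0r -{2}(scale0r (1 : R)).
    by apply: cvgD; [apply: cvgZ; [exact: cvg_id|exact: cvg_cst]|exact: cvg_cst].
  exact: cvg_comp h0 ca.
have cont2 : (fun h : R => (a1 (h *: 1 + t), a2 (h *: 1 + t))) @ 0^' --> (a1 t, a2 t).
  exact: (cvg_pair (cont _ _ da1) (cont _ _ da2)).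
have lim : (fun h : R => h^-1 *: (F (a1 (h *: 1 + t), a2 (h *: 1 + t)) - F (a1 t, a2 t))) @ 0^' -->
    'D_(1, 0) F (a1 t, a2 t) * a1' + 'D_(0, 1) F (a1 t, a2 t) * a2'.
  have lim' := cvgD (cvgM (cvg_comp _ _ cont2 hd1) (quot _ _ da1)) (cvgM (cvg_comp _ _ cont2 hd2) (quot _ _ da2)).
  apply: cvg_trans; last exact: lim'.
  apply: near_eq_cvg; near=> h => /=.
  have -> : F (a1 (h *: 1 + t), a2 (h *: 1 + t)) - F (a1 t, a2 t) =
    d1 (a1 (h *: 1 + t), a2 (h *: 1 + t)) * (a1 (h *: 1 + t) - a1 t) +
    d2 (a1 (h *: 1 + t), a2 (h *: 1 + t)) * (a2 (h *: 1 + t) - a2 t).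
    by near: h; exact: cont2 hF.
  by rewrite scalerDr !scalerAr.
by split; [apply/cvg_ex; eexists; exact: lim|exact: cvg_lim lim].
Unshelve. all: by end_near. Qed.

End ChainRule.

(** * Nonexistence of bigons *)

Section NoBigon.
Context {R : realType}.
Implicit Types w : R * R.

Lemma derive_fst (f : R * R -> R * R) w v : derivable f w v ->
  derivable (fun w => (f w).1) w v /\ 'D_v (fun w => (f w).1) w = ('D_v f w).1.
Proof.
move=> df; have l : (fun h : R => h^-1 *: ((f (h *: v + w)).1 - (f w).1)) @ 0^' --> ('D_v f w).1.
  exact: cvg_comp df (@continuousT_fst R R _).
by split; [apply/cvg_ex; eexists; exact: l|exact: cvg_lim l].
Qed.

Lemma derive_snd (f : R * R -> R * R) w v : derivable f w v ->
  derivable (fun w => (f w).2) w v /\ 'D_v (fun w => (f w).2) w = ('D_v f w).2.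
Proof.
move=> df; have l : (fun h : R => h^-1 *: ((f (h *: v + w)).2 - (f w).2)) @ 0^' --> ('D_v f w).2.
  exact: cvg_comp df (@continuousT_snd R R _).
by split; [apply/cvg_ex; eexists; exact: l|exact: cvg_lim l].
Qed.

Lemma smooth2_curve (f : R * R -> R * R) (U : set (R * R)) (a1 a2 : R -> R) (t a1' a2' : R) :
  open U -> U (a1 t, a2 t) -> smooth2 U f ->
  is_derive t 1 a1 a1' -> is_derive t 1 a2 a2' ->
  is_derive t 1 (fun s => (f (a1 s, a2 s)).1)
    (('D_(1, 0) f (a1 t, a2 t)).1 * a1' + ('D_(0, 1) f (a1 t, a2 t)).1 * a2') /\
  is_derive t 1 (fun s => (f (a1 s, a2 s)).2)
    (('D_(1, 0) f (a1 t, a2 t)).2 * a1' + ('D_(0, 1) f (a1 t, a2 t)).2 * a2').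
Proof.
move=> oU Ut sf da1 da2.
have [_ [df [cf1 _] [cf2 _]]] := sf 1%N.
have Unear : \forall w \near (a1 t, a2 t), U w by exact: open_nbhs_nbhs.
have transport (g h : R * R -> R) : (forall w, U w -> g w = h w) ->
    {for (a1 t, a2 t), continuous g} -> {for (a1 t, a2 t), continuous h}.
  move=> gh; rewrite /prop_for /continuous_at (gh _ Ut) => cg.
  by apply: cvg_trans cg; apply: near_eq_cvg; apply: filterS Unear => w /gh.
split.
- have [|||d1 d2] := @is_derive_curve R (fun w => (f w).1) U a1 a2 t a1' a2' oU Ut _ _ _ da1 da2.
  + by move=> w /df[h1 h2]; split; apply: (derive_fst _).1.
  + apply: (transport (fun w => ('D_(1, 0) f w).1)).
      by move=> w /df[h1 h2]; rewrite (derive_fst h1).2.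
    by apply: continuous_comp; [exact: cf1|exact: continuousT_fst].
  + apply: (transport (fun w => ('D_(0, 1) f w).1)).
      by move=> w /df[h1 h2]; rewrite (derive_fst h2).2.
    by apply: continuous_comp; [exact: cf2|exact: continuousT_fst].
  have [h1 h2] := df _ Ut; rewrite (derive_fst h1).2 (derive_fst h2).2 in d2.
  exact: DeriveDef.
- have [|||d1 d2] := @is_derive_curve R (fun w => (f w).2) U a1 a2 t a1' a2' oU Ut _ _ _ da1 da2.
  + by move=> w /df[h1 h2]; split; apply: (derive_snd _).1.
  + apply: (transport (fun w => ('D_(1, 0) f w).2)).
      by move=> w /df[h1 h2]; rewrite (derive_snd h1).2.
    by apply: continuous_comp; [exact: cf1|exact: continuousT_snd].
  + apply: (transport (fun w => ('D_(0, 1) f w).2)).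
      by move=> w /df[h1 h2]; rewrite (derive_snd h2).2.
    by apply: continuous_comp; [exact: cf2|exact: continuousT_snd].
  have [h1 h2] := df _ Ut; rewrite (derive_snd h1).2 (derive_snd h2).2 in d2.
  exact: DeriveDef.
Qed.

Lemma is_derive_arc (t : R) :
  is_derive t 1 (fun s => - cos (pi * s)) (pi * sin (pi * t)) /\
  is_derive t 1 (fun s => sin (pi * s)) (pi * cos (pi * t)).
Proof.
split; apply: is_derive_eq; rewrite ?scaler0 ?addr0 ?add0r /GRing.scale/= ?mulr0 ?mulr1; ring.
Qed.

(** The coordinates of [L0_lift e s] have sum [2 s + pi], so the parameter is an affine function of
    any lift of the curve. *)
Lemma L0_deck (e s : R) (b : bool) (m n : int) (v : R * R) : v = deck b m n (L0_lift e s) ->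
  s = (-1) ^+ b / 2 * (v.1 + v.2 - 2 * pi * (m + n)%:~R) - pi / 2.
Proof.
move=> ->; rewrite /deck /L0_lift /= intrD.
by case: b; rewrite ?expr1 ?expr0; field.
Qed.

Lemma continuous_L0 (e : R) : continuous (L0_lift e).
Proof.
have cst_cont (c : R) : continuous (fun _ : R => c) by move=> x; exact: cvg_cst.
have cid : continuous (fun x : R => x) by move=> x; exact: cvg_id.
have cs : continuous (fun x : R => e * sin x).
  exact: continuousTM (cst_cont _) (@continuous_sin R).
apply: continuousT_pair; apply: continuousTD => //; first exact: continuousTD.
exact: continuousTB.
Qed.

Lemma continuous_L1 (p : nat) (q : int) : continuous (L1_lift p q : R -> R * R).
Proof.
have cst_cont (c : R) : continuous (fun _ : R => c) by move=> x; exact: cvg_cst.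
have cid : continuous (fun x : R => x) by move=> x; exact: cvg_id.
by apply: continuousT_pair; apply: continuousTM.
Qed.

Lemma is_derive_affine2 (F1 F2 : R -> R) (t g1 g2 c K L : R) :
  is_derive t 1 F1 g1 -> is_derive t 1 F2 g2 ->
  is_derive t 1 (fun s => c * (F1 s + F2 s - K) - L) (c * (g1 + g2)).
Proof.
move=> d1 d2; apply: is_derive_eq.
by rewrite ?scaler0 ?addr0 ?add0r ?oppr0 ?addr0 /GRing.scale/= ?mulr0 ?mulr1 ?addr0 ?subr0; ring.
Qed.

(** For [k = e] and [k = - e] the function is a coordinate of [deck] applied to [L0_lift e (b s)]: a
    critical parameter stops both coordinates of the lifted edge. *)
Lemma is_derive_critical (b : R -> R) (t c k L M : R) : is_derive t 1 b 0 ->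
  is_derive t 1 (fun s => c * (b s + k * sin (b s) + L) + M) 0.
Proof.
move=> db; pose Phi (x : R) := c * (x + k * sin x + L) + M.
have dPhi : is_derive (b t) 1 Phi (c * (1 + k * cos (b t))).
  apply: is_derive_eq.
  by rewrite ?scaler0 ?addr0 ?add0r /GRing.scale/= ?mulr0 ?mulr1 ?addr0 ?add0r; ring.
have -> : 0 = c * (1 + k * cos (b t)) * 0 by rewrite mulr0.
exact: (is_derive1_comp (f := Phi) (g := b)).
Qed.

Section ArcDerivative.
Variables (e : R) (u : R * R -> pillow R) (beta : R -> R).
Hypothesis imm : oriented_immersion u.
Hypothesis u_star : forall w, half_disc w -> pillow_star (u w).
Hypothesis beta_cont : {within `[0, 1]%classic, continuous beta}.
Hypothesis on_arc : forall t, 0 <= t <= 1 ->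
  u (- cos (pi * t), sin (pi * t)) = proj (L0_lift e (beta t)).

Lemma half_disc_arc (t : R) : 0 <= t <= 1 -> half_disc (- cos (pi * t), sin (pi * t)).
Proof.
move=> ht; have p0 := @pi_gt0 R; split => /=.
  by rewrite sqrrN cos2Dsin2.
by apply: sin_ge0_pi; nra.
Qed.

(** [beta] is only assumed continuous. Near [t] the local chart [f] of the bigon agrees along the
    arc with a deck image of [L_0], so [beta] is an affine expression in [f] and becomes derivable.
    Were its derivative zero, [f] would be stationary along the arc, although its Jacobian is
    invertible and the arc moves. *)
Lemma arc_derivative (t : R) : 0 < t < 1 -> exists2 d, d != 0 & is_derive t 1 beta d.
Proof.
move=> ht; have ht' : 0 <= t <= 1 by lra.
have [U [f [oU Ut sf jac uf]]] := imm (half_disc_arc ht').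
have [da1 da2] := is_derive_arc t.
have [df1 df2] := smooth2_curve (a1 := fun s => - cos (pi * s)) (a2 := fun s => sin (pi * s))
  oU Ut sf da1 da2.
pose arc (s : R) : R * R := (- cos (pi * s), sin (pi * s)).
have carc : continuous arc.
  have cpi : continuous (fun s : R => pi * s).
    by apply: continuousTM; [move=> x; exact: cvg_cst|move=> x; exact: cvg_id].
  apply: continuousT_pair; last exact: continuousT_comp cpi (@continuous_sin R).
  move=> x; apply: cvgN; exact: continuousT_comp cpi (@continuous_cos R) x.
have [r r0 [rt rU]] : exists2 r, 0 < r & (forall s, t - r <= s <= t + r -> 0 <= s <= 1) /\
    (forall s, t - r <= s <= t + r -> U (arc s)).
  have : \forall s \near t, U (arc s) by apply: carc; exact: open_nbhs_nbhs.
  move=> /nbhs_ballP[r /= r0 hr].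
  exists (Num.min (r / 2) (Num.min t (1 - t))); first by rewrite !lt_min divr_gt0//=; lra.
  have h1 : Num.min (r / 2) (Num.min t (1 - t)) <= r / 2 by rewrite ge_min lexx.
  have h2 : Num.min (r / 2) (Num.min t (1 - t)) <= t by rewrite !ge_min lexx orbT.
  have h3 : Num.min (r / 2) (Num.min t (1 - t)) <= 1 - t by rewrite !ge_min lexx !orbT.
  move: (Num.min _ _) h1 h2 h3 => m h1 h2 h3.
  by split=> s hs; [lra|apply: hr; rewrite /ball/= ltr_norml; lra].
have ttr : t - r <= t + r by lra.
have [||||b [m [n hdeck]]] := @lift_unique _ (L0_lift e \o beta) (f \o arc) _ _ ttr.
- apply: continuousT_comp (@continuous_L0 e).
  by apply: continuous_subspaceW beta_cont => s /=; rewrite !in_itv/= => /rt.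
- apply/subspace_continuousP => s /=; rewrite in_itv/= => hs.
  have [+ _] := sf 0%N => /(_ _ (rU s hs)) cf.
  by apply: cvg_within_filter; apply: continuous_comp => //; exact: carc.
- move=> s hs; rewrite /= -on_arc ?uf//; [exact: rU|exact/half_disc_arc/rt|exact: rt].
- move=> s hs; rewrite /= => l; have := u_star (half_disc_arc (rt _ hs)).
  by rewrite on_arc; [move/pillow_starP|exact: rt].
have hd s : t - r <= s <= t + r -> f (arc s) = deck b m n (L0_lift e (beta s)) := hdeck s.
have nearR : \forall s \near t, t - r <= s <= t + r.
  apply/nbhs_ballP; exists r => //= s; rewrite /ball/= ltr_norml; lra.
have betaE : \forall s \near t, (-1) ^+ b / 2 * ((f (arc s)).1 + (f (arc s)).2 - 2 * pi * (m + n)%:~R) - pi / 2 = beta s.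
  by apply: filterS nearR => s hs; rewrite -(L0_deck (hdeck s hs)).
have dbeta := near_eq_is_derive betaE (is_derive_affine2 _ _ _ df1 df2).
eexists; last exact: dbeta.
apply/eqP => d0; rewrite d0 in dbeta.
have unique (F : R -> R) (c g M : R) : is_derive t 1 F g -> forall k,
    (\forall s \near t, c * (beta s + k * sin (beta s) + pi / 2) + M = F s) -> g = 0.
  move=> dF k FE; have dF0 := near_eq_is_derive FE (is_derive_critical c k (pi / 2) M dbeta).
  by rewrite -(@derive_val _ _ _ _ _ _ _ dF) (@derive_val _ _ _ _ _ _ _ dF0).
have g1 := unique _ ((-1) ^+ b) _ (2 * pi * m%:~R) df1 e.
have g2 := unique _ ((-1) ^+ b) _ (2 * pi * n%:~R) df2 (- e).
have {}g1 := g1 _; have {}g2 := g2 _.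
have g10 : ('D_(1, 0) f (arc t)).1 * (pi * sin (pi * t)) + ('D_(0, 1) f (arc t)).1 * (pi * cos (pi * t)) = 0.
  by apply: g1; apply: filterS nearR => s hs; rewrite -/(arc s) hd// /deck /L0_lift/=; ring.
have g20 : ('D_(1, 0) f (arc t)).2 * (pi * sin (pi * t)) + ('D_(0, 1) f (arc t)).2 * (pi * cos (pi * t)) = 0.
  by apply: g2; apply: filterS nearR => s hs; rewrite -/(arc s) hd// /deck /L0_lift/=; ring.
have := jac _ Ut; rewrite /Defs.jacobian /cross -/(arc t).
move: g10 g20; move: ('D_(1, 0) f (arc t)) ('D_(0, 1) f (arc t)) => D1 D2 g10 g20 J.
have p0 := @pi_gt0 R.
(* The invertible Jacobian kills the velocity of the arc; Cramer's rule applied to its first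
   component gives [sin (pi * t) = 0], which fails inside the interval. *)
have s0 : sin (pi * t) = 0.
  apply/eqP; have /eqP : (D1.1 * D2.2 - D1.2 * D2.1) * pi * sin (pi * t) = 0.
    transitivity ((D1.1 * (pi * sin (pi * t)) + D2.1 * (pi * cos (pi * t))) * D2.2 -
      (D1.2 * (pi * sin (pi * t)) + D2.2 * (pi * cos (pi * t))) * D2.1); first by ring.
    by rewrite g10 g20 !mul0r subrr.
  by rewrite !mulf_eq0 (gt_eqF J) (gt_eqF p0).
have [t0 t1] := andP ht.
have : 0 < sin (pi * t) by apply: sin_gt0_pi; rewrite mulr_gt0//= gtr_pMr.
by rewrite s0 ltxx.
Qed.

End ArcDerivative.

(** Along [L_0] the linear form is [- p s + (2 q - p) e sin s] up to a constant, and the sine is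
    1-Lipschitz. *)
Lemma L0_transverse (p : nat) (q : int) (e s s' : R) : (0 < p)%N ->
  `|(2 * q - p%:Z)%:~R| * e < p%:R :> R -> 0 < e ->
  (q - p%:Z)%:~R * (L0_lift e s).1 - q%:~R * (L0_lift e s).2 =
  (q - p%:Z)%:~R * (L0_lift e s').1 - q%:~R * (L0_lift e s').2 -> s = s'.
Proof.
move=> p0 he e0 H.
have {}H : p%:R * (s - s') = (2 * q - p%:Z)%:~R * e * (sin s - sin s').
  by move: H; rewrite /L0_lift /= !intrB intrM; lra.
apply/eqP; rewrite -subr_eq0 -normr_eq0 eq_le normr_ge0 andbT leNgt; apply/negP => ss.
have : p%:R * `|s - s'| <= `|(2 * q - p%:Z)%:~R| * e * `|s - s'|.
  rewrite -[p%:R]normr_nat -normrM H !normrM (gtr0_norm e0) ler_wpM2l ?sin_lip//.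
  by rewrite mulr_ge0 ?normr_ge0// ltW.
by rewrite ler_pM2r// leNgt he.
Qed.

Lemma no_bigon (p : nat) (q : int) (e : R) x y (u : R * R -> pillow R) : (0 < p)%N ->
  `|(2 * q - p%:Z)%:~R| * e < p%:R :> R -> 0 < e < 1 ->
  ~ is_bigon (L0_lift e) (L1_lift p q) x y u.
Proof.
move=> p0 hqe he [imm ustar [b0 [b1 [[cb0 cb1] _ _ ub]]]].
have e0 : 0 < e by case/andP: he.
have on_arc t : 0 <= t <= 1 -> u (- cos (pi * t), sin (pi * t)) = proj (L0_lift e (b0 t)).
  by move=> /ub[].
have deriv := arc_derivative imm ustar cb0 on_arc.
suff b01 : b0 0 = b0 1.
  have [|c] := @Rolle R b0 0 1 ltr01 _ cb0 b01.
    by move=> t; rewrite in_itv/= => /deriv[d _ []].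
  rewrite in_itv/= => /deriv[d d0 hd] hd0; case/eqP: d0.
  by rewrite -(@derive_val _ _ _ _ _ _ _ hd) (@derive_val _ _ _ _ _ _ _ hd0).
(* [chi] collapses the vertical sides of the square to the corners of the half
   disc. *)
pose chi (w : R * R) : R * R := (- cos (pi * w.1), w.2 * sin (pi * w.1)).
have cpi : continuous (fun w : R * R => pi * w.1).
  by apply: continuousTM; [move=> w; exact: cvg_cst|exact: continuousT_fst].
have cchi : continuous chi.
  apply: continuousT_pair.
    by move=> w; apply: cvgN; exact: continuousT_comp cpi (@continuous_cos R) w.
  apply: continuousTM; first exact: continuousT_snd.
  exact: continuousT_comp cpi (@continuous_sin R).
have chi_disc w : rect 0 1 0 1 w -> half_disc (chi w).
  move=> [w1 w2]; have [d1 d2] := half_disc_arc w1; split; rewrite /chi /=; last first.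
    by rewrite mulr_ge0//; case/andP: w2.
  apply: le_trans d1; rewrite /= lerD2l exprMn ler_piMl ?sqr_ge0//.
  by rewrite expr_le1//; case/andP: w2.
have [| |G [cG GE]] := @square_lift R (u \o chi).
- by move=> w /chi_disc/ustar.
- move=> w hw; have [U [f [oU Uw sf _ uf]]] := imm _ (chi_disc _ hw).
  exists (chi @^-1` U), (f \o chi); split; [|exact: Uw| |].
  + by apply: open_comp oU => v _; exact: cchi.
  + move=> v Uv; have [+ _] := sf 0%N => /(_ _ Uv) cf.
    by apply: continuous_comp; [exact: cchi|exact: cf].
  + by move=> v Uv hv; apply: uf => //; exact: chi_disc.
have edge (g : R -> R * R) : continuous g -> (forall t, 0 <= t <= 1 -> rect 0 1 0 1 (g t)) ->
    {within `[0, 1]%classic, continuous (G \o g)}.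
  move=> cg hg; apply: within_comp cG; first exact: continuous_subspaceT.
  by move=> t /=; rewrite in_itv/=; exact: hg.
have cid : continuous (fun t : R => t) by move=> t; exact: cvg_id.
have ccst (c : R) : continuous (fun _ : R => c) by move=> t; exact: cvg_cst.
have h01 : 0 <= (0 : R) <= 1 by rewrite lexx ler01.
have h11 : 0 <= (1 : R) <= 1 by rewrite lexx ler01.
have star w : rect 0 1 0 1 w -> ~ lattice (G w).
  by move=> hw; apply/pillow_starP; rewrite -GE//; exact/ustar/chi_disc.
(* A side collapsed by [chi] lifts a constant path, and by uniqueness of lifts [G] is constant along
   it. *)
have vert c : 0 <= c <= 1 -> sin (pi * c) = 0 -> G (c, 0) = G (c, 1).
  move=> hc sc.
  have [||||b [m [n H]]] := @lift_unique R (fun=> G (c, 0)) (fun t => G (c, t)) 0 1 ler01.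
  - by apply: continuous_subspaceT => t; exact: cvg_cst.
  - by apply: (edge (fun t => (c, t))); [exact: continuousT_pair|move=> t ht; split].
  - move=> t ht; rewrite -!GE; [|by split|by split].
    by rewrite /= /chi/= sc !mulr0.
  - by move=> t ht; apply: star; split.
  by rewrite (H 1 h11) -(H 0 h01).
have [||||s0 [m0 [n0 top]]] := @lift_unique R (fun t => G (t, 1)) (L0_lift e \o b0) 0 1 ler01.
- by apply: (edge (fun t => (t, 1))); [exact: continuousT_pair|move=> t ht; split].
- exact: continuousT_comp cb0 (@continuous_L0 e).
- by move=> t ht; rewrite -GE; [rewrite /= /chi/= mul1r on_arc|split].
- by move=> t ht; apply: star; split.
(* The bottom of the square follows the diameter through [(- cos (pi * t), 0)], whereas [beta1]
   parametrizes it by [1 - 2 * t]; [tau] translates between the two. *)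
pose tau (t : R) := (1 + cos (pi * t)) / 2.
have htau t : 0 <= tau t <= 1.
  by have := cos_le1 (pi * t); have := cos_geN1 (pi * t); rewrite /tau; lra.
have ctau : continuous tau.
  apply: continuousTM => //; apply: continuousTD => //.
  by apply: continuousT_comp (@continuous_cos R); exact: continuousTM.
have [||||s1 [m1 [n1 bot]]] := @lift_unique R (L1_lift p q \o (b1 \o tau)) (fun t => G (t, 0)) 0 1 ler01.
- apply: continuousT_comp (@continuous_L1 p q); apply: within_comp cb1.
    exact: continuous_subspaceT.
  by move=> t _; rewrite /= in_itv/= htau.
- by apply: (edge (fun t => (t, 0))); [exact: continuousT_pair|move=> t ht; split].
- move=> t ht; have [_ _ ubot] := ub _ (htau t).
  rewrite -GE; last by split.
  by rewrite /= -ubot /chi /= mul0r; congr u; congr pair; rewrite /tau; lra.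
- move=> t ht; have [_ _ ubot] := ub _ (htau t).
  have hw : rect 0 1 0 1 (t, 0) by split.
  have := ustar _ (chi_disc _ hw); rewrite /chi /= mul0r.
  have -> : - cos (pi * t) = 1 - 2 * tau t by rewrite /tau; lra.
  by rewrite ubot => /pillow_starP.
(* The linear form vanishing along [L1_lift]. A deck transformation changes it by a sign and a
   constant, so equality of two of its values survives. *)
pose h (v : R * R) : R := (q - p%:Z)%:~R * v.1 - q%:~R * v.2.
have h_deck (s : bool) m n v : h (deck s m n v) =
    (-1) ^+ s * h v + ((q - p%:Z)%:~R * (2 * pi * m%:~R) - q%:~R * (2 * pi * n%:~R)).
  by rewrite /h /deck /=; ring.
have h_L1 t : h (L1_lift p q t) = 0 by rewrite /h /L1_lift /=; ring.
have hbot : h (G (0, 0)) = h (G (1, 0)) by rewrite !bot// !h_deck /= !h_L1.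
apply: (L0_transverse p0 hqe e0); rewrite -/(h _) -/(h _).
have -> : L0_lift e (b0 0) = deck s0 m0 n0 (G (0, 0)).
  by rewrite vert ?mulr0 ?sin0//; exact: top.
have -> : L0_lift e (b0 1) = deck s0 m0 n0 (G (1, 0)).
  by rewrite vert ?mulr1 ?sinpi//; exact: top.
by rewrite !h_deck hbot.
Qed.

End NoBigon.

(** * Complexes with zero differential *)

Section HomologyOfZero.
Variables (V : vectType 'F_2) (d : 'End(V)).

Lemma homology_zero : d = 0 -> exists f : {linear V -> homology d}, bijective f.
Proof.
move=> d0; pose f (v : V) : homology d := homology_class (vsproj (lker d) v).
have f_linear : linear f.
  move=> a u v; rewrite /f linearP homology_classD.
  by rewrite -[a *: homology_class _]/(homology_scale a _) homology_scaleE.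
have ker v : v \in lker d by rewrite memv_ker d0 lfunE.
have class_inj c c' : homology_class (d := d) c = homology_class c' -> c = c'.
  move=> /eqP; rewrite /homology_class -Quotient.idealrBE unfold_in /boundary_pred.
  have limg0 : limg d = 0%VS.
    by apply/eqP; rewrite -subv0; apply/subvP => w /memv_imgP[v _ ->]; rewrite d0 lfunE mem0v.
  by rewrite limg0 memv0 linearB subr_eq0 => /eqP/val_inj.
pose F : {linear V -> homology d} := HB.pack f (GRing.isLinear.Build _ _ _ _ f f_linear).
exists F; exists (fun x : homology d => vsval (repr (x : Quotient.quot (boundaries d)))).
  move=> v; have : homology_class (repr (f v : Quotient.quot (boundaries d))) = f v.
    by rewrite /homology_class reprK.
  by move=> /class_inj ->; rewrite vsprojK.
by move=> x; rewrite /F/= /f vsvalK /homology_class reprK.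
Qed.

End HomologyOfZero.

Section ChainDimension.
Context {R : realType}.
Variables Lt0 Lt1 : R -> R * R.

Lemma dim_chains : \dim (fullv : {vspace chains Lt0 Lt1}) = #|{: fset_set (generators Lt0 Lt1)}|.
Proof. by rewrite dimvf /dim /= muln1. Qed.

Lemma differential_eq0 : (forall x y u, ~ is_bigon Lt0 Lt1 x y u) ->
  (forall x y, finite_set (moduli Lt0 Lt1 x y)) /\ differential Lt0 Lt1 = 0.
Proof.
move=> nb; have m0 x y : moduli Lt0 Lt1 x y = set0.
  by rewrite /moduli; apply/seteqP; split=> // A [u /nb].
split=> [x y|]; first by rewrite m0; exact: finite_set0.
apply/lfunP => c; rewrite /differential lfunE lfunE /=; apply/ffunP => y.
rewrite !ffunE big1// => x _.
by rewrite /moduli_count m0 fset_set0 mulr0.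
Qed.

End ChainDimension.

Lemma int_gtN1 (k : int) : (-1 < k)%R -> (0 <= k)%R.
Proof. lia. Qed.

Lemma leq_half_odd (p : nat) (k : int) : odd p -> (0 <= k)%R -> (2 * k < p%:Z + 1)%R ->
  (`|k| <= p.-1./2)%N.
Proof. lia. Qed.

Lemma half_odd_leq (p k : nat) : (0 < p)%N -> (k <= p.-1./2)%N -> (2 * k + 1 <= p)%N.
Proof. lia. Qed.

(** At a lattice point the coordinate difference [2 e sin s], being less than [pi], would vanish;
    then [s] is a multiple of [pi] and the coordinates are odd multiples of [pi / 2]. *)
Lemma L0_star {R : realType} (e s : R) : 0 < e < 1 / 4 -> pillow_star (proj (L0_lift e s)).
Proof.
move=> he; apply/pillow_starP => -[m [n [h1 h2]]].
have p2 := @pi_ge2 R.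
have d : 2 * e * sin s = pi * (m - n)%:~R by move: h1 h2; rewrite intrB; lra.
have [he0 he1] := andP he.
have sl : `|e * sin s| <= 1 / 4.
  rewrite normrM (gtr0_norm he0) -[leRHS]mulr1; apply: ler_pM => //; [exact: ltW|by lra|exact: sin_max].
rewrite ler_norml in sl.
have mn : m - n = 0.
  have [h|//|h] := int_trichotomy R (m - n); exfalso.
  - by have : pi * 1 <= pi * (m - n)%:~R :> R by [rewrite ler_pM2l ?pi_gt0]; rewrite -d mulr1 -mulrA; lra.
  - by have : pi * (m - n)%:~R <= pi * (-1) :> R by [rewrite ler_pM2l ?pi_gt0]; rewrite -d mulrN1 -mulrA; lra.
have s0 : sin s = 0.
  by apply/eqP; move/eqP: d; rewrite mn mulr0 !mulf_eq0 (gt_eqF he0) orbF pnatr_eq0.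
have [k hk'] := sin_eq0 s0.
have h : pi * (2 * (k - m) + 1)%:~R = 0 :> R.
  by rewrite intrD intrM intrB; move: h1; rewrite s0 mulr0 hk' -[1%:~R]/(1 : R); lra.
by move/eqP: h; rewrite mulf_eq0 intr_eq0 (gt_eqF (pi_gt0 R)) /=; lia.
Qed.

(** * Generators *)

Section Generators.
Context {R : realType}.
Variables (p : nat) (q : int).
Hypotheses (p_gt0 : (0 < p)%N) (p_odd : odd p) (pq_coprime : coprimez p%:Z q).

Definition kappa : R := (2 * q - p%:Z)%:~R / p%:R.

(** The first coordinate of [L1_lift] at the parameter of [x_k]. *)
Definition phase (k : nat) : R := 2 * pi * q%:~R * k%:R / p%:R.

Let pR : 0 < p%:R :> R. Proof. by rewrite ltr0n. Qed.

Lemma kappaE : kappa * p%:R = 2 * q%:~R - p%:R.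
Proof. by rewrite /kappa divfK ?gt_eqF// intrB intrM. Qed.

Lemma kappa_neq0 : kappa != 0.
Proof.
rewrite mulf_neq0 ?invr_eq0 ?(gt_eqF pR)// intr_eq0; apply/eqP => h.
have pE : p = (2 * `|q|)%N by lia.
by move: p_odd; rewrite pE oddM.
Qed.

Lemma sin_multiple_neq0 (j : int) : (0 < `|j| < p)%N -> sin (pi * q%:~R * j%:~R / p%:R) != 0 :> R.
Proof.
move=> hj; apply/eqP => /sin_eq0[m hm].
have /eqP : q%:~R * j%:~R = m%:~R * p%:R :> R.
  have p0 := @pi_gt0 R; apply: (@mulfI _ pi); first by rewrite gt_eqF.
  by have := congr1 (fun x => x * p%:R) hm; rewrite divfK ?gt_eqF// -!mulrA.
rewrite -[p%:R]/(p%:~R) -!intrM eqr_int => /eqP e.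
have : (p%:Z %| q * j)%Z by rewrite e dvdz_mull.
rewrite Gauss_dvdzr// dvdzE absz_nat => /dvdn_leq; lia.
Qed.

Lemma sin_phase_neq0 k : (0 < k <= p.-1./2)%N -> sin (phase k) != 0.
Proof.
move=> hk; have := @sin_multiple_neq0 (2 * k%:Z)%R.
rewrite (_ : pi * _ * _ / _ = phase k); last by rewrite /phase intrM; ring.
by apply; lia.
Qed.

(** The difference is a product of sines attached to [k + l] and [k - l], both nonzero and less than
    [p] in absolute value. *)
Lemma cos_phase_inj k l : (k <= p.-1./2)%N -> (l <= p.-1./2)%N -> k != l ->
  cos (phase k) != cos (phase l).
Proof.
move=> hk hl kl; rewrite -subr_eq0.
have -> : cos (phase k) - cos (phase l) =
    - 2 * (sin (pi * q%:~R * (k%:Z + l%:Z)%:~R / p%:R) * sin (pi * q%:~R * (k%:Z - l%:Z)%:~R / p%:R)).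
  set x := _ / p%:R; set y := (X in sin x * sin X).
  have -> : phase k = x + y by rewrite /phase /x /y intrD intrB; ring.
  have -> : phase l = x - y by rewrite /phase /x /y intrD intrB; ring.
  by rewrite cosB cosD; ring.
by rewrite !mulf_neq0 ?oppr_eq0 ?sin_multiple_neq0//; lia.
Qed.

(** The minimum starts from the default [1], so that an empty range, as for [p = 1], is covered and
    [c <= 1]. *)
Lemma finite_min (I : finType) (f : I -> R) (P : pred I) : (forall i, P i -> 0 < f i) ->
  exists2 c, 0 < c <= 1 & forall i, P i -> c <= f i.
Proof.
move=> f0; exists (\big[Num.min/1]_(i | P i) f i); last first.
  by move=> i Pi; rewrite (bigD1 i)//= ge_min lexx.
apply/andP; split; last first.
  by elim/big_rec: _ => // i x Pi x1; rewrite ge_min x1 orbT.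
by elim/big_rec: _ => // i x Pi x0; rewrite lt_min f0.
Qed.

(** The constant [c] is the scale of all later estimates: the gap in the sines fixes the sign of
    [cos] at the generators with [k > 0], and the gap in the cosines separates the points [x_k]. *)
Lemma phase_gap : exists2 c : R, 0 < c <= 1 &
  (forall k, (0 < k <= p.-1./2)%N -> c <= `|sin (phase k)|) /\
  (forall k l, (k <= p.-1./2)%N -> (l <= p.-1./2)%N -> k != l ->
    c <= `|cos (phase k) - cos (phase l)|).
Proof.
have [|c1 /andP[c10 c11] h1] := @finite_min 'I_p (fun k => `|sin (phase k)|) (fun k => 0 < k <= p.-1./2)%N.
  by move=> k /sin_phase_neq0; rewrite normr_gt0.
have [|c2 /andP[c20 c21] h2] := @finite_min ('I_p * 'I_p)%type
    (fun kl => `|cos (phase kl.1) - cos (phase kl.2)|)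
    (fun kl => [&& (kl.1 <= p.-1./2)%N, (kl.2 <= p.-1./2)%N & nat_of_ord kl.1 != kl.2]).
  by move=> [k l] /and3P[hk hl kl]; rewrite normr_gt0 subr_eq0 cos_phase_inj.
have lt_p k : (k <= p.-1./2)%N -> (k < p)%N by lia.
exists (Num.min c1 c2); first by rewrite lt_min c10 c20 ge_min c11.
split=> [k hk|k l hk hl kl].
  have kp : (k < p)%N by apply: lt_p; case/andP: hk.
  by rewrite ge_min (h1 (Ordinal kp)).
by rewrite ge_min (h2 (Ordinal (lt_p _ hk), Ordinal (lt_p _ hl))) ?orbT//=; apply/and3P.
Qed.

Section Fixed.
Variable e : R.
Hypotheses (he : 0 < e < 1 / 4) (hk : `|kappa| * e <= 1 / 4).

Let e_gt0 : 0 < e. Proof. by case/andP: he. Qed.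

(* Eliminating [t] from the equations saying that [L0_lift e s] and
   [L1_lift p q t] lie in one orbit leaves an equation for [twist s]; in [gen_at]
   below, [b] is the sign and [k] comes from the difference of the two
   translations of the group element. *)
Definition twist (s : R) : R := s - kappa * e * sin s.

Lemma twist_close s : `|s - twist s| <= `|kappa| * e.
Proof.
rewrite /twist opprB addrC subrK normrM normrM (gtr0_norm e_gt0).
by rewrite ler_piMr ?sin_max// mulr_ge0// ltW.
Qed.

Lemma twist_inj s s' : twist s = twist s' -> s = s'.
Proof.
move=> h; apply/eqP; rewrite -subr_eq0 -normr_eq0 eq_le normr_ge0 andbT leNgt; apply/negP => ss.
have hs : s - s' = kappa * e * (sin s - sin s') by move: h; rewrite /twist; lra.
have : `|s - s'| <= 1 / 4 * `|s - s'|.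
  rewrite {1}hs (normrM (kappa * e)) (normrM kappa) (gtr0_norm e_gt0); apply: ler_pM => //; last exact: sin_lip.
  by rewrite mulr_ge0// ltW.
by move: ss; move: `|s - s'| => y y0; lra.
Qed.

Lemma twist_surj a : exists s, twist s = a.
Proof.
have ct : continuous twist.
  apply: continuousTB; first by move=> x; exact: cvg_id.
  by apply: continuousTM; [move=> x; exact: cvg_cst|exact: continuous_sin].
have h1 : twist (a - 1) <= a.
  by have := le_trans (twist_close (a - 1)) hk; rewrite ler_norml => /andP[h1 h2]; lra.
have h2 : a <= twist (a + 1).
  by have := le_trans (twist_close (a + 1)) hk; rewrite ler_norml => /andP[h1' h2]; lra.
have aa : a - 1 <= a + 1 by lra.
have [|s _ hs] := @IVT R twist (a - 1) (a + 1) a aa (continuous_subspaceT ct).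
  by rewrite ge_min le_max h1 h2 orbT.
by exists s.
Qed.

Lemma twistD s (m : int) : twist (s + 2 * pi * m%:~R) = twist s + 2 * pi * m%:~R.
Proof. by rewrite /twist sinD2piz; ring. Qed.

Definition gen_at (b : bool) (k : nat) (x : R * R) : Prop :=
  [/\ 0 <= x.1 < 2 * pi,
      exists m : int, twist x.1 = - (pi / 2) + (-1) ^+ b * phase k + 2 * pi * m%:~R &
      x.2 = (2 * pi * k%:R + 2 * (-1) ^+ b * e * sin x.1) / p%:R].

Lemma fund_2pi (s s' : R) (m : int) : 0 <= s < 2 * pi -> 0 <= s' < 2 * pi ->
  s' = s + 2 * pi * m%:~R -> s' = s.
Proof.
move=> hs hs' e1; have p0 := @pi_gt0 R.
have [h|h|h] := int_trichotomy R m.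
- by have : 2 * pi * 1 <= 2 * pi * m%:~R :> R by [rewrite ler_pM2l; lra]; lra.
- by rewrite e1 h mulr0 addr0.
- by have : 2 * pi * m%:~R <= 2 * pi * (-1) :> R by [rewrite ler_pM2l; lra]; lra.
Qed.

Lemma gen_at_exists b k : exists x, gen_at b k x.
Proof.
have [s hs] := twist_surj (- (pi / 2) + (-1) ^+ b * phase k).
have p2 : 0 < 2 * pi :> R by rewrite mulr_gt0 ?pi_gt0.
pose m := Num.floor (s / (2 * pi)); pose s' := s + 2 * pi * (- m)%:~R.
exists (s', (2 * pi * k%:R + 2 * (-1) ^+ b * e * sin s') / p%:R); split=> //=.
  have /andP[h1 h2] : m%:~R <= s / (2 * pi) < (m + 1)%:~R.
    by rewrite floor_le_tmp ?floorD1_gt.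
  rewrite ler_pdivlMr// in h1; rewrite ltr_pdivrMr// intrD -[1%:~R]/(1 : R) in h2.
  by rewrite /s' mulrNz; lra.
by exists (- m); rewrite twistD hs.
Qed.

Lemma gen_at_unique b k x y : gen_at b k x -> gen_at b k y -> x = y.
Proof.
move=> [x1 [m hm] x2] [y1 [n hn] y2].
have xy : x.1 = y.1.
  apply: (@fund_2pi _ _ (m - n)) => //; apply: twist_inj.
  by rewrite twistD hm hn intrB; ring.
by move: x2 y2 xy; case: (x) (y) => [? ?] [? ?] /= -> -> ->.
Qed.

Lemma gen_at_angle b k x : gen_at b k x -> exists m : int,
  `|x.1 - (- (pi / 2) + (-1) ^+ b * phase k + 2 * pi * m%:~R)| <= `|kappa| * e.
Proof. by move=> [_ [m hm] _]; exists m; rewrite -hm; exact: twist_close. Qed.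

Lemma gen_at_cos b k x : gen_at b k x ->
  `|cos x.1 - (-1) ^+ b * sin (phase k)| <= `|kappa| * e.
Proof.
move=> /gen_at_angle[m h].
have -> : (-1) ^+ b * sin (phase k) = cos (- (pi / 2) + (-1) ^+ b * phase k + 2 * pi * m%:~R).
  rewrite cosD2piz addrC cosBpihalf.
  by case: b h; rewrite ?expr0 ?expr1 ?mulN1r ?mul1r ?sinN.
exact: le_trans (cos_lip _ _) h.
Qed.

Lemma gen_at_time b k x : gen_at b k x -> `|x.2 - 2 * pi * k%:R / p%:R| <= 2 * e / p%:R.
Proof.
move=> [_ _ ->]; rewrite -mulrBl addrC addKr normrM normfV (gtr0_norm pR).
rewrite ler_pM2r ?invr_gt0// !normrM normr_nat normrX normrN1 expr1n mulr1 (gtr0_norm e_gt0).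
by rewrite ler_piMr ?sin_max// mulr_ge0// ltW.
Qed.

Lemma gens_gen_at x : gens p q e x <->
  exists k (b : bool), [/\ (k <= p.-1./2)%N, k = 0%N -> b & gen_at b k x].
Proof.
have p2 := @pi_ge2 R; have [he0 he1] := andP he; have hk1 := hk.
have p_int : p%:~R = p%:R :> R by [].
have sl := sin_max x.1; rewrite ler_norml in sl.
split=> [[x1 x2 /projP[b [m [n e12]]] _]|[k [b [kh k0 [x1 [m hm] x2]]]]].
  move: e12; rewrite /L1_lift /L0_lift /= => -[h1 h2]; rewrite intrB p_int in h2.
  (* Subtracting the two coordinate equations leaves [p] times the second parameter. *)
  have hK : 2 * pi * (m - n)%:~R = p%:R * x.2 - 2 * (-1) ^+ b * e * sin x.1.
    by rewrite intrB; lra.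
  have ce : `|2 * (-1) ^+ b * e * sin x.1| <= 1 / 2.
    rewrite !normrM normr_nat normrX normrN1 expr1n mulr1 (gtr0_norm e_gt0) -[leRHS]mulr1.
    by apply: ler_pM => //; [rewrite mulr_ge0// ltW|lra|exact: sin_max].
  rewrite ler_norml in ce.
  have [x20 x2p] := andP x2.
  have K0 : (0 <= m - n)%R.
    have : ((-1)%:~R : R) < (m - n)%:~R.
      rewrite -(@ltr_pM2l _ (2 * pi)); last lra.
      rewrite hK -[(-1)%:~R]/(-1 : R).
      have : 0 <= p%:R * x.2 by rewrite mulr_ge0.
      lra.
    by rewrite ltr_int; exact: int_gtN1.
  have Kp : (2 * (m - n) < p%:Z + 1)%R.
    have : ((2 * (m - n))%:~R : R) < (p%:Z + 1)%:~R.
      rewrite -(@ltr_pM2l _ pi); last lra.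
      rewrite intrM mulrCA mulrA hK intrD p_int -[1%:~R]/(1 : R).
      have : p%:R * x.2 <= p%:R * pi by rewrite ler_pM2l.
      lra.
    by rewrite ltr_int.
  have kE : (`|m - n|%N)%:R = (m - n)%:~R :> R by rewrite -[in RHS](gez0_abs K0).
  have x2E : x.2 = (2 * pi * (`|m - n|%N)%:R + 2 * (-1) ^+ b * e * sin x.1) / p%:R.
    by rewrite kE hK subrK mulrC mulKf// gt_eqF.
  have tw : twist x.1 = - (pi / 2) + (-1) ^+ b * phase `|m - n|%N + 2 * pi * (- (-1) ^+ b * m)%:~R.
    have c2 : (-1) ^+ b * (-1) ^+ b = 1 :> R by rewrite -expr2 sqrr_sign.
    rewrite /phase kE.
    rewrite (_ : 2 * pi * q%:~R * (m - n)%:~R / p%:R = q%:~R * x.2 - q%:~R * (2 * (-1) ^+ b * e * sin x.1) / p%:R); last first.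
      have -> : 2 * pi * q%:~R * (m - n)%:~R = q%:~R * (2 * pi * (m - n)%:~R) :> R by ring.
      by rewrite hK; field; rewrite gt_eqF.
    rewrite h1 !(intrM, intrN) rmorphXn /= rmorphN1.
    have kp : kappa = 2 * q%:~R / p%:R - 1 by rewrite /kappa intrB intrM p_int; field; rewrite gt_eqF.
    rewrite /twist kp.
    transitivity (- (pi / 2) + ((-1) ^+ b * (-1) ^+ b) * (x.1 + e * sin x.1 + pi / 2) -
      ((-1) ^+ b * (-1) ^+ b) * (q%:~R * (2 * e * sin x.1) / p%:R)); last by ring.
    by rewrite c2; ring.
  exists `|m - n|%N, b; split; [exact: leq_half_odd| |by split=> //; exists (- (-1) ^+ b * m)].
  (* For [k = 0] the first parameter is close to [- pi / 2] modulo [2 pi], so its sine is negative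
     and the positive sign would make the second parameter negative. *)
  move=> k0; case: b h1 h2 hK ce x2E tw => // h1 h2 hK ce x2E tw; exfalso.
  rewrite k0 /phase !(mulr0, mul0r) add0r addr0 in x2E tw.
  have close := twist_close x.1; rewrite tw in close.
  have := le_trans (sin_lip _ _) close; rewrite sinD2piz sinN sin_pihalf opprK => s1.
  have {}s1 := le_trans s1 hk; rewrite ler_norml in s1.
  have : x.2 * p%:R < 0.
    rewrite x2E divfK ?gt_eqF// expr0 mulr1 pmulr_rlt0 ?mulr_gt0//; lra.
  by rewrite pmulr_llt0// ltNge x20.
have c2 : (-1) ^+ b * (-1) ^+ b = 1 :> R by rewrite -expr2 sqrr_sign.
have ce : `|2 * (-1) ^+ b * e * sin x.1| <= 1 / 2.
  rewrite !normrM normr_nat normrX normrN1 expr1n mulr1 (gtr0_norm e_gt0) -[leRHS]mulr1.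
  by apply: ler_pM => //; [rewrite mulr_ge0// ltW|lra|exact: sin_max].
split=> //; last exact: L0_star.
  rewrite x2; apply/andP; split; last first.
    rewrite ler_pdivrMr//.
    have : (2 * k + 1)%:R <= p%:R :> R by rewrite ler_nat; exact: half_odd_leq.
    rewrite natrD natrM => kp; rewrite ler_norml in ce.
    have : pi * (2 * k%:R + 1) <= pi * p%:R :> R by rewrite ler_pM2l//; lra.
    lra.
  rewrite mulr_ge0 ?invr_ge0// ?ltW//.
  case: k k0 kh hm x2 => [k0 kh hm x2|k _ kh hm x2].
    have {}k0 := k0 erefl; rewrite k0 in hm *.
    rewrite /phase !(mulr0, mul0r) addr0 in hm *.
    have close := twist_close x.1; rewrite hm in close.
    have := le_trans (sin_lip _ _) close; rewrite sinD2piz sinN sin_pihalf opprK => s1.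
    have {}s1 := le_trans s1 hk; rewrite ler_norml in s1.
    by rewrite add0r expr1; nra.
  rewrite ler_norml in ce.
  have : 2 * pi * 1 <= 2 * pi * k.+1%:R :> R by rewrite ler_pM2l ?ler1n//; lra.
  lra.
(* The translation [m] of the [twist] equation is multiplied by minus the sign; the two translations
   have difference [k]. *)
apply/projP; exists b, (- (-1) ^+ b * m), (- (-1) ^+ b * m - k%:Z).
have kp : kappa = 2 * q%:~R / p%:R - 1 by rewrite /kappa intrB intrM p_int; field; rewrite gt_eqF.
have sE : x.1 = - (pi / 2) + (-1) ^+ b * phase k + 2 * pi * m%:~R + kappa * e * sin x.1.
  by rewrite -hm /twist subrK.
have q1 : q%:~R * x.2 = (-1) ^+ b * (x.1 + e * sin x.1 + pi / 2) + 2 * pi * (- (-1) ^+ b * m)%:~R.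
  rewrite !(intrM, intrN) rmorphXn /= rmorphN1 {1}sE x2 /phase kp.
  transitivity (((-1) ^+ b * (-1) ^+ b) * (q%:~R * (2 * pi * k%:R) / p%:R) + q%:~R * (2 * (-1) ^+ b * e * sin x.1) / p%:R).
    by rewrite c2; field; rewrite gt_eqF.
  by field; rewrite gt_eqF.
rewrite /L1_lift /L0_lift /=; congr pair => //.
have -> : (q - p%:Z)%:~R * x.2 = q%:~R * x.2 - p%:R * x.2 by rewrite intrB p_int; ring.
rewrite q1 x2 mulrCA divff ?gt_eqF// mulr1 intrB -[(k%:Z)%:~R]/(k%:R); ring.
Qed.

End Fixed.
End Generators.

(** * Gradings *)

Section Loops.
Context {R : realType}.
Variables (z : (R -> pillow R) -> 'Z_4) (z_class : represents_z z).
Variables (p : nat) (q : int) (e : R).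
Hypotheses (p_gt0 : (0 < p)%N) (pq_coprime : coprimez p%:Z q) (he : 0 < e < 1 / 4).

Local Notation F0 := (fun s : R^o => proj (L0_lift e s)).
Local Notation F1 := (fun t : R^o => proj (L1_lift p q t)).
Local Notation Z0 := (zseg z F0).
Local Notation Z1 := (zseg z F1).

Let e_gt0 : 0 < e. Proof. by case/andP: he. Qed.

Definition in_arc (t : R^o) : Prop := 0 < t < pi.

Lemma cF0 : continuous F0.
Proof. exact: continuousT_comp (@continuous_L0 R e) (@continuous_proj R). Qed.

Lemma cF1 : continuous F1.
Proof. exact: continuousT_comp (@continuous_L1 R p q) (@continuous_proj R). Qed.

Lemma F0_star (s : R^o) : True -> pillow_star (F0 s).
Proof. by move=> _; exact: L0_star. Qed.

Lemma F1_star (t : R^o) : in_arc t -> pillow_star (F1 t).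
Proof. by move=> ht; apply/pillow_starP; exact: (L1_interior pq_coprime ht). Qed.

Lemma in_arc_convex (a b : R^o) (t : R) : in_arc a -> in_arc b -> 0 <= t <= 1 ->
  in_arc ((1 - t) *: a + t *: b).
Proof.
move: a b => a b; rewrite /in_arc -[_ *: a + _]/(seg a b t) segE.
move=> /andP[a1 a2] /andP[b1 b2] ht.
have [->|t0] := eqVneq t 0; first by rewrite subr0 mul0r mul1r addr0 a1.
have {}t0 : 0 < t by rewrite lt_neqAle eq_sym t0; case/andP: ht.
by apply/andP; split; nra.
Qed.

Let convT (a b : R^o) (t : R) : True -> True -> 0 <= t <= 1 -> True. Proof. by []. Qed.

Lemma Z0_add a b c : Z0 a b + Z0 b c = Z0 a c.
Proof. exact: (zseg_add z_class.1 cF0 F0_star convT). Qed.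

Lemma Z0_xx a : Z0 a a = 0.
Proof. exact: (zseg_xx z_class.1 F0_star). Qed.

Lemma Z0C a b : Z0 b a = - Z0 a b.
Proof. by apply/eqP; rewrite -addr_eq0 Z0_add Z0_xx. Qed.

Lemma Z1_add a b c : in_arc a -> in_arc b -> in_arc c -> Z1 a b + Z1 b c = Z1 a c.
Proof. exact: (zseg_add z_class.1 cF1 F1_star in_arc_convex). Qed.

Lemma Z1_xx a : in_arc a -> Z1 a a = 0.
Proof. exact: (zseg_xx z_class.1 F1_star). Qed.

Lemma Z1C a b : in_arc a -> in_arc b -> Z1 b a = - Z1 a b.
Proof. by move=> ha hb; apply/eqP; rewrite -addr_eq0 Z1_add// Z1_xx. Qed.

Lemma z_within (E : normedModType R) (F : E -> pillow R) (D : set E) (g : R -> E) :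
  continuous F -> (forall x, D x -> pillow_star (F x)) ->
  (forall a b (t : R), D a -> D b -> 0 <= t <= 1 -> D ((1 - t) *: a + t *: b)) ->
  {within `[0, 1]%classic, continuous g} -> (forall u, 0 <= u <= 1 -> D (g u)) ->
  path_in pillow_star (F \o g) /\ z (F \o g) = zseg z F (g 0) (g 1).
Proof.
move=> cF FD convD cg gD.
have gP : path_in pillow_star (F \o g).
  by split; [exact: continuousT_comp cg cF|move=> u /gD; exact: FD].
split=> //; have -> : z (F \o g) = z (F \o (g \o clamp)).
  by apply: (cocycle_ext z_class.1 gP) => u hu /=; rewrite clamp_id.
rewrite (zseg_path z_class.1 cF FD convD (continuous_clamped cg)).
  by rewrite /= !clamp_id ?lexx ?ler01.
by move=> u _ /=; apply/gD/clamp_itv.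
Qed.

Lemma F0D2pi s (k : int) : F0 (s + 2 * pi * k%:~R) = F0 s.
Proof.
rewrite -[RHS](projD2pi _ k k); congr proj; apply: pair_ext; rewrite /L0_lift /= sinD2piz; ring.
Qed.

(** The borderline value is [s = - pi / 2], where the curve is at [(- e, e)]: since [e] is positive
    this lies in the overlap of the half squares. *)
Lemma L0_upper_right (s : R) : 0 <= s + pi / 2 -> s + pi / 2 + e < pi -> upper_right (L0_lift e s).
Proof.
move=> s1 s2; have [e0 e1] := andP he; have p2 := @pi_ge2 R.
have se : `|e * sin s| <= e by rewrite normrM (gtr0_norm e0) ler_piMr ?sin_max// ltW.
rewrite ler_norml in se.
split; first by rewrite /near_corner /L0_lift /= !ltr_norml; split; lra.
rewrite /L0_lift /=; have [s0|s0] := eqVneq (s + pi / 2) 0; last first.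
  by left; have : 0 < s + pi / 2 by [rewrite lt_neqAle eq_sym s0]; lra.
right; have -> : s = - (pi / 2) by lra.
by rewrite sinN sin_pihalf; split; lra.
Qed.

Lemma L0_upper_left (s : R) : s + pi / 2 <= 0 -> - pi < s + pi / 2 - e -> upper_left (L0_lift e s).
Proof.
move=> s1 s2; have [e0 e1] := andP he; have p2 := @pi_ge2 R.
have se : `|e * sin s| <= e by rewrite normrM (gtr0_norm e0) ler_piMr ?sin_max// ltW.
rewrite ler_norml in se.
split; first by rewrite /near_corner /L0_lift /= !ltr_norml; split; lra.
rewrite /L0_lift /=; have [s0|s0] := eqVneq (s + pi / 2) 0; last first.
  by left; have : s + pi / 2 < 0 by [rewrite lt_neqAle s0]; lra.
right; have -> : s = - (pi / 2) by lra.
by rewrite sinN sin_pihalf; split; lra.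
Qed.

Lemma half_turn_L0 (m n : int) (a b : R) : 0 < a + pi / 2 -> a + pi / 2 + e < pi ->
  b + pi / 2 < 0 -> - pi < b + pi / 2 - e ->
  z (fun u => centered m n (L0_lift e (seg (a : R^o) (- (pi / 2)) u))) +
  z (fun u => centered m n (L0_lift e (seg (- (pi / 2) : R^o) b u))) +
  zseg z (centered m n) (L0_lift e b) (- L0_lift e a) = 1.
Proof.
move=> a1 a2 b1 b2; apply: half_turn_curve => //; first exact: continuous_L0.
- by move=> u hu; apply: L0_upper_right; rewrite segE; nra.
- by move=> u hu; apply: L0_upper_left; rewrite segE; nra.
- by rewrite /L0_lift /=; lra.
Qed.

Lemma centered00 (v : R * R) : centered 0 0 v = proj v.
Proof. by rewrite /centered; congr proj; apply: pair_ext => /=; rewrite mulr0 add0r. Qed.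

(** [L_0] is symmetric about [(pi / 2, pi / 2)]. This exchanges the corners [(0, 0)] and [(pi, pi)],
    so that one computation near the origin serves for both. *)
Lemma centered11_L0 s : centered 1 1 (L0_lift e s) = F0 (- s).
Proof.
rewrite -centeredN /centered -[RHS](projD2pi _ 0 0); congr proj.
by apply: pair_ext; rewrite /L0_lift /= sinN -[1%:~R]/(1 : R) mulr0; lra.
Qed.

Lemma L0_antipode : L0_lift e (- pi) = - L0_lift e 0.
Proof. by apply: pair_ext; rewrite /L0_lift /= sinN sinpi sin0; lra. Qed.

Lemma zseg_const (m n : int) (v : R * R) : upper_left v -> zseg z (centered m n) v v = 0.
Proof. exact: (zseg_xx z_class.1 (@upper_left_star R m n)). Qed.

(** From the parameter [0] the curve makes a half turn about [(0, 0)] when run backwards to [- pi],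
    and one about [(pi, pi)] when run forwards to [pi]. Both have value [1], so the full circuit has
    value [-1 + 1]. *)
Lemma Z0_full_turn : Z0 (- pi) pi = 0.
Proof.
have p2 := @pi_ge2 R; have [e0 e1] := andP he.
have ul : upper_left (L0_lift e (- pi)) by apply: L0_upper_left; lra.
have turn (m n : int) := @half_turn_L0 m n 0 (- pi).
have h0 : Z0 0 (- pi) = 1.
  rewrite -(Z0_add 0 (- (pi / 2))).
  have -> : Z0 0 (- (pi / 2)) = z (fun u => centered 0 0 (L0_lift e (seg (0 : R^o) (- (pi / 2)) u))).
    by congr z; apply/funext => u; rewrite centered00.
  have -> : Z0 (- (pi / 2)) (- pi) = z (fun u => centered 0 0 (L0_lift e (seg (- (pi / 2) : R^o) (- pi) u))).
    by congr z; apply/funext => u; rewrite centered00.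
  rewrite -[LHS]addr0 -(zseg_const 0 0 ul) {2}L0_antipode; apply: turn; lra.
have h1 : Z0 0 pi = 1.
  rewrite -(Z0_add 0 (pi / 2)).
  have -> : Z0 0 (pi / 2) = z (fun u => centered 1 1 (L0_lift e (seg (0 : R^o) (- (pi / 2)) u))).
    by congr z; apply/funext => u; rewrite centered11_L0; congr F0; rewrite !segE; ring.
  have -> : Z0 (pi / 2) pi = z (fun u => centered 1 1 (L0_lift e (seg (- (pi / 2) : R^o) (- pi) u))).
    by congr z; apply/funext => u; rewrite centered11_L0; congr F0; rewrite !segE; ring.
  rewrite -[LHS]addr0 -(zseg_const 1 1 ul) {2}L0_antipode; apply: turn; lra.
by rewrite -(Z0_add _ 0) h1 Z0C h0 addNr.
Qed.

Lemma Z0D2pi a b (k : int) : Z0 (a + 2 * pi * k%:~R) (b + 2 * pi * k%:~R) = Z0 a b.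
Proof.
congr z; apply/funext => u /=; rewrite -[RHS](F0D2pi _ k); congr F0.
by rewrite !segE; ring.
Qed.

Lemma Z0_turn a : Z0 a (a + 2 * pi) = 0.
Proof.
rewrite -(Z0_add a (- pi)) -(Z0_add (- pi) pi) Z0_full_turn add0r.
have -> : Z0 pi (a + 2 * pi) = Z0 (- pi) a.
  by rewrite -(Z0D2pi (- pi) a 1) mulr1; congr (Z0 _ _); lra.
by rewrite Z0_add Z0_xx.
Qed.

(** Consequently [Z0] depends only on the points of the circle, and it does not matter how often a
    path along [L_0] winds. *)
Lemma Z0_turns a b (k : int) : Z0 a (b + 2 * pi * k%:~R) = Z0 a b.
Proof.
have nat_turns c (n : nat) : Z0 c (c + 2 * pi * n%:R) = 0.
  elim: n => [|n IH]; first by rewrite mulr0 addr0 Z0_xx.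
  have -> : c + 2 * pi * n.+1%:R = c + 2 * pi * n%:R + 2 * pi.
    by rewrite -[n.+1%:R]natr1; ring.
  rewrite -(Z0_add c (c + 2 * pi * n%:R)) IH Z0_turn.
  by rewrite addr0.
rewrite -(Z0_add a b) -[RHS]addr0; congr (_ + _).
case: (intP k) => [|n|n]; first by rewrite mulr0 addr0 Z0_xx.
- exact: nat_turns.
- rewrite Z0C; apply/eqP; rewrite oppr_eq0; apply/eqP.
  rewrite -[X in Z0 _ X](subrK (2 * pi * n.+1%:R) b) mulrNz mulrN.
  exact: nat_turns.
Qed.

End Loops.

(** * Relative gradings of the generators *)

Section Grading.
Context {R : realType}.
Variables (p : nat) (q : int) (c e : R).
Local Notation phi := (@phase R p q).
Local Notation kap := (@kappa R p q).
Hypotheses (p_gt0 : (0 < p)%N) (p_odd : odd p) (pq_coprime : coprimez p%:Z q).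
Hypothesis hc : 0 < c <= 1.
Hypothesis sin_gap : forall k, (0 < k <= p.-1./2)%N -> c <= `|sin (phi k)|.
Hypotheses (he : 0 < e < c / 8) (hk : `|kap| * e <= c / 4).

Let pR : 0 < p%:R :> R. Proof. by rewrite ltr0n. Qed.

Lemma e_small : 0 < e < 1 / 4.
Proof. by have [h1 h2] := andP hc; have [h3 h4] := andP he; lra. Qed.

Lemma kappa_small : `|kap| * e <= 1 / 4.
Proof. by have [h1 h2] := andP hc; have h3 := hk; lra. Qed.

Lemma signed_lt0 (b : bool) (k : nat) (a : R) : (0 < k <= p.-1./2)%N ->
  `|a - (-1) ^+ b * sin (phi k)| <= c / 4 ->
  a != 0 /\ (a < 0) = (b != (sin (phi k) < 0)).
Proof.
move=> /sin_gap; have [c0 c1] := andP hc.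
move: (sin _) => s hs; rewrite ler_norml.
have sn : s != 0 by apply/eqP => s0; move: hs; rewrite s0 normr0; lra.
case: b; rewrite ?expr0 ?expr1 ?mul1r ?mulN1r ?opprK; case: (ltgtP s 0) sn hs => // s0 _;
  rewrite ?(ltr0_norm s0) ?(gtr0_norm s0) /= => hs ha.
- have a0 : 0 < a by lra.
  by rewrite gt_eqF// lt_gtF.
- have a0 : a < 0 by lra.
  by rewrite lt_eqF// a0.
- have a0 : a < 0 by lra.
  by rewrite lt_eqF// a0.
- have a0 : 0 < a by lra.
  by rewrite gt_eqF// lt_gtF.
Qed.

(** [cos x.1] is within [c / 4] of [sin (phase k)] or its negative, whose absolute value is at least
    [c]. *)
Lemma gen_at_cos_sign b k x : (0 < k <= p.-1./2)%N -> gen_at p q e b k x ->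
  cos x.1 != 0 /\ (cos x.1 < 0) = (b != (sin (phi k) < 0)).
Proof.
move=> hk' gx; apply: signed_lt0 => //; apply: le_trans hk.
exact: (gen_at_cos e_small gx).
Qed.

(** The phase is [0] here and the gap says nothing. Instead [cos x.1 = sin (kappa e sin x.1)], where
    [sin x.1] is close to [-1] and [kappa] is nonzero. *)
Lemma gen_at0_cos x : gen_at p q e true 0 x -> cos x.1 != 0.
Proof.
move=> [_ [m hm] _]; have [e0 e1] := andP e_small.
rewrite /phase !(mulr0, mul0r) addr0 in hm.
have close := twist_close p q e_small x.1; rewrite hm in close.
have := le_trans (sin_lip _ _) close; rewrite sinD2piz sinN sin_pihalf opprK => s1.
have {}s1 := le_trans s1 kappa_small; rewrite ler_norml in s1.
have -> : x.1 = kap * e * sin x.1 - pi / 2 + 2 * pi * m%:~R.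
  by have := hm; rewrite /twist; lra.
rewrite cosD2piz cosBpihalf.
have kn := kappa_neq0 (R := R) p_gt0 p_odd pq_coprime.
set a := kap * e * sin x.1.
have sn : sin x.1 != 0 by apply/eqP => h; move: s1; rewrite h; lra.
have an : a != 0 by rewrite (mulf_neq0 _ sn)// (mulf_neq0 kn)// gt_eqF.
have al : `|a| < pi.
  apply: le_lt_trans (_ : 1 / 4 < pi); last by have := @pi_ge2 R; lra.
  rewrite normrM (normrM (kap)) (gtr0_norm e0) -[leRHS]mulr1.
  by apply: ler_pM; rewrite ?sin_max ?kappa_small// mulr_ge0// ltW.
rewrite ltr_norml in al.
have [a0|a0|a0] := ltgtP a 0; last by rewrite a0 eqxx in an.
  rewrite -[a]opprK sinN oppr_eq0 gt_eqF// sin_gt0_pi//; lra.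
by rewrite gt_eqF// sin_gt0_pi//; lra.
Qed.

Lemma gens_cos x : gens p q e x -> cos x.1 != 0.
Proof.
move=> /(gens_gen_at p_gt0 p_odd e_small kappa_small)[[|k] [b [kh k0 gx]]].
  by move: gx; rewrite (k0 erefl); exact: gen_at0_cos.
by have [] := gen_at_cos_sign _ gx.
Qed.

Lemma gens_arc x : gens p q e x -> in_arc x.2.
Proof.
move=> [_ /andP[x0 x1] xx /pillow_starP xs].
have nl : ~ lattice (L1_lift p q x.2) by move=> l; apply: xs; exact: lattice_orbit l.
rewrite /in_arc !lt_neqAle x0 x1 !andbT; apply/andP; split; apply/eqP => h; apply: nl.
  by exists 0, 0; rewrite -h /L1_lift !mulr0.
by exists q, (q - p%:Z); rewrite h /L1_lift ![_%:~R * _]mulrC.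
Qed.

Lemma L0_gen (b : bool) (K : int) (l : nat) (a t : R) :
  twist p q e a = - (pi / 2) + (-1) ^+ b * (phi l + 2 * pi * K%:~R) ->
  t = (2 * pi * l%:R + 2 * (-1) ^+ b * e * sin a) / p%:R ->
  L0_lift e a = ((-1) ^+ b * ((L1_lift p q t).1 + 2 * pi * K%:~R),
    (-1) ^+ b * ((L1_lift p q t).2 + 2 * pi * (l%:Z + K)%:~R)).
Proof.
move=> ha ->; have p_int : p%:~R = p%:R :> R by [].
have kp : kap = 2 * q%:~R / p%:R - 1 :> R.
  by rewrite /kappa intrB intrM p_int; field; rewrite gt_eqF.
have aE : a = - (pi / 2) + (-1) ^+ b * (phi l + 2 * pi * K%:~R) +
    (2 * q%:~R / p%:R - 1) * e * sin a by rewrite -ha /twist kp; ring.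
have pn : p%:R != 0 :> R by rewrite gt_eqF.
rewrite /L1_lift /L0_lift /= intrB intrD p_int -[(l%:Z)%:~R]/(l%:R).
by congr pair; rewrite {1}aE /phase; case: b {ha aE}; rewrite ?expr0 ?expr1; field.
Qed.

(** The representative of the phase around [0]. As its sine is at least [c] in absolute value, it
    keeps the distance [c] from [0] and from [pi] and [- pi]; this room is what the half turn in
    [z_pair] uses. *)
Lemma phase_shift l : (0 < l <= p.-1./2)%N -> exists K : int, exists2 w,
  w = phi l + 2 * pi * K%:~R & [/\ sin w = sin (phi l), c <= `|w| & `|w| <= pi - c].
Proof.
move=> hl; have sg := sin_gap hl; have [c0 c1] := andP hc; have p0 := @pi_gt0 R.
have p2 : 0 < 2 * pi :> R by rewrite mulr_gt0.
pose K := Num.floor ((phi l + pi) / (2 * pi)).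
exists (- K), (phi l + 2 * pi * (- K)%:~R) => //.
have /andP[h1 h2] : K%:~R <= (phi l + pi) / (2 * pi) < (K + 1)%:~R.
  by rewrite floor_le_tmp ?floorD1_gt.
rewrite ler_pdivlMr// in h1; rewrite ltr_pdivrMr// intrD -[1%:~R]/(1 : R) in h2.
have sE := sinD2piz (phi l) (- K); rewrite -sE in sg; split=> //.
  move: sg; set w := _ + _ * _ => sg; have := sin_lip w 0; rewrite sin0 !subr0.
  exact: le_trans.
move: sg; set w := _ + _ * _ => sg.
have w1 : - pi <= w by rewrite /w mulrNz; lra.
have w2 : w < pi by rewrite /w mulrNz; lra.
clearbody w.
have [w0|w0] := leP 0 w.
  have := sin_lip pi w; rewrite sinpi sub0r normrN (@ger0_norm _ (pi - w)); last lra.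
  by move=> /(le_trans sg); rewrite ger0_norm//; lra.
have := sin_lip w (- pi); rewrite sinN sinpi oppr0 subr0 (@ger0_norm _ (w - - pi)); last lra.
by move=> /(le_trans sg); rewrite ltr0_norm//; lra.
Qed.

Variables (z : (R -> pillow R) -> 'Z_4) (z_class : represents_z z).

Local Notation F0 := (fun s : R^o => proj (L0_lift e s)).
Local Notation F1 := (fun t : R^o => proj (L1_lift p q t)).
Local Notation Z0 := (zseg z F0).
Local Notation Z1 := (zseg z F1).

Lemma z_pair l x y : (0 < l <= p.-1./2)%N ->
  gen_at p q e (sin (phi l) < 0) l x -> gen_at p q e (~~ (sin (phi l) < 0)) l y ->
  Z0 x.1 y.1 + Z1 y.2 x.2 = 1.
Proof.
move=> hl; have [K [w wE [ws w1 w2]]] := phase_shift hl; have sg := sin_gap hl.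
have p0 := @pi_gt0 R; have [c0 c1] := andP hc; have [he0 he1] := andP he.
have wn : `|w| < pi by lra.
rewrite -ws; have -> : (sin w < 0) = (w < 0).
  rewrite ltr_norml in wn.
  have [w0|w0|w0] := ltgtP w 0.
  - by rewrite -[w]opprK sinN oppr_lt0 sin_gt0_pi//; lra.
  - by rewrite lt_gtF// sin_gt0_pi//; lra.
  - by move: w1; rewrite w0 normr0 leNgt c0.
set b := w < 0 => -[_ [m hm] x2] [_ [n hn] y2].
have bw : (-1) ^+ b * w = `|w|.
  rewrite /b; case: ltP => w0; first by rewrite expr1 mulN1r ltr0_norm.
  by rewrite expr0 mul1r ger0_norm.
have nb : (-1) ^+ (~~ b) = - (-1) ^+ b :> R by case: (b); rewrite ?expr0 ?expr1 ?opprK.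
have shift (s : R) (k : int) (b' : bool) :
    twist p q e s = - (pi / 2) + (-1) ^+ b' * phi l + 2 * pi * k%:~R ->
    exists2 j : int, twist p q e (s + 2 * pi * j%:~R) = - (pi / 2) + (-1) ^+ b' * w &
      `|s + 2 * pi * j%:~R - (- (pi / 2) + (-1) ^+ b' * w)| <= c / 4.
  move=> hs; exists ((-1) ^+ b' * K - k).
    rewrite twistD hs wE intrB intrM rmorphXn /= rmorphN1; ring.
  have := twist_close p q e_small (s + 2 * pi * ((-1) ^+ b' * K - k)%:~R).
  rewrite twistD hs; move=> h; apply: le_trans hk; apply: le_trans h.
  rewrite le_eqVlt; apply/orP; left; apply/eqP; congr `|_ - _|.
  by rewrite wE intrB intrM rmorphXn /= rmorphN1; ring.
(* The translates [A] and [B] are close to [- pi / 2 + |w|] and [- pi / 2 - |w|], on the two sides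
   of the crossing point [- pi / 2]. *)
have [i ti ci] := shift _ _ _ hm; have [j tj cj] := shift _ _ _ hn.
rewrite nb mulNr bw in cj tj; rewrite bw in ci.
rewrite ler_norml in ci; rewrite ler_norml in cj.
set A := x.1 + 2 * pi * i%:~R in ti ci; set B := y.1 + 2 * pi * j%:~R in tj cj.
have -> : Z0 x.1 y.1 = Z0 A B.
  have e1 : Z0 A B = Z0 A y.1 by exact: (Z0_turns z_class e_small A y.1 j).
  have e2 : Z0 y.1 A = Z0 y.1 x.1 by exact: (Z0_turns z_class e_small y.1 x.1 i).
  by rewrite e1 (Z0C z_class e_small y.1 A) e2 -(Z0C z_class e_small y.1 x.1).
have xA : sin A = sin x.1 by rewrite /A sinD2piz.
have yB : sin B = sin y.1 by rewrite /B sinD2piz.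
have LA : L0_lift e A = ((-1) ^+ b * ((L1_lift p q x.2).1 + 2 * pi * K%:~R),
    (-1) ^+ b * ((L1_lift p q x.2).2 + 2 * pi * (l%:Z + K)%:~R)).
  by apply: L0_gen; [rewrite ti wE|rewrite xA].
have LB : L0_lift e B = ((-1) ^+ (~~ b) * ((L1_lift p q y.2).1 + 2 * pi * K%:~R),
    (-1) ^+ (~~ b) * ((L1_lift p q y.2).2 + 2 * pi * (l%:Z + K)%:~R)).
  by apply: L0_gen; [rewrite tj nb mulNr -bw wE|rewrite yB].
(* The ends of the segment on [L_1] are carried to [L0_lift e A] and [L0_lift e B] by the same
   translation but with opposite signs. Up to the group, the segment therefore runs from
   [L0_lift e B] to [- L0_lift e A] and closes the half turn about the origin. *)
have -> : Z1 y.2 x.2 = zseg z (centered 0 0) (L0_lift e B) (- L0_lift e A).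
  congr z; apply/funext => u /=; rewrite centered00.
  rewrite -(projD2pi (L1_lift p q _) K (l%:Z + K)).
  have -> : seg (L0_lift e B) (- L0_lift e A) u =
    (- (-1) ^+ b * ((L1_lift p q (seg (y.2 : R^o) x.2 u)).1 + 2 * pi * K%:~R),
     - (-1) ^+ b * ((L1_lift p q (seg (y.2 : R^o) x.2 u)).2 + 2 * pi * (l%:Z + K)%:~R)).
    have seg_fst (v w' : R * R) : (seg v w' u).1 = (1 - u) * v.1 + u * w'.1 by [].
    have seg_snd (v w' : R * R) : (seg v w' u).2 = (1 - u) * v.2 + u * w'.2 by [].
    by apply: pair_ext; rewrite ?seg_fst ?seg_snd LA LB nb /L1_lift /= segE; ring.
  by case: (b); rewrite ?expr0 ?expr1 ?opprK ?mul1r ?mulN1r// -[LHS]projN.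
rewrite -(Z0_add z_class e_small A (- (pi / 2))).
have := @half_turn_L0 R z z_class e e_small 0 0 A B.
have -> : (fun u => centered 0 0 (L0_lift e (seg (A : R^o) (- (pi / 2)) u))) = F0 \o seg (A : R^o) (- (pi / 2)).
  by apply/funext => u; rewrite centered00.
have -> : (fun u => centered 0 0 (L0_lift e (seg (- (pi / 2) : R^o) B u))) = F0 \o seg (- (pi / 2) : R^o) B.
  by apply/funext => u; rewrite centered00.
apply; lra.
Qed.

Lemma arc_star t : 0 <= t <= pi -> pillow_star (F1 t) -> in_arc t.
Proof.
move=> /andP[x0 x1] /pillow_starP xs.
rewrite /in_arc !lt_neqAle x0 x1 !andbT; apply/andP; split; apply/eqP => h; apply: xs.
  by exists 0, 0; rewrite -h /L1_lift !mulr0.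
by exists q, (q - p%:Z); rewrite h /L1_lift ![_%:~R * _]mulrC.
Qed.

Lemma connecting_z x y alpha0 alpha1 : gens p q e x -> gens p q e y ->
  connecting (L0_lift e) (L1_lift p q) x y alpha0 alpha1 ->
  z (connecting_loop (L0_lift e) (L1_lift p q) alpha0 alpha1) = Z0 x.1 y.1 + Z1 y.2 x.2.
Proof.
move=> gx gy [[c0 a00 [k a01]] [c1 a10 a11] ha].
have [g0 z0] := z_within z_class (@cF0 R e) (F0_star e_small) (fun _ _ _ _ _ _ => I) c0 (fun _ _ => I).
have arc1 u : 0 <= u <= 1 -> in_arc (alpha1 u).
  by move=> /ha[h1 _ h2]; exact: arc_star.
have [g1 z1] := z_within z_class (@cF1 R p q) (F1_star pq_coprime) in_arc_convex c1 arc1.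
have [_ _ yy _] := gy.
rewrite /connecting_loop (cocycle_concat z_class.1 g0 g1) ?z0 ?z1.
  by rewrite a00 a01 a10 a11 (Z0_turns z_class e_small).
by rewrite /= a01 a10 (F0D2pi e) yy.
Qed.

Let slope_small s : 0 < p%:R - e * cos s * (2 * q%:~R - p%:R) :> R.
Proof.
rewrite -kappaE// mulrA -[X in X - _]mul1r -mulrBl pmulr_lgt0// subr_gt0.
apply: le_lt_trans (ler_norm _) _; apply: le_lt_trans (_ : 1 / 4 < 1); last by lra.
have [e0 _] := andP e_small; rewrite normrM mulrC (normrM e) (gtr0_norm e0).
by apply: le_trans kappa_small; rewrite ler_wpM2l// ler_piMr ?cos_max// ltW.
Qed.

Lemma L1_sum_diff : ((q%:~R : R) + (q - p%:Z)%:~R = 2 * q%:~R - p%:R) *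
  ((q - p%:Z)%:~R - (q%:~R : R) = - p%:R).
Proof. by split; rewrite intrB -[(p%:Z)%:~R]/(p%:R); ring. Qed.

Lemma tau_iff x n : gens p q e x ->
  is_tau_at (L0_lift e) (L1_lift p q) x n <-> n = (cos x.1 < 0)%R%:Z.
Proof.
move=> gx; have [e0 _] := andP e_small.
rewrite /is_tau_at velocity_L0 velocity_L1; apply: is_tau_L0 => //.
- by rewrite mulf_neq0 ?gens_cos// gt_eqF.
- by rewrite /= L1_sum_diff oppr_lt0.
- by rewrite /= !L1_sum_diff opprK; exact: slope_small.
Qed.

(** The tangent [(q, q - p)] is constant and not diagonal; the bound on [eta] keeps the reference
    line off it. *)
Lemma maslov_L1 alpha : is_maslov (L1_lift p q : R -> R * R) alpha 0 /\
  forall n, is_maslov (L1_lift p q : R -> R * R) alpha n -> n = 0.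
Proof.
pose S : R := `|2 * q%:~R - p%:R| + 1.
have S0 : 0 < S by rewrite ltr_wpDl.
apply: (@is_degree_none R _ (Num.min (1 / 4) (p%:R / (2 * S)))).
  by rewrite lt_min !divr_gt0// mulr_gt0.
move=> eta u; rewrite lt_min => /andP[h0 /andP[h1 h2]] _.
have heta : 0 < eta < 1 / 4 by rewrite h0.
have [s0 s1 /andP[c0 c1]] := small_angle heta.
rewrite velocity_L1 cross_dir /= !L1_sum_diff.
apply: mulf_neq0; first by rewrite gt_eqF// cos_piquarter_gt0.
rewrite lt_eqF// mulNr subr_lt0 ltrNl.
rewrite ltr_pdivlMr ?mulr_gt0// in h2.
have : `|2 * q%:~R - p%:R| * sin eta <= S * eta by apply: ler_pM => //; [exact: ltW|rewrite lerDl].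
have : - ((2 * q%:~R - p%:R) * sin eta) <= `|2 * q%:~R - p%:R| * sin eta.
  have key (A s : R) : 0 <= s -> - (A * s) <= `|A| * s.
    by move=> hs; rewrite -mulNr ler_wpM2r//; have := ler_norm (- A); rewrite normrN.
  by apply: key; exact: ltW.
have : p%:R * (3 / 4) <= p%:R * cos eta by rewrite ler_pM2l.
have := pR; lra.
Qed.

(** This is the window of [maslov_L0_exists]; its ends are excluded because [cos] vanishes there. *)
Lemma gens_lift x : gens p q e x -> exists2 x' : R, - (pi / 2) < x' < 3 / 2 * pi &
  exists j : int, x.1 = x' + 2 * pi * j%:~R.
Proof.
move=> gx; have cx := gens_cos gx; have [/andP[x0 x1] _ _ _] := gx; have p0 := @pi_gt0 R.
have xn : x.1 != 3 / 2 * pi.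
  apply: contra_neq cx => ->.
  have -> : 3 / 2 * pi = pi / 2 + pi :> R by lra.
  by rewrite cosDpi cos_pihalf oppr0.
have [h|h|h] := ltgtP x.1 (3 / 2 * pi); last by rewrite h eqxx in xn.
  by exists x.1; [lra|exists 0; rewrite mulr0 addr0].
by exists (x.1 - 2 * pi); [lra|exists 1; rewrite mulr1 subrK].
Qed.

Lemma connecting_exists x y : gens p q e x -> gens p q e y -> exists alpha0 alpha1,
  connecting (L0_lift e) (L1_lift p q) x y alpha0 alpha1 /\
  is_maslov (L0_lift e) alpha0 ((cos y.1 < 0)%R%:Z - (cos x.1 < 0)%R%:Z).
Proof.
move=> gx gy; have [x' hx [j xj]] := gens_lift gx; have [y' hy [k yk]] := gens_lift gy.
have [e0 e1] := andP e_small.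
have cx : cos x.1 = cos x' by rewrite xj cosD2piz.
have cy : cos y.1 = cos y' by rewrite yk cosD2piz.
exists (fun u => seg (x' : R^o) y' u + 2 * pi * j%:~R), (seg (y.2 : R^o) x.2); split.
  split.
  - split; first 2 last.
    + by exists (j - k); rewrite seg1 yk intrB; ring.
    + apply: continuous_subspaceT; apply: continuousTD; last by move=> u; exact: cvg_cst.
      exact: (@continuous_seg _ R^o).
    + by rewrite seg0 xj.
  - by split; [apply: continuous_subspaceT; exact: (@continuous_seg _ R^o)|rewrite seg0|rewrite seg1].
  - move=> u hu; have h := in_arc_convex (gens_arc gy) (gens_arc gx) hu.
    split; [|exact: (F0_star e_small)|exact: (F1_star pq_coprime h)].
    by case/andP: h => h1 h2; apply/andP; split; apply: ltW.
rewrite /is_maslov; have -> : (fun u => velocity (L0_lift e) (seg (x' : R^o) y' u + 2 * pi * j%:~R)) =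
    (fun u => L0_tangent e (seg (x' : R^o) y' u)).
  by apply/funext => u; rewrite velocity_L0 /L0_tangent cosD2piz.
rewrite cx cy; apply: maslov_L0_exists => //; first by rewrite e0; lra.
  by rewrite -cx gens_cos.
by rewrite -cy gens_cos.
Qed.

Lemma is_gr_iff x y g : gens p q e x -> gens p q e y ->
  is_gr (L0_lift e) (L1_lift p q) z x y g <-> g = Z0 x.1 y.1 + Z1 y.2 x.2.
Proof.
move=> gx gy; split=> [[a0 [a1 [m0 [m1 [tx [ty [cn [hm0 hm1] [htx hty] ->]]]]]]]|->].
  rewrite (connecting_z gx gy cn).
  have [[c0 a00 [k a01]] _ _] := cn; have [e0 e1] := andP e_small.
  have cx : cos (a0 0) = cos x.1 by rewrite a00.
  have cy : cos (a0 1) = cos y.1 by rewrite a01 cosD2piz.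
  have -> : m0 = (cos y.1 < 0)%R%:Z - (cos x.1 < 0)%R%:Z.
    rewrite -cx -cy; apply: (maslov_L0_unique _ c0 _ _ hm0); rewrite ?cx ?cy ?gens_cos//.
    by rewrite e0; lra.
  rewrite ((maslov_L1 a1).2 _ hm1) ((tau_iff tx gx).1 htx) ((tau_iff ty gy).1 hty).
  have -> : (cos y.1 < 0)%R%:Z - (cos x.1 < 0)%R%:Z + 0 + (cos x.1 < 0)%R%:Z -
    (cos y.1 < 0)%R%:Z = 0 by ring.
  by rewrite add0r.
have [a0 [a1 [cn hm]]] := connecting_exists gx gy.
exists a0, a1, ((cos y.1 < 0)%R%:Z - (cos x.1 < 0)%R%:Z), 0, (cos x.1 < 0)%R%:Z, (cos y.1 < 0)%R%:Z.
split=> //.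
- by split=> //; exact: (maslov_L1 a1).1.
- by split; apply/tau_iff.
- rewrite (connecting_z gx gy cn).
  have -> : (cos y.1 < 0)%R%:Z - (cos x.1 < 0)%R%:Z + 0 + (cos x.1 < 0)%R%:Z -
    (cos y.1 < 0)%R%:Z = 0 by ring.
  by rewrite add0r.
Qed.

End Grading.

Lemma lipschitz_continuous (R : realType) (f : R -> R) (x a b C : R) : a < x < b ->
  (forall y, a < y < b -> `|f x - f y| <= C * `|x - y|) -> {for x, continuous f}.
Proof.
move=> /andP[ax xb] hf; apply/cvgrPdist_lt => e e0.
have C0 : 0 <= C.
  pose y := (x + b) / 2; have : `|f x - f y| <= C * `|x - y| by apply: hf; rewrite /y; lra.
  have xy : 0 < `|x - y| by rewrite normr_gt0 subr_eq0 lt_eqF// /y; lra.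
  by move=> h; rewrite -(pmulr_lge0 _ xy); apply: le_trans h.
have [Cn|Cn] := eqVneq C 0.
  near=> y; have hy : a < y < b.
    by apply/andP; split; near: y; [exact: lt_nbhsr|exact: lt_nbhsl].
  by apply: le_lt_trans (hf y hy) _; rewrite Cn mul0r.
have {}C0 : 0 < C by rewrite lt_neqAle eq_sym Cn.
have eC : 0 < e / C by exact: divr_gt0.
have xn : \forall y \near x, `|x - y| < e / C by apply/nbhs_ballP; exists (e / C).
near=> y; have hy : a < y < b.
  by apply/andP; split; near: y; [exact: lt_nbhsr|exact: lt_nbhsl].
apply: le_lt_trans (hf y hy) _; rewrite mulrC -ltr_pdivlMr//.
Unshelve. all: by end_near. Qed.

(** * The intersection points as functions of [e] *)

Section Points.
Context {R : realType}.
Variables (p : nat) (q : int) (c e0 : R).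
Local Notation phi := (@phase R p q).
Local Notation kap := (@kappa R p q).
Hypotheses (p_gt0 : (0 < p)%N) (p_odd : odd p) (pq_coprime : coprimez p%:Z q).
Hypothesis hc : 0 < c <= 1.
Hypothesis sin_gap : forall k, (0 < k <= p.-1./2)%N -> c <= `|sin (phi k)|.
Hypothesis cos_gap : forall k l, (k <= p.-1./2)%N -> (l <= p.-1./2)%N -> k != l ->
    c <= `|cos (phi k) - cos (phi l)|.
Hypothesis e0_gt0 : 0 < e0.
Hypothesis he : forall e, 0 < e < e0 -> 0 < e < c / 8.
Hypothesis hk : forall e, 0 < e < e0 -> `|kap| * e <= c / 4.
Hypothesis hq : forall e, 0 < e < e0 -> `|q%:~R| * (2 * e / p%:R) <= c / 4.

Let pR : 0 < p%:R :> R. Proof. by rewrite ltr0n. Qed.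

(** The unique solution of [gen_at]; it exists for [e] below [e0], where the default is never
    taken. *)
Definition gen_pt (b : bool) (k : nat) (e : R) : R * R :=
  xget (0, 0) [set x | gen_at p q e b k x].

Let he' e : 0 < e < e0 -> 0 < e < 1 / 4.
Proof. by move=> /he h; have := e_small hc h. Qed.

Let hk' e : 0 < e < e0 -> `|kap| * e <= 1 / 4.
Proof. by move=> h; apply: kappa_small hc _; exact: hk. Qed.

Lemma gen_ptP b k e : 0 < e < e0 -> gen_at p q e b k (gen_pt b k e).
Proof.
move=> h; rewrite /gen_pt; case: xgetP => [x -> //|].
by have [x hx] := gen_at_exists (he' h) (hk' h) b k; move=> /(_ x).
Qed.

Lemma gens_pt e x : 0 < e < e0 -> gens p q e x <->
  exists k (b : bool), [/\ (k <= p.-1./2)%N, k = 0%N -> b & x = gen_pt b k e].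
Proof.
move=> h; rewrite (gens_gen_at p_gt0 p_odd (he' h) (hk' h)).
split=> -[k [b [kh k0 gx]]]; exists k, b; split=> //.
  exact: (gen_at_unique (he' h) (hk' h) gx (gen_ptP b k h)).
by rewrite gx; exact: gen_ptP.
Qed.

Lemma gens_gen_pt e (b : bool) k : 0 < e < e0 -> (k <= p.-1./2)%N -> (k = 0%N -> b) ->
  gens p q e (gen_pt b k e).
Proof. by move=> h kh k0; apply/gens_pt => //; exists k, b. Qed.

(** The radius [c / 2] works because a generator is within [c / 4] of its own level while different
    levels are at least [c] apart. *)
Definition cos_nbhd (l : nat) : set (pillow R) :=
  [set x : pillow R | exists v, x = proj v /\ `|cos v.1 - cos (phi l)| < c / 2].

Lemma cos_nbhdP l t : cos_nbhd l (proj (L1_lift p q t)) <->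
  `|cos (q%:~R * t) - cos (phi l)| < c / 2.
Proof.
split=> [[v [/cos_orbit[h _ _] hv]]|h]; last by exists (L1_lift p q t).
by rewrite -[q%:~R * t]/((L1_lift p q t).1) h.
Qed.

Lemma phaseE k : phi k = q%:~R * (2 * pi * k%:R / p%:R).
Proof. by rewrite /phase; ring. Qed.

Lemma gen_pt_phase b k e : 0 < e < e0 ->
  `|cos (q%:~R * (gen_pt b k e).2) - cos (phi k)| <= c / 4.
Proof.
move=> h; apply: le_trans (hq h); rewrite phaseE.
apply: le_trans (cos_lip _ _) _; rewrite -mulrBr normrM ler_wpM2l//.
exact: (gen_at_time p_gt0 (he' h) (gen_ptP b k h)).
Qed.

Lemma cos_nbhd_pt b k l e : 0 < e < e0 -> (k <= p.-1./2)%N -> (l <= p.-1./2)%N ->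
  cos_nbhd l (image_pt p q (gen_pt b k e)) <-> k = l.
Proof.
move=> h kh lh; rewrite /image_pt cos_nbhdP; have hph := gen_pt_phase b k h; have [c0 c1] := andP hc.
split=> [hl|<-]; last by apply: le_lt_trans hph _; lra.
apply/eqP/negPn/negP => /(cos_gap kh lh).
move: hph hl; move: (cos (q%:~R * _)) (cos (phi k)) (cos (phi l)) => A B D.
rewrite ler_norml ltr_norml => h1 h2; rewrite leNgt => /negP; apply.
by rewrite ltr_norml; lra.
Qed.

Lemma x_pt_nbhd l : cos_nbhd l (x_pt p q l : pillow R).
Proof.
have [c0 c1] := andP hc.
by rewrite /x_pt cos_nbhdP -phaseE subrr normr0 divr_gt0.
Qed.

Lemma gen_pt_cvg b k : (fun e => image_pt p q (gen_pt b k e)) @ 0^'+ --> (x_pt p q k : pillow R).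
Proof.
have tk : (fun e => (gen_pt b k e).2) @ 0^'+ --> 2 * pi * k%:R / p%:R.
  apply/cvgrPdist_lt => eps eps0; near=> e.
  have h : 0 < e < e0 by apply/andP; split; near: e; [exact: nbhs_right_gt|exact: nbhs_right_lt].
  rewrite distrC; apply: le_lt_trans (gen_at_time p_gt0 (he' h) (gen_ptP b k h)) _.
  rewrite ltr_pdivrMr// -ltr_pdivlMl//.
  by near: e; apply: nbhs_right_lt; rewrite !mulr_gt0.
have cF : continuous (fun t => proj (L1_lift p q t) : pillow R) by exact: cF1.
exact: cvg_comp tk (cF _).
Unshelve. all: by end_near. Qed.

Lemma gen_pt_inj (b : bool) k (b' : bool) k' e : 0 < e < e0 -> (k <= p.-1./2)%N -> (k' <= p.-1./2)%N ->
  (k = 0%N -> b) -> (k' = 0%N -> b') -> gen_pt b k e = gen_pt b' k' e -> k = k' /\ b = b'.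
Proof.
move=> h kh kh' k0 k0' e1.
have kk : k = k' by apply/(cos_nbhd_pt b h kh kh'); rewrite e1; apply/cos_nbhd_pt.
split=> //; move: e1 k0 k0'; rewrite -kk; case: k {kh kk kh'} (kh) => [kh _ k0 k0'|k kh e1 _ _].
  by rewrite k0// k0'.
have kp : (0 < k.+1 <= p.-1./2)%N by [].
have [_ s1] := gen_at_cos_sign hc sin_gap (he h) (hk h) kp (gen_ptP b k.+1 h).
have [_ s2] := gen_at_cos_sign hc sin_gap (he h) (hk h) kp (gen_ptP b' k.+1 h).
move: s1; rewrite e1 s2 => /esym.
by case: b b' (sin _ < 0) {e1 s2} => [] [] [].
Qed.

Lemma slope_lt1 e s : 0 < e < e0 -> (slope_L0 e s < 1) = (0 < cos s) /\ (1 < slope_L0 e s) = (cos s < 0).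
Proof.
move=> h; have [h0 h1] := andP (he' h); rewrite /slope_L0 velocity_L0 /=.
have ec : `|e * cos s| < 1.
  rewrite normrM (gtr0_norm h0); apply: le_lt_trans (_ : e * 1 < 1); last by lra.
  by rewrite ler_pM2l// cos_max.
rewrite ltr_norml in ec.
have k0 : 0 < 1 + e * cos s by lra.
rewrite ltr_pdivrMr// ltr_pdivlMr// !mul1r -(pmulr_rgt0 (cos s) h0) -(pmulr_rlt0 (cos s) h0).
split; apply/idP/idP; lra.
Qed.

(** The slope of [L_0] is below [1] exactly where [cos] is positive. By [gen_at_cos_sign] this is
    the solution with [b = (sin (phase l) < 0)], and the other sign gives the minus branch. *)
Lemma x_branch_gen_pt (plus : bool) l : (0 < l <= p.-1./2)%N ->
  x_branch p q plus l e0 (gen_pt (plus == (sin (phi l) < 0)) l).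
Proof.
move=> hl; have [l0 lh] := andP hl; split; first exact: gen_pt_cvg.
exists (cos_nbhd l); split; [exact: open_cos1_nbhd|exact: x_pt_nbhd|].
move=> e h y.
have side (b : bool) : (if plus then slope_L0 e (gen_pt b l e).1 < 1 else 1 < slope_L0 e (gen_pt b l e).1) =
    (b == (plus == (sin (phi l) < 0))).
  have [cn cs] := gen_at_cos_sign hc sin_gap (he h) (hk h) hl (gen_ptP b l h).
  have [s1 s2] := slope_lt1 (gen_pt b l e).1 h.
  case: (plus); rewrite ?s1 ?s2 ?cs; last by case: (b) (sin _ < 0) => [] [].
  rewrite lt_neqAle eq_sym cn /= leNgt cs.
  by case: (b) (sin _ < 0) => [] [].
split=> [->|[/(gens_pt _ h)[k [b [kh k0 ->]]]]].
  split; last by rewrite side.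
  - by apply: gens_gen_pt => // l0'; rewrite l0' in l0.
  - exact/cos_nbhd_pt.
by move=> /(cos_nbhd_pt b h kh lh) ->; rewrite side => /eqP ->.
Qed.

(** The parameters differ modulo [2 pi] by [kappa] times the difference of the [e sin] terms. Its
    contribution to that same difference is at most one quarter of it and is absorbed on the
    left. *)
Lemma r_plus_lipschitz e1 e2 : 0 < e1 < e0 -> 0 < e2 < e0 ->
  `|e1 * sin (gen_pt true 0 e1).1 - e2 * sin (gen_pt true 0 e2).1| <= 2 * `|e1 - e2| /\
  exists m1 m2 : int, `|((gen_pt true 0 e1).1 + 2 * pi * m1%:~R) - ((gen_pt true 0 e2).1 + 2 * pi * m2%:~R)|
     <= `|kap| * (2 * `|e1 - e2|).
Proof.
move=> h1 h2; have [[_ [m1 t1] _] [_ [m2 t2] _]] := (gen_ptP true 0 h1, gen_ptP true 0 h2).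
move: t1 t2; set s1 := (gen_pt _ _ e1).1; set s2 := (gen_pt _ _ e2).1.
rewrite /phase !(mulr0, mul0r) !addr0 => t1 t2.
pose g1 := s1 + 2 * pi * (- m1)%:~R; pose g2 := s2 + 2 * pi * (- m2)%:~R.
have gg : g1 - g2 = kap * (e1 * sin s1 - e2 * sin s2).
  by move: t1 t2; rewrite /g1 /g2 /twist !mulrNz; lra.
have sg : `|sin s1 - sin s2| <= `|g1 - g2|.
  by rewrite -(sinD2piz s1 (- m1)) -(sinD2piz s2 (- m2)); exact: sin_lip.
have [e20 e21] := andP h2.
have D : `|e1 * sin s1 - e2 * sin s2| <= 2 * `|e1 - e2|.
  have -> : e1 * sin s1 - e2 * sin s2 = (e1 - e2) * sin s1 + e2 * (sin s1 - sin s2) by ring.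
  have step : `|(e1 - e2) * sin s1 + e2 * (sin s1 - sin s2)| <=
      `|e1 - e2| + 1 / 4 * `|(e1 - e2) * sin s1 + e2 * (sin s1 - sin s2)|.
    apply: le_trans (ler_normD _ _) _; apply: lerD; first by rewrite normrM ler_piMr// sin_max.
    rewrite normrM (gtr0_norm e20); apply: le_trans (_ : e2 * `|g1 - g2| <= _).
      by rewrite ler_pM2l.
    rewrite gg (normrM kap) mulrA [e2 * _]mulrC.
    have -> : e1 * sin s1 - e2 * sin s2 = (e1 - e2) * sin s1 + e2 * (sin s1 - sin s2) by ring.
    by rewrite ler_wpM2r// hk'.
  have := normr_ge0 (e1 - e2); lra.
split=> //; exists (- m1), (- m2); rewrite -/g1 -/g2 gg normrM.
by rewrite ler_wpM2l.
Qed.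

Lemma r_plus_branch_gen_pt : r_plus_branch p q e0 (gen_pt true 0).
Proof.
split; [by move=> e h; exact: gens_gen_pt| |exact: gen_pt_cvg].
move=> e h; split.
- apply: (lipschitz_continuous (C := `|kap| * 2) h) => e' h'.
  have [_ [m1 [m2 hm]]] := r_plus_lipschitz h h'.
  rewrite -mulrA; apply: le_trans hm.
  by rewrite -(cosD2piz (gen_pt _ _ e).1 m1) -(cosD2piz (gen_pt _ _ e').1 m2); exact: cos_lip.
- apply: (lipschitz_continuous (C := `|kap| * 2) h) => e' h'.
  have [_ [m1 [m2 hm]]] := r_plus_lipschitz h h'.
  rewrite -mulrA; apply: le_trans hm.
  by rewrite -(sinD2piz (gen_pt _ _ e).1 m1) -(sinD2piz (gen_pt _ _ e').1 m2); exact: sin_lip.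
- apply: (lipschitz_continuous (C := 2 / p%:R * 2) h) => e' h'.
  have [D _] := r_plus_lipschitz h h'.
  have [[_ _ ->] [_ _ ->]] := (gen_ptP true 0 h, gen_ptP true 0 h').
  rewrite -mulrBl !(mulr0, mul0r) !add0r expr1.
  move: D; set x := e * _; set y := e' * _ => D.
  have -> : (2 * -1 * e * sin (gen_pt true 0 e).1 - 2 * -1 * e' * sin (gen_pt true 0 e').1) / p%:R =
     2 / p%:R * - (x - y) by rewrite /x /y; ring.
  rewrite normrM normrN ger0_norm ?divr_ge0// -[leRHS]mulrA ler_wpM2l// divr_ge0//.
Qed.

(** On [L_1] the point with [k = 0] stays near the parameter [0] and the others near [2 pi k / p];
    the barrier [pi / p] is never attained. *)
Lemma gen_pt_time_side b k e : 0 < e < e0 -> (gen_pt b k e).2 != pi / p%:R /\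
  ((gen_pt b k e).2 < pi / p%:R -> k = 0%N) /\ (k = 0%N -> (gen_pt b k e).2 < pi / p%:R).
Proof.
move=> h; have [h0 h1] := andP (he' h); have p2 := @pi_ge2 R.
have := gen_at_time p_gt0 (he' h) (gen_ptP b k h); move: (gen_pt b k e).2 => t ht.
have {}ht : `|t * p%:R - 2 * pi * k%:R| <= 2 * e.
  have -> : t * p%:R - 2 * pi * k%:R = (t - 2 * pi * k%:R / p%:R) * p%:R.
    by field; rewrite gt_eqF.
  by rewrite normrM (gtr0_norm pR) -ler_pdivlMr.
move: ht; rewrite ler_norml; case: k => [|k].
  rewrite mulr0 subr0 => hu; have tp : t < pi / p%:R by rewrite ltr_pdivlMr//; lra.
  by rewrite lt_eqF.
have : 2 * pi * 1 <= 2 * pi * k.+1%:R :> R by rewrite ler_pM2l ?ler1n//; lra.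
move: (2 * pi * k.+1%:R) => w hw hu.
have tp : pi / p%:R < t by rewrite ltr_pdivrMr//; lra.
by rewrite gt_eqF// lt_gtF.
Qed.

(** By its limit, a branch has [k = 0] for some smaller value of [e]. If it later had another [k],
    its second parameter would cross the barrier [pi / p] by the intermediate value theorem. *)
Lemma r_plus_branch_unique r' : r_plus_branch p q e0 r' ->
  forall e, 0 < e < e0 -> r' e = gen_pt true 0 e.
Proof.
move=> [gr' cr' lr'] e h; have p0 := @pi_gt0 R.
have /(gens_pt _ h)[k [b [kh k0 rE]]] := gr' _ h.
suff kE : k = 0%N by rewrite rE k0// kE.
have [s1 [s2 s3]] := gen_pt_time_side b k h.
apply: s2; rewrite -rE ltNge; apply/negP => ht.
have [e1 [he1 ue1]] : exists e1, 0 < e1 < e /\ cos_nbhd 0 (image_pt p q (r' e1)).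
  have hU : \forall e1 \near (0 : R)^'+, cos_nbhd 0 (image_pt p q (r' e1)).
    have hN : nbhs (x_pt p q 0 : pillow R) (cos_nbhd 0).
      by apply: open_nbhs_nbhs; split; [exact: open_cos1_nbhd|exact: x_pt_nbhd].
    exact: (lr' _ hN).
  have h1 : \forall e1 \near (0 : R)^'+, 0 < e1 by exact: nbhs_right_gt.
  have h2 : \forall e1 \near (0 : R)^'+, e1 < e by apply: nbhs_right_lt; case/andP: h.
  have [x [xU [x0 xe]]] :=
    @filter_ex _ _ (at_right_proper_filter (0 : R)) _ (filterI hU (filterI h1 h2)).
  by exists x; rewrite x0 xe.
have h1 : 0 < e1 < e0 by lra.
have ht1 : (r' e1).2 < pi / p%:R.
  have /(gens_pt _ h1)[k1 [b1 [kh1 k01 rE1]]] := gr' _ h1.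
  have [_ [_ t3]] := gen_pt_time_side b1 k1 h1.
  by rewrite rE1; apply: t3; apply/(cos_nbhd_pt b1 h1 kh1); rewrite // -rE1.
have e1e : e1 <= e by lra.
have [||e2 e2i e2t] := @IVT R (fun e => (r' e).2) e1 e (pi / p%:R) e1e.
- apply/subspace_continuousP => x /=; rewrite in_itv/= => hx.
  have hx' : 0 < x < e0 by lra.
  by have [_ _ cx] := cr' _ hx'; exact: cvg_within_filter cx.
- by rewrite ge_min le_max (ltW ht1) ht orbT.
rewrite in_itv/= in e2i; have h2 : 0 < e2 < e0 by lra.
have /(gens_pt _ h2)[k2 [b2 [_ _ rE2]]] := gr' _ h2.
by have [] := gen_pt_time_side b2 k2 h2; rewrite -rE2 e2t eqxx.
Qed.

Definition gen_seq (e : R) : seq (R * R) :=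
  gen_pt true 0 e :: [seq gen_pt b l e | b <- [:: true; false], l <- iota 1 p.-1./2].

Lemma gens_seq e : 0 < e < e0 -> gens p q e = [set` gen_seq e].
Proof.
move=> h; apply/seteqP; split=> x.
  move=> /(gens_pt _ h)[[|k] [b [kh k0 ->]]] /=; first by rewrite k0// inE eqxx.
  rewrite inE; apply/orP; right; apply/allpairsP; exists (b, k.+1); split=> //.
    by case: (b); rewrite !inE.
  by rewrite mem_iota /= add1n ltnS.
rewrite /= inE => /orP[/eqP->|/allpairsP[[b l] [_ /= lh ->]]]; first exact: gens_gen_pt.
by move: lh; rewrite mem_iota add1n ltnS => /andP[l0 lh]; apply: gens_gen_pt => // l0'; rewrite l0' in l0.
Qed.

Lemma gen_seq_uniq e : 0 < e < e0 -> uniq (gen_seq e).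
Proof.
move=> h; have lh l : l \in iota 1 p.-1./2 -> (0 < l <= p.-1./2)%N.
  by rewrite mem_iota add1n ltnS.
rewrite /gen_seq cons_uniq; apply/andP; split.
  apply/allpairsP => -[[b l] [_ /lh/= /andP[l0 lp]]].
  by move/(gen_pt_inj h (leq0n _) lp); case=> // [l0'|l0']; [rewrite l0' in l0|rewrite -l0' in l0].
apply: allpairs_uniq; [by []|exact: iota_uniq|].
have st (v : bool * nat) : v \in [seq (b, l) | b <- [:: true; false], l <- iota 1 p.-1./2] ->
    (0 < v.2 <= p.-1./2)%N.
  by case/allpairsP => -[b l] [_ /lh hl ->].
move=> [b l] [b' l'] /st/andP[/= l0 lp] /st/andP[/= l0' lp'] e12.
have [||-> ->//] := gen_pt_inj h lp lp' _ _ e12; first by move=> l0''; rewrite l0'' in l0.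
by move=> l0''; rewrite l0'' in l0'.
Qed.

Lemma card_gens e : 0 < e < e0 -> finite_set (gens p q e) /\
  #|{: fset_set (gens p q e)}| = p.
Proof.
move=> h; rewrite gens_seq//; split; first exact: finite_seq.
have -> : [set` gen_seq e] = [set` [fset x in gen_seq e]%fset].
  by apply/seteqP; split=> x /=; rewrite in_fset.
rewrite set_fsetK -cardfE card_fseq undup_id ?gen_seq_uniq//.
by rewrite /= size_cat !size_map size_iota size_cat /= ?size_map ?size_iota; lia.
Qed.

End Points.

(** * Absolute gradings and what determines them *)

Section GradingSolution.
Context {R : realType}.
Variables (p : nat) (q : int) (c e0 : R).
Local Notation phi := (@phase R p q).
Local Notation kap := (@kappa R p q).
Hypotheses (p_gt0 : (0 < p)%N) (p_odd : odd p) (pq_coprime : coprimez p%:Z q).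
Hypothesis hc : 0 < c <= 1.
Hypothesis sin_gap : forall k, (0 < k <= p.-1./2)%N -> c <= `|sin (phi k)|.
Hypothesis he : forall e, 0 < e < e0 -> 0 < e < c / 8.
Hypothesis hk : forall e, 0 < e < e0 -> `|kap| * e <= c / 4.
Variables (z : (R -> pillow R) -> 'Z_4) (z_class : represents_z z).
Variables (sigma : int) (e : R).
Hypothesis h : 0 < e < e0.

Local Notation Z0 := (zseg z (fun s : R^o => proj (L0_lift e s))).
Local Notation Z1 := (zseg z (fun t : R^o => proj (L1_lift p q t))).
Local Notation r := (gen_pt p q true 0 e).
Local Notation xp l := (gen_pt p q (sin (phi l) < 0) l e).
Local Notation xm l := (gen_pt p q (~~ (sin (phi l) < 0)) l e).

Let es := e_small hc (he h).

Let gen_gens (b : bool) k : (k <= p.-1./2)%N -> (k = 0%N -> b) -> gens p q e (gen_pt p q b k e).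
Proof. exact: (gens_gen_pt p_gt0 p_odd hc he hk h). Qed.

Let gx b l : (0 < l <= p.-1./2)%N -> gens p q e (gen_pt p q b l e).
Proof. by case: l => // l /andP[_ lh]; apply: gen_gens. Qed.

Let gr_r : gens p q e r. Proof. exact: gen_gens. Qed.

Let arc x : gens p q e x -> in_arc x.2.
Proof. exact: gens_arc. Qed.

Definition grading (x : R * R) : 'Z_4 := sigma%:~R + (Z0 x.1 r.1 + Z1 r.2 x.2).

Lemma grading_absolute : absolute_grading p q z sigma e r grading.
Proof.
split; last by rewrite /grading (Z0_xx z_class es) (Z1_xx z_class pq_coprime (arc gr_r)) !addr0.
move=> x y hx hy g; rewrite (is_gr_iff p_gt0 p_odd pq_coprime hc sin_gap (he h) (hk h) z_class _ hx hy).
suff -> : Z0 x.1 y.1 + Z1 y.2 x.2 = grading x - grading y by [].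
rewrite -(Z0_add z_class es x.1 r.1 y.1).
rewrite -(Z1_add z_class pq_coprime (arc hy) (arc gr_r) (arc hx)).
rewrite (Z0C z_class es y.1 r.1) (Z1C z_class pq_coprime (arc gr_r) (arc hy)) /grading.
ring.
Qed.

Lemma absolute_diff gr x y : absolute_grading p q z sigma e r gr -> gens p q e x -> gens p q e y ->
  gr x - gr y = Z0 x.1 y.1 + Z1 y.2 x.2.
Proof.
move=> [hgr _] hx hy; apply/esym/(hgr x y hx hy).
exact/(is_gr_iff p_gt0 p_odd pq_coprime hc sin_gap (he h) (hk h) z_class).
Qed.

Lemma grading_pair l : (0 < l <= p.-1./2)%N ->
  Z0 (xp l).1 (xm l).1 + Z1 (xm l).2 (xp l).2 = 1.
Proof.
by move=> hl; apply: (z_pair p_gt0 hc sin_gap (he h) (hk h) z_class hl);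
  exact: (gen_ptP hc he hk _ _ h).
Qed.

(** Conversely, the conditions fix [gr] on every generator: connecting paths exist, so the third
    condition determines the member of each pair selected by [xc], and the second one its partner.
    In the theorem [xc] is the slope test of [x_circ]. *)
Lemma absolute_iff (xc : nat -> bool) gr :
  absolute_grading p q z sigma e r gr <->
  [/\ gr r = sigma%:~R,
      forall l, (1 <= l <= p.-1./2)%N -> gr (xp l) - gr (xm l) = 1 &
      forall l, (1 <= l <= p.-1./2)%N -> forall alpha0 alpha1,
        connecting (L0_lift e) (L1_lift p q) r (if xc l then xp l else xm l) alpha0 alpha1 ->
        gr r - gr (if xc l then xp l else xm l) =
          z (connecting_loop (L0_lift e) (L1_lift p q) alpha0 alpha1)].
Proof.
have gc l : (0 < l <= p.-1./2)%N -> gens p q e (if xc l then xp l else xm l).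
  by case: (xc l) => hl; exact: gx.
split=> [ha|[h1 h2 h3]].
  split; first by case: ha.
  - by move=> l hl; rewrite (absolute_diff ha (gx _ hl) (gx _ hl)) grading_pair.
  - move=> l hl a0 a1 cn; rewrite (absolute_diff ha gr_r (gc _ hl)).
    by rewrite (connecting_z pq_coprime hc (he h) z_class gr_r (gc _ hl) cn).
have [hg hgr] := grading_absolute.
have circ l : (0 < l <= p.-1./2)%N -> gr (if xc l then xp l else xm l) = grading (if xc l then xp l else xm l).
  move=> hl; have [a0 [a1 [cn _]]] :=
    connecting_exists p_gt0 p_odd pq_coprime hc sin_gap (he h) (hk h) gr_r (gc _ hl).
  have := h3 l hl a0 a1 cn; rewrite (connecting_z pq_coprime hc (he h) z_class gr_r (gc _ hl) cn).
  by rewrite -(absolute_diff grading_absolute gr_r (gc _ hl)) h1 hgr => /addrI/oppr_inj.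
have eqg x : gens p q e x -> gr x = grading x.
  move=> /(gens_pt p_gt0 p_odd hc he hk _ h)[[|l] [b [lh l0 ->]]].
    by rewrite l0// h1 hgr.
  have hl : (0 < l.+1 <= p.-1./2)%N by [].
  have d1 := h2 _ hl.
  have := absolute_diff grading_absolute (gx (sin (phi l.+1) < 0) hl) (gx (~~ (sin (phi l.+1) < 0)) hl).
  rewrite grading_pair// -d1 => d2.
  have both : gr (xp l.+1) = grading (xp l.+1) /\ gr (xm l.+1) = grading (xm l.+1).
    have := circ _ hl; case: (xc _) => e1; split=> //.
      by move: d2; rewrite e1 => /addrI/oppr_inj.
    by move: d2; rewrite e1 => /addIr.
  by case: both; case: b {l0} (sin _ < 0) => [] [].
split=> // x y hx hy g; rewrite !eqg//; exact: hg.
Qed.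

End GradingSolution.

Theorem theorem7p1 (R : realType) (p : nat) (q : int)
    (p_gt0 : (0 < p)%N) (p_odd : odd p) (pq_coprime : coprimez p%:Z q)
    (cs : seq int) (K_cs : plumbing_of p%:Z q cs)
    (sigma : int) (K_sigma : is_knot_signature R cs sigma)
    (T : tangle_complement) (rho_ : R -> T -> quaternion R)
    (rho_param : parametrizes_R rho_)
    (rho_coord : forall t, 0 <= t <= pi ->
       has_coordinates (rho_ t) (L1_lift p q t))
    (z : (R -> pillow R) -> 'Z_4) (z_class : represents_z z) :
  [/\ linearly_embedded_arc 0 pi (fun t => restriction (rho_ t))
        (q - p%:Z)%:~R q%:~R,
      restricted_immersed_arc 0 pi (fun t => restriction (rho_ t)) &
      exists (e0 : R) (r : R -> R * R) (xp xm : nat -> R -> R * R),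
      [/\ 0 < e0,
          r_plus_branch p q e0 r /\
            (forall r', r_plus_branch p q e0 r' ->
               forall e, 0 < e < e0 -> r' e = r e),
          forall l, (1 <= l <= p.-1./2)%N ->
            x_branch p q true l e0 (xp l) /\ x_branch p q false l e0 (xm l) &
          forall e, 0 < e < e0 ->
          [/\ gens p q e =
                [set x | x = r e \/ exists2 l, (1 <= l <= p.-1./2)%N &
                                      x = xp l e \/ x = xm l e],
              \dim (fullv : {vspace C_complex p q e}) = p /\
                finite_set (gens p q e),
              (exists gr, absolute_grading p q z sigma e (r e) gr) /\
              (forall gr : R * R -> 'Z_4,
                 absolute_grading p q z sigma e (r e) gr <->
                 [/\ gr (r e) = sigma%:~R,
                     forall l, (1 <= l <= p.-1./2)%N ->
                       gr (xp l e) - gr (xm l e) = 1 &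
                     forall l, (1 <= l <= p.-1./2)%N ->
                       forall alpha0 alpha1,
                       connecting (L0_lift e) (L1_lift p q)
                         (r e) (x_circ p q xp xm l e) alpha0 alpha1 ->
                       gr (r e) - gr (x_circ p q xp xm l e) =
                         z (connecting_loop (L0_lift e) (L1_lift p q)
                              alpha0 alpha1)]),
              (forall x y, gens p q e x -> gens p q e y ->
                 finite_set (moduli (L0_lift e) (L1_lift p q) x y)) /\
              C_differential p q e = 0 &
              exists f : {linear C_complex p q e -> H_natural p q e},
                bijective f]]].
Proof.
have restrE t : 0 <= t <= pi -> restriction (rho_ t) = proj (L1_lift p q t).
  by move=> /rho_coord; exact: restrictionE.
have [lin1 lin2] := L1_linear (R := R) pq_coprime.
split.
- split.
    have [v0 [v [vn vd vt]]] := lin1; exists v0, v; split=> // t ht.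
    by rewrite restrE// vt.
  by move=> s t hs ht; rewrite !restrE//; exact: lin2.
- exact: (L1_restricted pq_coprime restrE).
have [c hc [sin_gap cos_gap]] := phase_gap (R := R) p_gt0 p_odd pq_coprime.
have [c0 c1] := andP hc.
(* [N] is at least [1] and [|q|], and [2 N] is at least [|kappa|]; hence the single inequality
   [2 * N * e < c / 4] yields all the smallness conditions on [e]. *)
pose N : R := `|q%:~R| + p%:R.
have p1 : 1 <= p%:R :> R by rewrite (ler_nat R 1).
have N1 : 1 <= N by rewrite -[leLHS]add0r lerD.
pose e0 := c / (8 * N).
have N0 : 0 < 8 * N by rewrite mulr_gt0// (lt_le_trans ltr01).
have e0_gt0 : 0 < e0 by rewrite divr_gt0.
have eN e : 0 < e < e0 -> 0 < e /\ 2 * N * e < c / 4.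
  by move=> /andP[h0]; rewrite ltr_pdivlMr// => h1; split=> //; lra.
have he e : 0 < e < e0 -> 0 < e < c / 8.
  by move=> /eN[h0 h1]; rewrite h0 /=; have : e <= N * e by [rewrite ler_peMl// ltW]; lra.
have kN : `|kappa p q : R| <= 2 * N.
  rewrite /kappa normrM normfV normr_nat ler_pdivrMr ?(lt_le_trans ltr01)//.
  apply: le_trans (_ : 2 * N * 1 <= _); last first.
    by rewrite ler_wpM2l// mulr_ge0// (le_trans ler01).
  rewrite mulr1 intrB intrM; apply: le_trans (ler_normB _ _) _.
  by rewrite normrM !normr_nat /N; lra.
have hk e : 0 < e < e0 -> `|kappa p q| * e <= c / 4.
  by move=> /eN[h0 /ltW]; apply: le_trans; rewrite ler_pM2r.
have hq e : 0 < e < e0 -> `|q%:~R| * (2 * e / p%:R) <= c / 4.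
  move=> /eN[h0 /ltW]; apply: le_trans.
  rewrite [2 * N]mulrC -[leRHS]mulrA; apply: ler_pM => //.
  - by rewrite divr_ge0// mulr_ge0// ltW.
  - by rewrite lerDl.
  - by rewrite ler_pdivrMr ?(lt_le_trans ltr01)// ler_peMr// mulr_ge0// ltW.
pose xp l (e : R) := gen_pt p q (sin (phase p q l : R) < 0) l e.
pose xm l (e : R) := gen_pt p q (~~ (sin (phase p q l : R) < 0)) l e.
exists e0, (gen_pt p q true 0), xp, xm; split; first exact: e0_gt0.
- split; first exact: (r_plus_branch_gen_pt p_gt0 p_odd hc e0_gt0 he hk).
  exact: (r_plus_branch_unique p_gt0 p_odd hc cos_gap he hk hq).
- have xb := x_branch_gen_pt p_gt0 p_odd hc sin_gap cos_gap e0_gt0 he hk hq.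
  by move=> l hl; split; [have := xb true l hl|have := xb false l hl];
    rewrite /xp /xm; case: (sin _ < 0).
move=> e h; have [h0 h1] := eN e h; have es := e_small hc (he e h).
have nb x y u : ~ is_bigon (L0_lift e) (L1_lift p q) x y u.
  apply: no_bigon => //; last first.
    by have /andP[-> /= /lt_trans] := es; apply; lra.
  have -> : `|(2 * q - p%:Z)%:~R : R| = `|kappa p q| * p%:R.
    by rewrite -[in RHS](normr_nat R p) -normrM divfK// pnatr_eq0 -lt0n.
  rewrite mulrAC gtr_pMl ?ltr0n//; apply: le_lt_trans (hk e h) _; lra.
have [finM d0] := differential_eq0 nb.
have [fin card] := card_gens p_gt0 p_odd pq_coprime hc sin_gap cos_gap e0_gt0 he hk hq h.
split.
- apply/seteqP; split=> x.
    move=> /(gens_pt p_gt0 p_odd hc he hk _ h)[[|l] [b [lh l0 ->]]]; first by left; rewrite l0.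
    right; exists l.+1 => //; rewrite /xp /xm.
    by case: b {l0} (sin _ < 0) => [] []; auto.
  have gp (b : bool) l : (0 < l <= p.-1./2)%N -> gens p q e (gen_pt p q b l e).
    by case: l => // l /andP[_ lh]; apply: (gens_gen_pt p_gt0 p_odd hc he hk h).
  move=> [->|[l hl [->|->]]]; [|exact: gp|exact: gp].
  exact: (gens_gen_pt p_gt0 p_odd hc he hk h).
- by split=> //; rewrite -[RHS]card; exact: dim_chains.
- split.
    exists (grading p q z sigma e); exact: (grading_absolute p_gt0 p_odd pq_coprime hc sin_gap he hk z_class sigma h).
  move=> gr; rewrite /x_circ.
  have := absolute_iff p_gt0 p_odd pq_coprime hc sin_gap he hk z_class sigma h
     (fun=> 1 < `|(q - p%:Z)%:~R / q%:~R : R|) gr.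
  by case: ifP.
- split=> //; exact: d0.
- exact: (homology_zero d0).
Qed.
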